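(* Assume $\mu$ satisfies $(\mathrm H_\mu)$, let $Y$ be $\mu$-distributed, let $(a_n)_{n\ge1}$ be any sequence with $n\mathbf P(Y\ge a_n)\to1$, and set \[ h_n=\int_1^{n\mathbf E[Y\mathbf 1_{\{Y\ge a_n\}}]}\frac{\mathrm dx}{x\,\mathbf E[Y\mathbf 1_{\{Y\ge x\}}]}. \] Then, in probability as $n\to\infty$, \[ \frac{\mathsf{Height}(\mathrm T_n)}{h_n}\to1\qquad\text{and}\qquad\frac{\mathsf{Width}(\mathrm T_n)}{n\,\mathbf E[Y\mathbf 1_{\{Y\ge a_n\}}]}\to1. \]
   Context: Condition $(\mathrm H_\mu)$: $\mu=(\mu_k)_{k\ge0}$ is a probability measure on $\mathbb Z_+$ with $\sum_k k\mu_k=1$, and there is a slowly varying function $L:\mathbb R_+\to\mathbb R_+$ (i.e. $L(cx)/L(x)\to1$ as $x\to\infty$ for every $c>0$) with $\mu_n=L(n)/n^2$ for all $n\ge1$. $\mathrm T$ is a $\mu$-Bienaymé tree (family tree of a Galton–Watson process with offspring law $\mu$ started from one individual) and $\mathrm T_n$ is $\mathrm T$ conditioned to have exactly $n$ vertices (limits are along $n$ with $\mathbf P(|\mathrm T|=n)>0$). $\mathsf{Height}$ is the maximal distance of a vertex from the root; $\mathsf{Width}$ is the maximal number of vertices in one generation. *)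

(* Defs.v *)
From HB Require Import structures.
From mathcomp Require Import all_boot all_order all_algebra.
From mathcomp Require Import all_classical all_reals all_analysis.
Set Implicit Arguments. Unset Strict Implicit. Unset Printing Implicit Defensive.
Import Order.TTheory GRing.Theory Num.Theory.
Import numFieldNormedType.Exports.
Local Open Scope classical_set_scope.
Local Open Scope ring_scope.

Inductive tree : Type := Node of seq tree.

Definition children (t : tree) : seq tree := let: Node ts := t in ts.

Fixpoint tsize (t : tree) : nat :=
  let: Node ts := t in (sumn (map tsize ts)).+1.

Fixpoint height (t : tree) : nat :=
  let: Node ts := t in foldr maxn 0%N (map (fun s => (height s).+1) ts).

Fixpoint gen (t : tree) (k : nat) : nat :=
  let: Node ts := t in
  match k with 0 => 1%N | k'.+1 => sumn (map (fun s => gen s k') ts) end.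

(* Width: maximal number of vertices in one generation
   (all generations of depth >= tsize t are empty) *)
Definition width (t : tree) : nat := \max_(k < tsize t) gen t k.

Fixpoint tree_enc (t : tree) : GenTree.tree nat :=
  let: Node ts := t in GenTree.Node 0 (map tree_enc ts).
Fixpoint tree_dec (g : GenTree.tree nat) : tree :=
  match g with
  | GenTree.Leaf _ => Node [::]
  | GenTree.Node _ gs => Node (map tree_dec gs)
  end.
Lemma tree_encK : cancel tree_enc tree_dec.
Proof.
red; fix IH 1; move=> [ts] /=; congr Node.
elim: ts => [|s ts IHts] //=; by rewrite IH IHts.
Qed.
HB.instance Definition _ := Countable.copy tree (can_type tree_encK).

Section GW.
Variable R : realType.
Variable mu : nat -> R.

(* P(T = t) = prod over vertices v of t of mu(k_v), k_v = number of children *)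
Fixpoint tweight (t : tree) : R :=
  let: Node ts := t in
  mu (size ts) * foldr (fun s acc => s * acc) 1 (map tweight ts).

Definition PGW (A : set tree) : R := fine (\esum_(t in A) (tweight t)%:E)%E.

(* P(T_n in A) = P(T in A | |T| = n) *)
Definition condP (n : nat) (A : set tree) : R :=
  PGW [set t | tsize t = n /\ A t] / PGW [set t | tsize t = n].

Definition tailP (x : R) : R := fine (\sum_(k <oo | (x <= k%:R)%R) (mu k)%:E)%E.
Definition tailE (x : R) : R :=
  fine (\sum_(k <oo | (x <= k%:R)%R) (k%:R * mu k)%:E)%E.

End GW.

Definition slowly_varying (R : realType) (L : R -> R) : Prop :=
  measurable_fun setT L /\
  forall c : R, 0 < c -> (L (c * x) / L x) @[x --> +oo] --> (1 : R).

Definition H_mu (R : realType) (mu : nat -> R) : Prop :=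
  (forall k, 0 <= mu k) /\
  (\sum_(0 <= k < N) mu k) @[N --> \oo] --> (1 : R) /\
  (\sum_(0 <= k < N) k%:R * mu k) @[N --> \oo] --> (1 : R) /\
  exists L : R -> R, (forall x, 0 <= x -> 0 <= L x) /\ slowly_varying L /\
    forall n : nat, (1 <= n)%N -> mu n = L n%:R / (n%:R ^+ 2).

Definition hseq (R : realType) (mu : nat -> R) (a : nat -> R) (n : nat) : R :=
  fine (\int[lebesgue_measure]_(x in `[1%R, (n%:R * tailE mu (a n))%R])
          ((x * tailE mu x)^-1)%:E)%E.

Definition cvg_prob_to1 (R : realType) (mu : nat -> R) (X : nat -> tree -> R) : Prop :=
  forall eps delta : R, 0 < eps -> 0 < delta ->
    exists N : nat, forall n : nat, (N <= n)%N ->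
      0 < PGW mu [set t | tsize t = n] ->
      condP mu n [set t | eps < `|X n t - 1|] < delta.

(* Main.v *)
Require Import Defs.
From HB Require Import structures.
From mathcomp Require Import all_boot all_order all_algebra.
From mathcomp Require Import all_classical all_reals all_analysis.
From mathcomp Require Import measurable_realfun.
From mathcomp Require Import zify ring lra.
(* Let [B n] be [n E[Y; Y >= a_n]] rounded up. Since the mean is one
   and the tail is slowly varying, [n E[Y; Y >= B n] ~ B n]: a walk with steps
   [Y - 1], killed at its first jump comparable to [B n], drifts down to [- B n] in
   [n] steps like a straight line (Chernoff bounds for truncated steps, made uniform in
   time by Ottaviani's inequality). Hence the cheapest way of ending at [-1] is a
   single jump close to [B n], and all others are negligible.

   A tree of size [n] is coded by its depth-first or breadth-first word of
   offspring numbers, and the cycle lemma lets one rotate the code so that the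
   big letter comes first; the remaining [n - 1] letters are then i.i.d. up to
   a bounded density. The width is thus [B n] up to the fluctuations of the walk. The
   height is that of a forest of about [B n] independent Bienayme trees: the
   probability [Q h] of reaching height [h] satisfies [Q h - Q (h + 1) ~ Q h E[Y; Y >= 1 / Q h]],
   so the integral [Gr] defining [h_n] satisfies [Gr (1 / Q h) ~ h], and [B n * Q h] passes
   from large to small values around [h = Gr (B n)]. What sits above the
   big vertex has height of order [n / B n], which is negligible compared to [h_n]. *)
Set Implicit Arguments. Unset Strict Implicit. Unset Printing Implicit Defensive.
Import Order.TTheory GRing.Theory Num.Theory.
Import numFieldNormedType.Exports.
Local Open Scope classical_set_scope.
Local Open Scope ring_scope.

(** No sharp local limit theorem is proved. The event of having size [n] has probability at least
    [mu (B n) / 64], and every bad event gets the bound [kappa * mu (B n)] with [kappa] arbitrary,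
    so absolute factors are harmless in the conditional probability and are kept crude throughout.

    The obstacle is the upper bound for words of sum [n - 1] without a letter near [B n]. A Chernoff
    bound for letters below [B n / K] yields only a small constant, whereas [n * mu (B n)] tends to
    zero. The truncation level is therefore raised by doubling from a fixed one. A letter between
    [C] and [2 * C] has weight at most of order [(B n / C)^3 * mu (B n)], and the rest of the word
    must then stay far above its drift, which has probability of order at most [(C / B n)^4]. The
    product leaves one factor [C / B n], so the errors form a geometric sum dominated by the last
    level. *)

Local Notation tsize := Defs.tsize.

(** * Lukasiewicz words, their rotations, and heights read on words *)

Section Words.
Local Open Scope nat_scope.

(** Lukasiewicz words: the walk with steps [y - 1] stays nonnegative before the last letter and ends
    at [-1]. Indices are moved across the inequalities so that nothing is subtracted in [nat]. *)
Definition luk (w : seq nat) : bool :=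
  ((sumn w).+1 == size w) &&
  all (fun j => j <= sumn (take j w)) (iota 0 (size w)).

Lemma lukP w : reflect ((sumn w).+1 = size w /\
  forall j, j < size w -> j <= sumn (take j w)) (luk w).
Proof.
apply: (iffP andP) => -[/eqP h1 h2]; split => //.
- by move=> j jn; apply: (allP h2); rewrite mem_iota.
- by apply/allP => j; rewrite mem_iota /= add0n; apply: h2.
Qed.

Lemma sumn_take_drop k (w : seq nat) : sumn (take k w) + sumn (drop k w) = sumn w.
Proof. by rewrite -sumn_cat cat_take_drop. Qed.

Lemma sumn_rot k (w : seq nat) : sumn (rot k w) = sumn w.
Proof. by rewrite /rot sumn_cat addnC sumn_take_drop. Qed.

(** For [i < j], the letters from [i] to [j] form a proper prefix of the first rotation and the
    other letters a proper prefix of the second. Both pieces would have a nonnegative walk, whereas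
    the total is [-1]. *)
Lemma luk_rot_uniq w i j : i < size w -> j < size w ->
  luk (rot i w) -> luk (rot j w) -> i = j.
Proof.
wlog ij : i j / i <= j => [H hi hj li lj|].
  by case/orP: (leq_total i j) => /H e; [apply: e|apply/esym/e].
move=> hi hj /lukP [si li] /lukP [sj lj].
apply/eqP; rewrite eqn_leq ij leqNgt; apply/negP => ltij.
rewrite !size_rot in si li sj lj.
have := li (j - i) ltac:(lia).
have := lj (size w - (j - i)) ltac:(lia).
have -> : rot j w = rot (j - i) (rot i w).
  by rewrite -rotD ?subnK // ltnW.
set v := rot i w in si *.
have sv : size v = size w by rewrite size_rot.
rewrite /rot take_size_cat ?size_drop ?sv; last by lia.
have := sumn_take_drop (j - i) v; lia.
Qed.

(** The good starting point is the first time at which the walk attains its minimum. *)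
Lemma luk_rot_exists w : (sumn w).+1 = size w ->
  exists2 i, i < size w & luk (rot i w).
Proof.
move=> sw; set n := size w in sw *.
have n0 : 0 < n by lia.
(* Lexicographic order: first the level of the walk, raised by [n] to stay in [nat], then the index,
   which is below [n.+1]. *)
pose key (j : 'I_n) := (sumn (take j w) + (n - j)) * n.+1 + j.
case: (@arg_minnP _ (Ordinal n0) xpredT key) => // i _ imin.
exists (nat_of_ord i) => [|]; first exact: ltn_ord.
apply/lukP; rewrite size_rot sumn_rot; split=> // j jn.
have Hk k (kn : k < n) :
  sumn (take i w) + (n - i) <= sumn (take k w) + (n - k) /\
  (k < i -> sumn (take i w) + (n - i) < sumn (take k w) + (n - k)).
  have := imin (Ordinal kn) isT; rewrite /key /=; have := ltn_ord i.
  move: (sumn _ + _) (sumn _ + _) => x y; split; first by nia.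
  by move=> ki; nia.
have iin := ltn_ord i.
have [jn'|jn'] := ltnP (i + j) n.
  have [+ _] := Hk _ jn'.
  rewrite /rot takel_cat ?size_drop -/n; last by lia.
  have -> : take (i + j) w = take i w ++ take j (drop i w) by rewrite takeD.
  rewrite sumn_cat; lia.
have [/eqP jE|jE] := boolP (i + j == n).
  have [_] := Hk 0 n0; rewrite take0 /= => /(_ ltac:(lia)).
  rewrite /rot take_size_cat; last by rewrite size_drop -/n; lia.
  have := sumn_take_drop i w; lia.
have [_ /(_ ltac:(lia))] := Hk (i + j - n) ltac:(lia).
have -> : take j (rot i w) = drop i w ++ take (i + j - n) w.
  rewrite /rot take_cat size_drop -/n ifF; last by apply/negbTE; rewrite -leqNgt; lia.
  congr cat; rewrite take_takel; last by lia.
  congr take; lia.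
rewrite sumn_cat; have := sumn_take_drop i w; lia.
Qed.

(* With [S] the walk of steps [y - 1], [mindepth w = - min_{j <= size w} S_j]. *)
Fixpoint mindepth (w : seq nat) : nat :=
  if w is y :: s then (mindepth s).+1 - y else 0.

Lemma mindepth_leP m w :
  mindepth w <= m <-> forall j, j <= size w -> j <= m + sumn (take j w).
Proof.
elim: w m => [|y s IH] m /=.
  by split=> // _ j; rewrite leqn0 => /eqP ->.
have -> : ((mindepth s).+1 - y <= m) = (mindepth s <= (m + y).-1) && (0 < m + y).
  by lia.
split.
  move=> /andP[/IH h h0] [|j] //= /h; lia.
move=> h; apply/andP; split; last by have := h 1 isT; rewrite /= take0 /=; lia.
apply/IH => j js; have := h j.+1 js; rewrite /=; lia.
Qed.

Lemma mindepth_ge w m j : j <= size w -> m + sumn (take j w) <= j -> m <= mindepth w.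
Proof.
move=> js h; have /mindepth_leP /(_ _ js) := leqnn (mindepth w); lia.
Qed.

Lemma mindepth_cat_ge u v : mindepth u <= mindepth (u ++ v).
Proof.
apply/mindepth_leP => j ju.
have /mindepth_leP /(_ j) := leqnn (mindepth (u ++ v)).
by rewrite size_cat takel_cat //; apply; rewrite (leq_trans ju) ?leq_addr.
Qed.

(* For [w] a proper prefix of a depth-first word, this is the height of the
   next vertex: its ancestors are the letters from which the walk stays
   nonnegative up to the end of [w]. *)
Fixpoint depth (w : seq nat) : nat :=
  if w is y :: s then (mindepth w == 0) + depth s else 0.

Lemma depth_suffix u v : depth v <= depth (u ++ v).
Proof. by elim: u => [|y u IH] //=; apply: leq_trans IH _; rewrite leq_addl. Qed.

(** A letter of [u] from which the walk stays nonnegative up to the end of [u ++ v] already had this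
    property up to the end of [u]. *)
Lemma depth_cat u v : depth (u ++ v) <= depth u + depth v.
Proof.
elim: u => [|y u IH] //=; rewrite -addnA leq_add //.
by have := mindepth_cat_ge (y :: u) v => /=; do 2 case: eqP => //; lia.
Qed.

(* [st] lists target heights for the trees still to be explored: [reach] holds
   when some explored vertex attains the target of its tree, [fin] when all
   trees are completely explored without this happening. *)
Fixpoint reach (w st : seq nat) : bool :=
  match w, st with
  | y :: w', h :: st' => if h is h'.+1 then reach w' (nseq y h' ++ st') else true
  | _, _ => false
  end.

Fixpoint fin (w st : seq nat) : bool :=
  match st, w with
  | [::], _ => true
  | h :: st', y :: w' => if h is h'.+1 then fin w' (nseq y h' ++ st') else false
  | _, [::] => false
  end.

Lemma fin_nil w : fin w [::]. Proof. by case: w. Qed.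

Lemma fin_cat u v st : fin u st -> fin (u ++ v) st.
Proof.
elim: u st => [|y u IH] [|[|h] st] //=; first by rewrite fin_nil.
exact: IH.
Qed.

(** After [k] letters, [mindepth] counts the trees completely explored, hence is the index of the
    current one, and [depth] is the height of the next vertex inside that tree. *)
Lemma reachP w st : reach w st <-> exists k, [/\ k < size w,
  mindepth (take k w) < size st & nth 0 st (mindepth (take k w)) <= depth (take k w)].
Proof.
elim: w st => [|y w IH] [|[|h] st] /=.
- by split=> // -[k []].
- by split=> // -[k []].
- by split=> // -[k []].
- by split=> // -[k []].
- by split=> // _; exists 0.
rewrite IH; split.
- move=> [k [kw]]; rewrite size_cat size_nseq nth_cat size_nseq => km hk.
  exists k.+1; split=> //=; first by lia.
  move: hk; case: ltnP => my.
    rewrite nth_nseq my => hk.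
    have -> : (mindepth (take k w)).+1 - y = 0 by lia.
    by rewrite eqxx.
  by rewrite subSn //= => hk; rewrite eqn0Ngt.
- move=> [[|k] [kw]] //=; rewrite ltnS => km hk.
  exists k; split=> //; first by rewrite size_cat size_nseq; lia.
  rewrite nth_cat size_nseq; case: ltnP => my.
    have E : (mindepth (take k w)).+1 - y = 0 by lia.
    by move: hk; rewrite nth_nseq my E.
  by move: hk; rewrite subSn.
Qed.

Lemma fin_not_reach w st : ~~ reach w st -> size st <= mindepth w -> fin w st.
Proof.
elim: w st => [|y w IH] [|[|h] st] //= nr sz; apply: IH => //.
rewrite size_cat size_nseq; lia.
Qed.

End Words.

(** * Depth-first and breadth-first codings of trees *)

Section Coding.
Local Open Scope nat_scope.

Lemma tree_ind_mem (P : tree -> Prop) :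
  (forall ts : seq tree, (forall t, t \in ts -> P t) -> P (Node ts)) -> forall t, P t.
Proof.
move=> H; fix IH 1; case=> ts; apply: H.
elim: ts => [|s ts IHts] t; first by rewrite in_nil => h; case: (notF h).
by rewrite inE => /orP[/eqP ->|]; [exact (IH s)|exact (IHts t)].
Qed.

Fixpoint dfs_word (t : tree) : seq nat :=
  let: Node ts := t in size ts :: flatten (map dfs_word ts).

Lemma size_dfs_forest (ts : seq tree) : (forall t, t \in ts -> size (dfs_word t) = tsize t) ->
  size (flatten (map dfs_word ts)) = sumn (map tsize ts).
Proof.
elim: ts => [|t ts IH] //= H; rewrite size_cat H ?mem_head // IH // => s sts.
by rewrite H // inE sts orbT.
Qed.

Lemma size_dfs_word t : size (dfs_word t) = tsize t.
Proof. by elim/tree_ind_mem: t => ts IH /=; rewrite size_dfs_forest. Qed.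

Lemma dfs_word_sum t : (sumn (dfs_word t)).+1 = tsize t.
Proof.
elim/tree_ind_mem: t => ts IH /=; congr _.+1.
elim: ts IH => [|t ts IHts] //= H; rewrite sumn_cat.
have := H t (mem_head _ _).
have := IHts (fun s hs => H s ltac:(by rewrite inE hs orbT)).
lia.
Qed.

Lemma dfs_word_prefix t w : forall j, j < size (dfs_word t) ->
  j <= sumn (take j (dfs_word t ++ w)).
Proof.
elim/tree_ind_mem: t w => ts IH w [|j] //=; rewrite ltnS => js.
elim: ts IH j js => [|t ts IHts] //= H j.
rewrite size_cat => js; rewrite -catA.
have [jt|jt] := ltnP j (size (dfs_word t)).
  have := H t (mem_head _ _) (flatten (map dfs_word ts) ++ w) _ jt; lia.
have -> : j = size (dfs_word t) + (j - size (dfs_word t)) by lia.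
rewrite takeD take_size_cat // drop_size_cat // sumn_cat.
have := IHts (fun s hs => H s ltac:(by rewrite inE hs orbT)) (j - size (dfs_word t)) ltac:(lia).
have := dfs_word_sum t; rewrite -size_dfs_word; lia.
Qed.

Lemma dfs_word_luk t : luk (dfs_word t).
Proof.
apply/lukP; split; first by rewrite dfs_word_sum size_dfs_word.
by move=> j /(@dfs_word_prefix t [::]); rewrite cats0.
Qed.

Lemma dfs_word_cat_inj t t' w w' :
  dfs_word t ++ w = dfs_word t' ++ w' -> t = t' /\ w = w'.
Proof.
elim/tree_ind_mem: t t' w w' => ts IH [ts'] w w' /= [sz].
suff : flatten (map dfs_word ts) ++ w = flatten (map dfs_word ts') ++ w' ->
    ts = ts' /\ w = w' by move=> H /H[-> ->].
elim: ts ts' sz IH => [|t ts IHts] [|t' ts'] //= [sz] H; rewrite -!catA.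
move=> /(H t (mem_head _ _)) [-> E].
have [|-> ->] // := IHts ts' sz _ E.
by move=> s hs; apply: H; rewrite inE hs orbT.
Qed.

Lemma dfs_word_inj : injective dfs_word.
Proof.
by move=> t t' /(congr1 (cat^~ [::])) /dfs_word_cat_inj [].
Qed.

(** Decoding from the right: the first letter [y] replaces the [K] trees still to be read by
    [K.-1 + y] trees, and in the forest obtained for the rest of the word the first [y] trees become
    the children of one root. *)
Lemma dfs_forest_surj n K w : size w <= n ->
  (forall j, j < size w -> j < K + sumn (take j w)) -> K + sumn w = size w ->
  exists2 ts, size ts = K & flatten (map dfs_word ts) = w.
Proof.
elim: n K w => [|n IH] K [|y w] //.
- by move=> _ _ /=; rewrite addn0 => ->; exists [::].
- by move=> _ _ /=; rewrite addn0 => ->; exists [::].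
rewrite /= ltnS => sw hw hs.
have K0 : 0 < K by have := hw 0 isT; rewrite addn0.
have [j js||ts szt ets] := IH (K.-1 + y) w sw.
- by have := hw j.+1 js => /=; lia.
- lia.
exists (Node (take y ts) :: drop y ts).
  by rewrite /= size_drop szt; lia.
rewrite /= size_takel ?szt; last by lia.
by rewrite -flatten_cat -map_cat cat_take_drop ets.
Qed.

Lemma luk_dfs_word w : luk w -> exists t, dfs_word t = w.
Proof.
move=> /lukP[sw hw].
have [j js||ts] := @dfs_forest_surj (size w) 1 w (leqnn _).
- by have := hw j js; lia.
- lia.
by case: ts => [|t [|]] //= _; rewrite cats0 => <-; exists t.
Qed.

(** The code of one tree uses up exactly one target of the stack. Arbitrary [w] and [st] are kept
    because the children of a vertex are explored one after the other. *)
Lemma reach_dfs_word t w h st :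
  reach (dfs_word t ++ w) (h :: st) = (h <= height t) || reach w st.
Proof.
elim/tree_ind_mem: t w h st => ts IH w [|h] st //=.
elim: ts IH st => [|t ts IHts] //= H st.
rewrite -catA H ?mem_head // IHts; last by move=> s hs; apply: H; rewrite inE hs orbT.
by rewrite leq_max ltnS orbA.
Qed.

Lemma height_geP t h : h <= height t <-> exists2 k, k < tsize t & h <= depth (take k (dfs_word t)).
Proof.
have := reach_dfs_word t [::] h [::]; rewrite cats0 /= orbF => <-.
rewrite reachP size_dfs_word; split.
  move=> [k [kt]] /=; rewrite ltnS leqn0 => /eqP -> /= hk; by exists k.
move=> [k kt hk]; exists k; have -> : mindepth (take k (dfs_word t)) = 0.
  apply/eqP; rewrite -leqn0; apply/mindepth_leP => j.
  rewrite size_takel ?size_dfs_word; last by lia.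
  move=> jk; rewrite take_takel // add0n.
  have /lukP[_] := dfs_word_luk t; apply; rewrite size_dfs_word; lia.
by split.
Qed.

(** For a vertex met before the letter [d], putting [s] in front of its prefix only raises [depth],
    so [m] bounds its height. For a later vertex, the ancestors in [p] number at most
    [depth (s ++ p)], the letter [d] accounts for at most one, and those in [s] for at most [m]. *)
Lemma height_le_rot t p d s m : dfs_word t = p ++ d :: s ->
  (forall k, k < size (s ++ p) -> depth (take k (s ++ p)) <= m) ->
  height t <= depth (s ++ p) + 1 + m.
Proof.
move=> E H; have /height_geP[k] := leqnn (height t).
rewrite -size_dfs_word E size_cat /= => kt hk; apply: leq_trans hk _.
rewrite take_cat; case: ltnP => kp.
  have := H (size s + k); rewrite size_cat ltn_add2l => /(_ kp).
  rewrite take_cat ltnNge leq_addr /= addKn => H'.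
  have := depth_suffix s (take k p); lia.
have := depth_cat p (take (k - size p) (d :: s)).
have := depth_suffix s p.
case jk: (k - size p) => [|j] /=; first by lia.
have := H j; rewrite size_cat takel_cat; last by lia.
move=> /(_ ltac:(lia)); case: eqP => _; lia.
Qed.

(** The walk is nonnegative after [p] and ends at [-1], so it falls by at least [d] along [s]: the
    trees above the vertex with [d] children are explored within [s], and each of them is lower than
    [t]. *)
Lemma height_lt_fin t p d s K h : dfs_word t = p ++ d :: s ->
  height t < h -> K <= d -> fin (s ++ p) (nseq K h).
Proof.
move=> E hh Kd; apply: fin_cat; apply: fin_not_reach.
  apply/negP => /reachP[k [ks]]; rewrite size_nseq => mk.
  rewrite nth_nseq mk => hk.
  have : h <= height t.
    apply/height_geP; exists (size p + k.+1).
      by rewrite -size_dfs_word E size_cat /=; lia.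
    rewrite E take_cat ltnNge leq_addr /= addKn /=.
    apply: leq_trans hk _; rewrite -cat_rcons; exact: depth_suffix.
  by rewrite leqNgt hh.
rewrite size_nseq; apply: (@mindepth_ge _ _ (size s)) => //; rewrite take_size.
have /lukP[sw /(_ (size p))] := dfs_word_luk t.
rewrite E take_size_cat // size_cat /= in sw *; move=> /(_ ltac:(lia)).
rewrite sumn_cat /= in sw; lia.
Qed.

Definition forest_size (f : seq tree) := sumn (map tsize f).
Definition offspring (f : seq tree) := map (fun t => size (children t)) f.
Definition next_gen (f : seq tree) := flatten (map children f).

(** Here [k] is fuel counted in generations. A bound on the number of vertices is enough fuel, since
    each nonempty generation contains a vertex. *)
Fixpoint bfs_word (k : nat) (f : seq tree) : seq nat :=
  if k is k'.+1 then offspring f ++ bfs_word k' (next_gen f) else [::].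

Lemma forest_size_next f : forest_size f = size f + forest_size (next_gen f).
Proof.
rewrite /forest_size /next_gen; elim: f => [|[ts] f IH] //=.
rewrite map_cat sumn_cat IH; lia.
Qed.

Lemma size_next_gen f : size (next_gen f) = sumn (offspring f).
Proof. by rewrite size_flatten /shape -map_comp. Qed.

Lemma forest_size_next_le k f : forest_size f <= k.+1 -> forest_size (next_gen f) <= k.
Proof. case: f => [|t f] //; rewrite (forest_size_next (t :: f)) /=; lia. Qed.

Lemma size_bfs_word k f : forest_size f <= k -> size (bfs_word k f) = forest_size f.
Proof.
elim: k f => [|k IH] f /=; first by rewrite leqn0 => /eqP.
move=> /forest_size_next_le /IH E.
by rewrite size_cat E (forest_size_next f) size_map.
Qed.

Lemma bfs_word_sum k f : forest_size f <= k -> size f + sumn (bfs_word k f) = forest_size f.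
Proof.
elim: k f => [|k IH] f /=; first by case: f => [|[]].
move=> /forest_size_next_le /IH.
rewrite sumn_cat (forest_size_next f) -size_next_gen; lia.
Qed.

Lemma bfs_word_prefix k f : forest_size f <= k ->
  forall j, j < size (bfs_word k f) -> j < size f + sumn (take j (bfs_word k f)).
Proof.
elim: k f => [|k IH] f //= /forest_size_next_le /IH H j.
rewrite size_cat take_cat size_map => js; case: (ltnP j (size f)) => jf; first by lia.
rewrite sumn_cat -size_next_gen; have := H (j - size f); lia.
Qed.

(** A generation is recovered from the next one by cutting the latter into blocks whose lengths are
    the offspring numbers. *)
Lemma bfs_word_inj k f f' : forest_size f <= k -> forest_size f' <= k ->
  size f = size f' -> bfs_word k f = bfs_word k f' -> f = f'.
Proof.
elim: k f f' => [|k IH] f f' /=.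
  by case: f => [|[]] //; case: f' => [|[]].
move=> /forest_size_next_le hf /forest_size_next_le hf' sz /eqP.
rewrite eqseq_cat ?size_map // => /andP[/eqP ed /eqP eb].
have en := IH _ _ hf hf' _ eb; have {eb en}E : next_gen f = next_gen f'.
  by apply: en; rewrite !size_next_gen ed.
have Hf g : g = map Node (reshape (offspring g) (next_gen g)).
  rewrite /offspring /next_gen.
  have -> : [seq size (children t) | t <- g] = shape (map children g).
    by rewrite /shape -map_comp.
  by rewrite flattenK -map_comp -{1}[g]map_id; apply: eq_map; case.
by rewrite (Hf f) (Hf f') ed E.
Qed.

(** Once the generations before [i] have been explored in breadth-first order, the queue of waiting
    vertices is exactly generation [i]; its length is one value of the walk. *)
Lemma bfs_word_gen k f i : forest_size f <= k -> exists2 j, j <= size (bfs_word k f) &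
  sumn (map (gen^~ i) f) + j = size f + sumn (take j (bfs_word k f)).
Proof.
elim: i k f => [|i IH] k f hf.
  exists 0 => //; rewrite take0 /= !addn0; elim: f {hf} => [|[ts] f IHf] //=; by rewrite IHf.
case: k hf => [|k] hf; first by exists 0 => //; case: f hf => [|[]].
have [j js E] := IH k _ (forest_size_next_le hf).
exists (size f + j); rewrite /= ?size_cat ?size_map ?leq_add2l //.
have -> : [seq gen t i.+1 | t <- f] = [seq sumn (map (gen^~ i) (children t)) | t <- f].
  by apply: eq_map; case.
rewrite take_cat size_map ltnNge leq_addr /= addKn sumn_cat -size_next_gen -E.
have -> : sumn [seq sumn [seq gen s i | s <- children t] | t <- f] =
  sumn [seq gen s i | s <- next_gen f].
  rewrite /next_gen; elim: f {hf j js E} => [|t f IHf] //=.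
  by rewrite IHf map_cat sumn_cat.
lia.
Qed.

Lemma bfs_word_luk t : luk (bfs_word (tsize t) [:: t]).
Proof.
have h : forest_size [:: t] <= tsize t by rewrite /forest_size /= addn0.
apply/lukP; split.
  by have := bfs_word_sum h; rewrite -(size_bfs_word h) /=; lia.
by move=> j /(bfs_word_prefix h) /=; lia.
Qed.

Lemma width_le_bfs t : exists2 j, j <= tsize t &
  width t + j <= 1 + sumn (take j (bfs_word (tsize t) [:: t])).
Proof.
have h : forest_size [:: t] <= tsize t by rewrite /forest_size /= addn0.
have sz : size (bfs_word (tsize t) [:: t]) = tsize t.
  by rewrite size_bfs_word // /forest_size /= addn0.
have t0 : 0 < tsize t by case: (t).
rewrite /width; have [|i ->] := @bigop.eq_bigmax _ (fun k : 'I_(tsize t) => gen t k).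
  by rewrite card_ord.
 have [j] := bfs_word_gen i h.
rewrite sz /= addn0 => js E; exists j => //; by rewrite E.
Qed.

(** The children of one vertex all lie in the same generation. *)
Lemma size_child_le_width t d : d \in dfs_word t -> d <= width t.
Proof.
suff H : d \in dfs_word t -> exists2 k, k < tsize t & d <= gen t k.
  move=> /H[k kt]; move/leq_trans; apply.
  by rewrite /width; exact: (@leq_bigmax _ (fun k : 'I_(tsize t) => gen t k) (Ordinal kt)).
elim/tree_ind_mem: t => ts IH /=; rewrite inE => /orP[/eqP ->|].
  case: ts IH => [|t ts] IH; first by exists 0.
  exists 1; first by case: t {IH} => ? /=; lia.
  rewrite [leqRHS](_ : _ = size (t :: ts)) //.
  by elim: (t :: ts) => [|[?] s /= ->].
move=> /flattenP[_ /mapP[t tts ->]] /(IH _ tts)[k kt dk].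
have tle (F : tree -> nat) : F t <= sumn (map F ts).
  elim: ts tts {IH} => [|s ts IHt] //; rewrite inE => /orP[/eqP ->|/IHt] /=; lia.
exists k.+1; first by have := tle tsize; lia.
exact: leq_trans dk (tle (gen^~ k)).
Qed.

End Coding.

(** * Expectations over words of independent letters *)

Lemma sum_indic_uniq (R : realType) (P : pred nat) (n : nat) :
  (forall i j, (i < n)%N -> (j < n)%N -> P i -> P j -> i = j) ->
  \sum_(0 <= i < n) (P i)%:R <= (has P (iota 0 n))%:R :> R.
Proof.
elim: n => [|n IH] H; first by rewrite big_geq.
have H' : forall i j, (i < n)%N -> (j < n)%N -> P i -> P j -> i = j.
  by move=> i j hi hj; apply: H; rewrite ltnS ltnW.
have -> : has P (iota 0 n.+1) = has P (iota 0 n) || P n.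
  by rewrite -addn1 iotaD has_cat /= orbF.
rewrite big_nat_recr //=.
have := IH H'; case: hasP => [[i]|_] /=.
  rewrite mem_iota /= => hi Pi.
  case Pn: (P n); last by rewrite addr0.
  by have := H i n ltac:(lia) (leqnn _) Pi Pn; lia.
by move=> h; rewrite -[leRHS]add0r lerD2r.
Qed.

Lemma sum_sub_uniq (R : realType) (T : eqType) (F : T -> R) (s r : seq T) :
  (forall x, 0 <= F x) -> uniq s -> {subset s <= r} ->
  \sum_(x <- s) F x <= \sum_(x <- r) F x.
Proof.
move=> F0; elim: s r => [|x s IH] r /=.
  by rewrite big_nil => _ _; apply: sumr_ge0.
move=> /andP[xs us] sr; have xr : x \in r by apply: sr; rewrite mem_head.
rewrite big_cons (big_rem _ xr) /= lerD2l; apply: IH => // y ys.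
have : y \in r by apply: sr; rewrite inE ys orbT.
rewrite (perm_mem (perm_to_rem xr)) inE => /orP[/eqP yx|//].
by rewrite -yx ys in xs.
Qed.

Section Expectation.
Variables (R : realType) (mu : nat -> R).
Hypothesis mu_ge0 : forall k, 0 <= mu k.
Implicit Types (f g : seq nat -> R) (A B : pred (seq nat)).

(* The i.i.d. letters are restricted to values below [M]: this keeps all sums
   finite, at the price of a total mass possibly smaller than one. *)
Fixpoint Ex (M n : nat) (f : seq nat -> R) : R :=
  if n is n'.+1 then \sum_(0 <= y < M) mu y * Ex M n' (fun s => f (y :: s))
  else f [::].

Definition Pr M n (A : pred (seq nat)) : R := Ex M n (fun w => (A w)%:R).

Definition word (M n : nat) (w : seq nat) : bool :=
  (size w == n) && all (fun y => (y < M)%N) w.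

Lemma Ex_le M n f g : (forall w, word M n w -> f w <= g w) -> Ex M n f <= Ex M n g.
Proof.
elim: n f g => [|n IH] f g H /=; first exact: H.
apply: ler_sum_nat => y /andP[_ yM]; rewrite ler_wpM2l //; apply: IH => w /andP[/eqP sw aw].
by apply: H; rewrite /word /= sw eqxx yM aw.
Qed.

Lemma Ex_ext M n f g : (forall w, word M n w -> f w = g w) -> Ex M n f = Ex M n g.
Proof. by move=> H; apply/eqP; rewrite eq_le !Ex_le // => w /H ->. Qed.

Lemma Ex_zero M n : Ex M n (fun=> 0) = 0.
Proof. by elim: n => [|n IH] //=; rewrite big1 // => y _; rewrite IH mulr0. Qed.

Lemma Ex_ge0 M n f : (forall w, word M n w -> 0 <= f w) -> 0 <= Ex M n f.
Proof. by move=> H; rewrite -(Ex_zero M n); apply: Ex_le. Qed.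

Lemma ExD M n f g : Ex M n (fun w => f w + g w) = Ex M n f + Ex M n g.
Proof.
elim: n f g => [|n IH] f g //=.
by rewrite -big_split /=; apply: eq_bigr => y _; rewrite IH mulrDr.
Qed.

Lemma ExZ M n a f : Ex M n (fun w => a * f w) = a * Ex M n f.
Proof.
elim: n f => [|n IH] f //=; rewrite big_distrr /=.
by apply: eq_bigr => y _; rewrite IH mulrCA.
Qed.

Lemma Ex_sum M n (I : Type) (r : seq I) (P : pred I) (F : I -> seq nat -> R) :
  Ex M n (fun w => \sum_(i <- r | P i) F i w) = \sum_(i <- r | P i) Ex M n (F i).
Proof.
elim: r => [|i r IH].
  rewrite big_nil -[RHS](Ex_zero M n); apply: Ex_ext => w _; by rewrite big_nil.
rewrite big_cons -IH; case: ifP => Pi; last by apply: Ex_ext => w _; rewrite big_cons Pi.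
by rewrite -ExD; apply: Ex_ext => w _; rewrite big_cons Pi.
Qed.

Lemma Ex_cat M n m f : Ex M (n + m) f = Ex M n (fun u => Ex M m (fun v => f (u ++ v))).
Proof. by elim: n f => [|n IH] f //=; apply: eq_bigr => y _; rewrite IH. Qed.

Lemma Ex_exchange M n m (F : seq nat -> seq nat -> R) :
  Ex M n (fun u => Ex M m (F u)) = Ex M m (fun v => Ex M n (F^~ v)).
Proof.
elim: n F => [|n IH] F //=; rewrite Ex_sum.
apply: eq_bigr => y _; rewrite ExZ; congr (_ * _).
exact: (IH (fun u v => F (y :: u) v)).
Qed.

Lemma Ex_rot M n i f : Ex M n f = Ex M n (fun w => f (rot i w)).
Proof.
have [hi|hi] := leqP n i.
  by apply: Ex_ext => w /andP[/eqP sw _]; rewrite rot_oversize // sw.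
rewrite -{1}(subnK (ltnW hi)) -{2}(subnKC (ltnW hi)) !Ex_cat Ex_exchange.
apply: Ex_ext => u /andP[/eqP su _]; apply: Ex_ext => v _.
by rewrite -su rot_size_cat.
Qed.

Lemma Ex_rotr M n i f : Ex M n f = Ex M n (fun w => f (rotr i w)).
Proof.
rewrite (Ex_rot M n (n - i)); apply: Ex_ext => w /andP[/eqP sw _].
by rewrite /rotr sw.
Qed.

Lemma Ex_prod M n (g : nat -> R) :
  Ex M n (fun w => \prod_(y <- w) g y) = (\sum_(0 <= y < M) mu y * g y) ^+ n.
Proof.
elim: n => [|n IH] /=; first by rewrite big_nil expr0.
rewrite exprS big_distrl /=; apply: eq_bigr => y _.
rewrite -mulrA -IH; congr (_ * _); rewrite -ExZ; apply: Ex_ext => w _; by rewrite big_cons.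
Qed.

Lemma Ex_trunc c M n f : (c <= M)%N ->
  Ex c n f = Ex M n (fun w => (all (fun y => (y < c)%N) w)%:R * f w).
Proof.
move=> cM; elim: n f => [|n IH] f /=; first by rewrite mul1r.
rewrite [RHS](@big_cat_nat _ _ _ c) //= [X in _ + X]big_nat_cond [X in _ + X]big1 ?addr0; last first.
  move=> y /andP[/andP[cy _] _]; rewrite ltnNge cy /=.
  by rewrite [X in _ * X](_ : _ = 0) ?mulr0 // -[RHS](Ex_zero M n); apply: Ex_ext => w _;
    rewrite mul0r.
rewrite [LHS]big_nat_cond [RHS]big_nat_cond; apply: eq_bigr => y /andP[/andP[_ yc] _].
by rewrite IH; congr (_ * _); apply: Ex_ext => w _; rewrite yc.
Qed.

Lemma Ex_le_trunc c M n f : (c <= M)%N -> (forall w, word M n w -> 0 <= f w) ->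
  Ex c n f <= Ex M n f.
Proof.
move=> cM f0; rewrite (Ex_trunc n f cM); apply: Ex_le => w /f0 fw.
by case: all; rewrite ?mul1r ?mul0r.
Qed.

Lemma Pr_ge0 M n A : 0 <= Pr M n A.
Proof. by apply: Ex_ge0 => w _; rewrite ler0n. Qed.

Lemma Pr_le M n A B : (forall w, word M n w -> A w -> B w) -> Pr M n A <= Pr M n B.
Proof.
move=> H; apply: Ex_le => w hw; rewrite ler_nat.
by case: (A w) (H w hw) => // /(_ isT) ->.
Qed.

Lemma Pr_or M n A B : Pr M n (fun w => A w || B w) <= Pr M n A + Pr M n B.
Proof.
rewrite -ExD; apply: Ex_le => w _; rewrite -natrD ler_nat.
by case: (A w); case: (B w).
Qed.

Lemma Pr_union M n A B C : (forall w, word M n w -> A w -> B w || C w) ->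
  Pr M n A <= Pr M n B + Pr M n C.
Proof. by move=> H; apply: le_trans (Pr_or _ _ _ _); apply: Pr_le. Qed.

Lemma markov_word M n A f a : (forall w, word M n w -> 0 <= f w) ->
  (forall w, word M n w -> A w -> a <= f w) -> a * Pr M n A <= Ex M n f.
Proof.
move=> f0 H; rewrite -ExZ; apply: Ex_le => w hw.
by case: (boolP (A w)) => [/(H _ hw)|_]; rewrite ?mulr1 ?mulr0 // f0.
Qed.

Lemma Pr_true M n : Pr M n xpredT = (\sum_(0 <= y < M) mu y) ^+ n.
Proof.
have -> : \sum_(0 <= y < M) mu y = \sum_(0 <= y < M) mu y * 1 by apply: eq_bigr => y _; rewrite mulr1.
rewrite -(Ex_prod M n (fun=> 1)); apply: Ex_ext => w _.
by rewrite big1.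
Qed.

(** Union bound over the position of the marked letter; by exchangeability each position contributes
    as much as the first. *)
Lemma Pr_big_letter M n (D : pred nat) (G : nat -> pred (seq nat)) :
  Pr M n.+1 (fun w => has (fun i => if rot i w is d :: u then D d && G d u else false)
                       (iota 0 n.+1)) <=
  n.+1%:R * \sum_(0 <= d < M | D d) mu d * Pr M n (G d).
Proof.
pose H (w : seq nat) := if w is d :: u then D d && G d u else false.
apply: (@le_trans _ _ (Ex M n.+1 (fun w => \sum_(0 <= i < n.+1) (H (rot i w))%:R))).
  apply: Ex_le => w _.
  have [/hasP[i]|_] := boolP (has _ _); last by apply: sumr_ge0 => i _; rewrite ler0n.
  move=> iin Hi; rewrite (bigD1_seq i) ?iota_uniq //=.
  rewrite {1}/H Hi lerDl; apply: sumr_ge0 => j _; exact: ler0n.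
rewrite Ex_sum.
have E i : Ex M n.+1 (fun w => (H (rot i w))%:R) = \sum_(0 <= d < M | D d) mu d * Pr M n (G d).
  rewrite -(Ex_rot _ _ _ (fun w => (H w)%:R)) /= [RHS]big_mkcond /=.
  apply: eq_bigr => d _; case: ifP => Dd //.
  by rewrite /= Ex_zero mulr0.
rewrite (eq_bigr _ (fun i _ => E i)) big_const_nat subn0 iter_addr addr0.
by rewrite mulr_natl.
Qed.

End Expectation.

(** * A maximal inequality, exploration of a forest, ladder times and the cycle lemma *)

Section WordProbabilities.
Variables (R : realType) (mu : nat -> R).
Hypothesis mu_ge0 : forall k, 0 <= mu k.
Variable M : nat.
Hypothesis mass_le1 : \sum_(0 <= y < M) mu y <= 1.
Local Notation EM := (Ex mu M).
Local Notation PM := (Pr mu M).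

Lemma Pr_le1 n A : PM n A <= 1.
Proof.
apply: (@le_trans _ _ (PM n xpredT)); first exact: Pr_le.
rewrite Pr_true // exprn_ile1 //; exact: sumr_ge0.
Qed.

Lemma Ex_cst_le n (a : R) : 0 <= a -> EM n (fun=> a) <= a.
Proof.
move=> a0; have -> : EM n (fun=> a) = a * PM n xpredT.
  by rewrite -ExZ; apply: Ex_ext => // w _; rewrite mulr1.
by rewrite ler_piMr // Pr_le1.
Qed.

Section Maximal.
Variable g : nat -> R.

Fixpoint crosses (x : R) (w : seq nat) : bool :=
  (x <= 0) || (if w is y :: s then crosses (x - g y) s else false).

Lemma crossesP x w : reflect (exists2 j, (j <= size w)%N & x <= \sum_(y <- take j w) g y)
  (crosses x w).
Proof.
elim: w x => [|y w IH] x /=.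
  rewrite orbF; apply: (iffP idP) => [x0|[j _]]; last by rewrite big_nil.
  by exists 0%N => //; rewrite big_nil.
apply: (iffP orP) => [[x0|/IH[j js xj]]|[[|j] js]].
- by exists 0%N => //; rewrite take0 big_nil.
- by exists j.+1 => //=; rewrite big_cons -lerBlDl.
- by rewrite take0 big_nil; left.
- by rewrite /= big_cons -lerBlDl => xj; right; apply/IH; exists j.
Qed.

(** Once [x] is crossed, the remaining letters lower the sum by at most [z] with probability at
    least [q], which leaves the final value above [x - z]. Removing the first letter by induction
    replaces the usual stopping time. *)
Lemma ottaviani n (q x z : R) : 0 <= q ->
  (forall m, (m <= n)%N -> q <= PM m (fun w => - z <= \sum_(y <- w) g y)) ->
  q * PM n (crosses x) <= PM n (fun w => x - z <= \sum_(y <- w) g y).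
Proof.
move=> q0; elim: n x => [|n IH] x H; case: (leP x 0) => x0.
- apply: (@le_trans _ _ q); first by rewrite ler_piMr // Pr_le1.
  apply: le_trans (H 0%N (leqnn _)) _; apply: Pr_le => // w _ /(le_trans _); apply.
  by rewrite lerBlDr addNr.
- by rewrite /Pr /= orbF [x <= 0]leNgt x0 /= mulr0 ler0n.
- apply: (@le_trans _ _ q); first by rewrite ler_piMr // Pr_le1.
  apply: le_trans (H n.+1 (leqnn _)) _; apply: Pr_le => // w _ /(le_trans _); apply.
  by rewrite lerBlDr addNr.
rewrite /Pr /= big_distrr /=; apply: ler_sum => y _.
rewrite mulrCA ler_wpM2l //.
have := IH (x - g y) (fun m hm => H m (leqW hm)).
have -> : PM n (crosses (x - g y)) =
  EM n (fun s => ((x <= 0) || crosses (x - g y) s)%:R).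
  by apply: Ex_ext => // w _; rewrite leNgt x0.
move/le_trans; apply; apply: Pr_le => // w _.
by rewrite big_cons addrAC lerBlDl.
Qed.

End Maximal.

Section Stack.
Variable Q : nat -> R.
Hypothesis Q0 : Q 0%N = 1.
Hypothesis Q01 : forall h, 0 <= Q h <= 1.
Hypothesis QS_le : forall h, \sum_(0 <= y < M) mu y * (1 - Q h) ^+ y <= 1 - Q h.+1.
Hypothesis QS_ge : forall h, 1 - Q h.+1 <=
  \sum_(0 <= y < M) mu y * (1 - Q h) ^+ y + (1 - \sum_(0 <= y < M) mu y).

Lemma prod_stack_01 st : 0 <= \prod_(h <- st) (1 - Q h) <= 1.
Proof.
elim: st => [|h st /andP[IH0 IH1]]; first by rewrite big_nil ler01 lexx.
rewrite big_cons; have /andP[q0 q1] := Q01 h.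
by rewrite mulr_ge0 ?subr_ge0 //= mulr_ile1 ?subr_ge0 // lerBlDr lerDl.
Qed.

Lemma prod_stack_nseq y h st :
  \prod_(k <- nseq y h ++ st) (1 - Q k) = (1 - Q h) ^+ y * \prod_(k <- st) (1 - Q k).
Proof. by rewrite big_cat big_nseq /= iter_mulr_1. Qed.

(** Independent trees miss their targets with probability [1 - Q h] each. Truncating the letters
    loses mass, so the recursion for [Q] is only available as two inequalities: [QS_le] serves here
    and [QS_ge] in [Pr_reach]. *)
Lemma Pr_fin n st : PM n (fun w => fin w st) <= \prod_(h <- st) (1 - Q h).
Proof.
elim: n st => [|n IH] [|[|h] st].
- by rewrite big_nil /Pr.
- by rewrite /Pr /= big_cons Q0 subrr mul0r.
- by rewrite /Pr /=; case/andP: (prod_stack_01 (h.+1 :: st)).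
- by rewrite big_nil Pr_le1.
- rewrite big_cons Q0 subrr mul0r /Pr /= big1 // => y _.
  by rewrite Ex_zero mulr0.
rewrite big_cons; have /andP[p0 p1] := prod_stack_01 st.
apply: le_trans (ler_wpM2r p0 (QS_le h)).
rewrite /Pr /= big_distrl /=; apply: ler_sum => y _.
by rewrite -mulrA ler_wpM2l // -prod_stack_nseq; apply: IH.
Qed.

Lemma Pr_reach n st : PM n (fun w => reach w st) <= 1 - \prod_(h <- st) (1 - Q h).
Proof.
elim: n st => [|n IH] [|[|h] st].
- by rewrite big_nil /Pr subrr.
- by rewrite /Pr /= big_cons Q0 subrr mul0r subr0.
- by rewrite /Pr /= subr_ge0; case/andP: (prod_stack_01 (h.+1 :: st)).
- by rewrite big_nil subrr /Pr /= big1 // => y _; rewrite Ex_zero mulr0.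
- by rewrite big_cons Q0 subrr mul0r subr0 Pr_le1.
rewrite big_cons; have /andP[p0 p1] := prod_stack_01 st.
set p := \prod_(_ <- st) _ in p0 p1 *.
have : PM n.+1 (fun w => reach w (h.+1 :: st)) <=
   \sum_(0 <= y < M) mu y * (1 - (1 - Q h) ^+ y * p).
  rewrite /Pr /=; apply: ler_sum => y _; rewrite ler_wpM2l //.
  by rewrite -prod_stack_nseq; apply: IH.
move/le_trans; apply.
under eq_bigr do rewrite mulrBr mulr1 mulrA.
rewrite sumrB -big_distrl /=.
have := QS_ge h; move: (\sum_(0 <= y < M) mu y * _) (\sum_(0 <= y < M) mu y) mass_le1 => f m m1 hq.
nra.
Qed.

End Stack.

Definition staypos n := PM n (fun w => mindepth w == 0%N).

(** A letter followed by [j] others counts in [depth] when the suffix of length [j.+1] that it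
    starts keeps its walk nonnegative. The letters before it have total mass at most one. *)
Lemma Ex_depth n : EM n (fun w => (depth w)%:R) <= \sum_(0 <= j < n) staypos j.+1.
Proof.
elim: n => [|n IH]; first by rewrite big_geq //=.
rewrite big_nat_recr //= addrC.
have -> : \sum_(0 <= y < M) mu y * EM n (fun s => ((((mindepth s).+1 - y)%N == 0%N) + depth s)%:R) =
   staypos n.+1 + (\sum_(0 <= y < M) mu y) * EM n (fun s => (depth s)%:R).
  rewrite /staypos /Pr /= big_distrl /= -big_split /=; apply: eq_bigr => y _.
  rewrite -mulrDr -ExD; congr (_ * _); apply: Ex_ext => // w _.
  by rewrite natrD.
rewrite lerD2l; apply: le_trans IH; rewrite ler_piMl //.
by apply: Ex_ge0 => // w _; rewrite ler0n.
Qed.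

(** The end of [u] is a strict descending ladder time: the walk is strictly below all its earlier
    values. *)
Definition newmin (u : seq nat) : bool :=
  all (fun j => (sumn u + j < sumn (take j u) + size u)%N) (iota 0 (size u)).

Lemma newminP u : reflect (forall j, (j < size u)%N -> (sumn u + j < sumn (take j u) + size u)%N)
  (newmin u).
Proof.
apply: (iffP allP) => H j; first by move=> js; apply: H; rewrite mem_iota.
by rewrite mem_iota /= => /H.
Qed.

(** The walk goes down by at most one at a time, so each new lowest level is first reached at a
    strict ladder time. *)
Lemma mindepth_le_newmin w :
  (mindepth w <= \sum_(0 <= k < (size w).+1) newmin (take k w))%N.
Proof.
elim/last_ind: w => [|w y IH]; first by rewrite big_nat1.
rewrite size_rcons big_nat_recr //=.
have -> : take (size w).+1 (rcons w y) = rcons w y by rewrite -(size_rcons w y) take_size.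
have -> : (\sum_(0 <= k < (size w).+1) newmin (take k (rcons w y)) =
           \sum_(0 <= k < (size w).+1) newmin (take k w))%N.
  rewrite [LHS]big_nat_cond [RHS]big_nat_cond; apply: eq_bigr => k /andP[/andP[_ kw] _].
  by rewrite -cats1 takel_cat.
suff : (mindepth (rcons w y) <= mindepth w + newmin (rcons w y))%N.
  by move/leq_trans; apply; rewrite leq_add2r.
have /mindepth_leP hw := leqnn (mindepth w).
apply/mindepth_leP => j; rewrite size_rcons leq_eqVlt => /orP[/eqP ->|jw]; last first.
  rewrite -cats1 takel_cat //; have := hw j jw; lia.
rewrite -(size_rcons w y) take_size.
have [|/newminP] := boolP (newmin _).
  have := hw _ (leqnn _); rewrite take_size size_rcons sumn_rcons; lia.
move=> nm; rewrite leqNgt; apply/negP => lt; apply: nm => i.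
rewrite size_rcons ltnS => iw; have := hw i iw.
rewrite -cats1 takel_cat // cats1; move: lt; rewrite size_rcons; lia.
Qed.

Lemma newmin_drop_uniq w i j : (i <= size w)%N -> (j <= size w)%N ->
  newmin (take i w) -> mindepth (drop i w) = 0%N ->
  newmin (take j w) -> mindepth (drop j w) = 0%N -> i = j.
Proof.
wlog ij : i j / (i < j)%N.
  move=> H hi hj h1 h2 h3 h4; case: (ltngtP i j) => // ij.
    exact: (H i j).
  by apply/esym; apply: (H j i).
move=> hi hj _ md /newminP nm _; exfalso.
have := nm i; rewrite size_takel // => /(_ ij); rewrite take_takel ?(ltnW ij) //.
have /mindepth_leP /(_ (j - i)%N) : (mindepth (drop i w) <= 0)%N by rewrite md.
rewrite size_drop => /(_ ltac:(lia)).
have {3}-> : j = (i + (j - i))%N by lia.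
rewrite takeD sumn_cat; lia.
Qed.

(** Cutting a word at the first minimum of its walk gives a prefix that ends at a strict ladder time
    and a suffix with nonnegative walk. This cut is unique, so the events summed here are
    disjoint. *)
Lemma sum_newmin_staypos t :
  \sum_(0 <= k < t.+1) PM k newmin * staypos (t - k) <= 1.
Proof.
have -> : \sum_(0 <= k < t.+1) PM k newmin * staypos (t - k) =
  EM t (fun w => \sum_(0 <= k < t.+1) (newmin (take k w) && (mindepth (drop k w) == 0%N))%:R).
  rewrite Ex_sum // [LHS]big_nat_cond [RHS]big_nat_cond.
  apply: eq_bigr => k /andP[/andP[_ kt] _].
  rewrite -{2}(subnKC (kt : (k <= t)%N)) Ex_cat mulrC -ExZ.
  apply: Ex_ext => // u /andP[/eqP su _]; rewrite mulrC -ExZ; apply: Ex_ext => // v _.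
  by rewrite -su take_size_cat // drop_size_cat // -natrM mulnb.
apply: le_trans (Pr_le1 t xpredT); apply: Ex_le => // w /andP[/eqP sw _].
apply: le_trans (sum_indic_uniq _ _) _ => [i j it jt /andP[h1 /eqP h2] /andP[h3 /eqP h4]|].
  by apply: (@newmin_drop_uniq w); rewrite ?sw.
by rewrite ler_nat; case: has.
Qed.

(** Markov's inequality for the number of ladder times: at least [x] of them occur when the walk
    ends at [- x] or lower. *)
Lemma sum_newmin_ge m (x : nat) :
  x%:R * PM m (fun w => (sumn w + x <= m)%N) <= \sum_(0 <= k < m.+1) PM k newmin.
Proof.
apply: (@le_trans _ _ (EM m (fun w => \sum_(0 <= k < m.+1) (newmin (take k w))%:R))).
  apply: markov_word => // [w _|w /andP[/eqP sw _] hx]; first by apply: sumr_ge0.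
  rewrite -natr_sum ler_nat -{1}sw; apply: leq_trans (mindepth_le_newmin w).
  apply: (@mindepth_ge _ _ m); rewrite ?sw // -{1}sw take_size; lia.
rewrite Ex_sum //; rewrite [leLHS]big_nat_cond [leRHS]big_nat_cond.
apply: ler_sum => k /andP[/andP[_ kt] _].
rewrite -{1}(subnKC (kt : (k <= m)%N)) Ex_cat; apply: Ex_le => // u /andP[/eqP su _].
apply: (@le_trans _ _ (EM (m - k) (fun=> (newmin u)%:R))); last exact: Ex_cst_le.
by apply: Ex_le => // v _; rewrite -su take_size_cat.
Qed.

(** The product of the two sums over [k, j <= m] is part of the convolutions of total index
    [k + j < n], each of which is at most one by [sum_newmin_staypos]. *)
Lemma sum_staypos_le m n (x : nat) : (m.*2 < n)%N ->
  x%:R * PM m (fun w => (sumn w + x <= m)%N) * \sum_(0 <= j < m.+1) staypos j <= n%:R.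
Proof.
move=> mn; have sp j : 0 <= staypos j by exact: Pr_ge0.
apply: (@le_trans _ _ ((\sum_(0 <= k < m.+1) PM k newmin) * \sum_(0 <= j < m.+1) staypos j)).
  by rewrite ler_wpM2r ?sum_newmin_ge ?sumr_ge0.
apply: (@le_trans _ _ (\sum_(0 <= t < n) \sum_(0 <= k < t.+1) PM k newmin * staypos (t - k))).
  have -> : \sum_(0 <= t < n) \sum_(0 <= k < t.+1) PM k newmin * staypos (t - k) =
     \sum_(0 <= k < n) \sum_(k <= t < n) PM k newmin * staypos (t - k).
    elim: (n) => [|n' IH]; first by rewrite !big_geq.
    rewrite big_nat_recr //= IH [RHS]big_nat_recr //= big_nat1.
    rewrite [X in _ + X]big_nat_recr //= addrA; congr (_ + _).
    rewrite -big_split /= [LHS]big_nat_cond [RHS]big_nat_cond.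
    by apply: eq_bigr => k /andP[/andP[_ kn] _]; rewrite [RHS]big_nat_recr //= ltnW.
  have mn' : (m.+1 <= n)%N by lia.
  rewrite [leRHS](@big_cat_nat _ _ _ m.+1) //= ler_wpDr //.
    apply: sumr_ge0 => k _; apply: sumr_ge0 => t _; rewrite mulr_ge0 //; exact: Pr_ge0.
  rewrite big_distrl /= [leLHS]big_nat_cond [leRHS]big_nat_cond.
  apply: ler_sum => k /andP[/andP[_ km] _]; rewrite big_distrr /=.
  rewrite [leRHS](@big_cat_nat _ _ _ (m.+1 + k)) //=; try lia.
  rewrite ler_wpDr //; first by apply: sumr_ge0 => t _; rewrite mulr_ge0 //; exact: Pr_ge0.
  rewrite -{2}[k]add0n big_addn addnK; apply: ler_sum => j _.
  by rewrite addnK.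
rewrite -[n in n%:R]subn0 -sumr_const_nat; apply: ler_sum => t _.
exact: sum_newmin_staypos.
Qed.

(** Cycle lemma: the [n] rotations of a word are equally likely and at most one of them is a
    Lukasiewicz word. [Pr_luk_ge] uses the existence of such a rotation. *)
Lemma Pr_luk_le n (F : pred (seq nat)) : (forall i w, F (rot i w) = F w) ->
  n%:R * PM n (fun w => luk w && F w) <= PM n (fun w => ((sumn w).+1 == n) && F w).
Proof.
move=> HF.
have -> : n%:R * PM n (fun w => luk w && F w) =
   EM n (fun w => \sum_(0 <= i < n) (luk (rot i w) && F w)%:R).
  rewrite Ex_sum // (eq_bigr (fun=> PM n (fun w => luk w && F w))).
    by rewrite sumr_const_nat subn0 mulr_natl.
  move=> i _; rewrite /Pr [RHS](Ex_rot _ _ _ i) //; apply: Ex_ext => // w _.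
  by rewrite HF.
apply: Ex_le => // w /andP[/eqP sw _]; case: (F w); last first.
  by rewrite andbF big1 // => i _; rewrite andbF.
apply: le_trans (sum_indic_uniq _ _) _ => [i j hi hj|].
  by rewrite !andbT; apply: luk_rot_uniq; rewrite sw.
rewrite ler_nat andbT; case: hasP => //= -[i _]; rewrite andbT => /lukP[].
by rewrite sumn_rot size_rot sw => ->; rewrite eqxx.
Qed.

Lemma Pr_luk_ge n : PM n (fun w => (sumn w).+1 == n) <= n%:R * PM n luk.
Proof.
have -> : n%:R * PM n luk = EM n (fun w => \sum_(0 <= i < n) (luk (rot i w))%:R).
  rewrite Ex_sum // (eq_bigr (fun=> PM n luk)).
    by rewrite sumr_const_nat subn0 mulr_natl.
  by move=> i _; rewrite /Pr [RHS](Ex_rot _ _ _ i).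
apply: Ex_le => // w /andP[/eqP sw _]; case: eqP => [sn|_]; last by apply: sumr_ge0.
have [i] := luk_rot_exists (etrans sn (esym sw)); rewrite sw => hi li.
rewrite (bigD1_seq i) ?iota_uniq ?mem_index_iota //= li lerDl.
exact: sumr_ge0.
Qed.

Lemma luk_rotr_uniq w i j : (i < size w)%N -> (j < size w)%N ->
  luk (rotr i w) -> luk (rotr j w) -> i = j.
Proof.
wlog ij : i j / (i <= j)%N => [H hi hj li lj|].
  by case/orP: (leq_total i j) => /H e; [apply: e|apply/esym/e].
move=> hi hj li lj; set v := rotr j w in lj.
have sv : size v = size w by rewrite size_rotr.
have E : rotr i w = rot (j - i) v.
  apply: (@rot_inj i); rewrite rotrK -rotD ?subnKC // ?sv 1?ltnW //.
  by rewrite rotrK.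
have := @luk_rot_uniq v 0 (j - i); rewrite sv rot0 -E => /(_ _ _ lj li).
move=> /(_ ltac:(lia) ltac:(lia)); lia.
Qed.

(* Rotating a Lukasiewicz word so that a marked letter [d] comes first loses
   nothing, since each cyclic class contains only one such word. *)
Lemma Pr_luk_mark n (D : pred nat) (A : pred (seq nat)) (G : nat -> pred (seq nat)) :
  (forall w, luk w -> A w -> exists p d s, [/\ w = p ++ d :: s, D d & G d (s ++ p)]) ->
  PM n.+1 (fun w => luk w && A w) <=
  \sum_(0 <= d < M | D d) mu d * PM n (fun u => (d + sumn u == n) && G d u).
Proof.
move=> HA.
pose H (w : seq nat) := if w is d :: u then D d && G d u else false.
apply: (@le_trans _ _ (EM n.+1 (fun w => \sum_(0 <= i < n.+1) (luk w && H (rot i w))%:R))).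
  apply: Ex_le => // w /andP[/eqP sw _].
  case: (boolP (luk w)) => [lw|_] /=; last by rewrite big1.
  case: (boolP (A w)) => [Aw|_] /=; last by apply: sumr_ge0.
  have [p [d [s [Ew Dd Gd]]]] := HA w lw Aw.
  have ps : (size p < n.+1)%N by rewrite -sw Ew size_cat /=; lia.
  rewrite (bigD1_seq (size p)) ?iota_uniq ?mem_index_iota //=.
  rewrite {1}/H {1}Ew rot_size_cat /= Dd Gd lerDl; exact: sumr_ge0.
rewrite Ex_sum // (eq_bigr (fun i => EM n.+1 (fun w => (luk (rotr i w) && H w)%:R))); last first.
  by move=> i _; rewrite (Ex_rotr _ _ _ i) //; apply: Ex_ext => // w _; rewrite rotrK.
rewrite -Ex_sum //.
apply: (@le_trans _ _ (EM n.+1 (fun w => (((sumn w).+1 == n.+1) && H w)%:R))).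
  apply: Ex_le => // w /andP[/eqP sw _]; case: (H w); last first.
    by rewrite andbF big1 // => i _; rewrite andbF.
  apply: le_trans (sum_indic_uniq _ _) _ => [i j hi hj|].
    by rewrite !andbT; apply: luk_rotr_uniq; rewrite sw.
  rewrite ler_nat andbT; case: hasP => //= -[i _]; rewrite andbT => /lukP[].
  by rewrite {1}/rotr sumn_rot size_rotr sw => ->; rewrite eqxx.
rewrite /= [leRHS]big_mkcond /=; apply: ler_sum => d _.
case: ifP => Dd; first by apply: ler_wpM2l => //; apply: Ex_le => // u _; rewrite /H /= Dd.
rewrite [X in _ * X](_ : _ = 0) ?mulr0 // -[RHS](Ex_zero mu M n).
by apply: Ex_ext => // u _; rewrite andbF.
Qed.

End WordProbabilities.

(** * From trees weighted by the offspring law to words *)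

Section TreeMeasure.
Variables (R : realType) (mu : nat -> R).
Hypothesis mu_ge0 : forall k, 0 <= mu k.

Definition wt (w : seq nat) : R := \prod_(y <- w) mu y.

Lemma wt_ge0 w : 0 <= wt w.
Proof. by apply: prodr_ge0. Qed.

Fixpoint words (M n : nat) : seq (seq nat) :=
  if n is n'.+1 then [seq y :: s | y <- index_iota 0 M, s <- words M n'] else [:: [::]].

Lemma words_uniq M n : uniq (words M n).
Proof.
elim: n => [|n IH] //=; apply: allpairs_uniq => //; first exact: iota_uniq.
by move=> [a b] [c d] _ _ /= [-> ->].
Qed.

Lemma mem_words M n w : (w \in words M n) = word M n w.
Proof.
rewrite /word; elim: n w => [|n IH] w /=.
  by rewrite inE; case: w.
apply/allpairsP/idP => [[[y s] /= [yM sw ->]]|].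
  by move: yM sw; rewrite mem_index_iota IH /= eqSS => -> /andP[-> ->].
case: w => [|y s] //= /andP[sn /andP[yM aM]]; exists (y, s).
by rewrite mem_index_iota yM IH -eqSS sn aM.
Qed.

Lemma Ex_words M n f : Ex mu M n f = \sum_(w <- words M n) wt w * f w.
Proof.
elim: n f => [|n IH] f /=; first by rewrite big_seq1 /wt big_nil mul1r.
rewrite big_allpairs_dep /=; apply: eq_bigr => y _; rewrite IH big_distrr /=.
by apply: eq_bigr => s _; rewrite /wt big_cons mulrA.
Qed.

Lemma tweight_Node ts : tweight mu (Node ts) = mu (size ts) * \prod_(t <- ts) tweight mu t.
Proof. by rewrite /= foldrE big_map. Qed.

Lemma tweight_dfs t : tweight mu t = wt (dfs_word t).
Proof.
elim/tree_ind_mem: t => ts IH; rewrite tweight_Node /wt /= big_cons; congr (_ * _).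
elim: ts IH => [|t ts IHts] H /=; first by rewrite !big_nil.
rewrite big_cons big_cat /= H ?mem_head // IHts // => s hs.
by apply: H; rewrite inE hs orbT.
Qed.

Lemma tweight_bfs k f : (forest_size f <= k)%N ->
  \prod_(t <- f) tweight mu t = wt (bfs_word k f).
Proof.
elim: k f => [|k IH] f; first by case: f => [|[]] //; rewrite /wt !big_nil.
move=> /forest_size_next_le /IH; rewrite /wt /= big_cat /= => <-.
rewrite big_map /next_gen; elim: f => [|[ts] f IHf]; first by rewrite /= !big_nil mul1r.
by rewrite !big_cons tweight_Node IHf /= big_cat /= mulrACA.
Qed.

Lemma esum_tweight_le M n (A : set tree) (code : tree -> seq nat) (B : pred (seq nat)) :
  (forall t, A t -> tweight mu t = wt (code t)) ->
  (forall t, A t -> word M n (code t) && B (code t)) ->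
  (forall t t', A t -> A t' -> code t = code t' -> t = t') ->
  (\esum_(t in A) (tweight mu t)%:E <= (Pr mu M n B)%:E)%E.
Proof.
move=> Hw HB Hinj; apply: ub_ereal_sup => _ [X [finX XA] <-].
rewrite fsbig_finite //= sumEFin lee_fin.
have mX t : t \in finmap.enum_fset (fset_set X) -> A t.
  by rewrite (in_fset_set finX) inE => /XA.
set l := finmap.enum_fset _ in mX *.
have ul : uniq l by apply: finmap.fset_uniq.
rewrite big_seq (eq_bigr (fun t => wt (code t))); last by move=> t /mX; exact: Hw.
rewrite -big_seq -(big_map code xpredT wt) /Pr Ex_words.
have -> : \sum_(w <- words M n) wt w * (B w)%:R = \sum_(w <- seq.filter B (words M n)) wt w.
  by rewrite big_filter [RHS]big_mkcond; apply: eq_bigr => w _; case: ifP => _; rewrite ?mulr1 ?mulr0.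
apply: sum_sub_uniq; first exact: wt_ge0.
  by rewrite map_inj_in_uniq // => t t' /mX At /mX At'; apply: Hinj.
by move=> _ /mapP[t /mX /HB /andP[h1 h2] ->]; rewrite mem_filter h2 mem_words.
Qed.

Lemma esum_tweight_ge0 (A : set tree) : (0 <= \esum_(t in A) (tweight mu t)%:E)%E.
Proof. by apply: esum_ge0 => t _; rewrite lee_fin tweight_dfs wt_ge0. Qed.

Lemma PGW_le M n (A : set tree) (code : tree -> seq nat) (B : pred (seq nat)) :
  (forall t, A t -> tweight mu t = wt (code t)) ->
  (forall t, A t -> word M n (code t) && B (code t)) ->
  (forall t t', A t -> A t' -> code t = code t' -> t = t') ->
  PGW mu A <= Pr mu M n B.
Proof.
move=> Hw HB Hinj; have H := esum_tweight_le Hw HB Hinj.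
by rewrite -lee_fin /PGW fineK // ge0_fin_numE ?esum_tweight_ge0 // (le_lt_trans H) ?ltry.
Qed.

Lemma letter_lt_luk w y : luk w -> y \in w -> (y < size w)%N.
Proof.
move=> /lukP[<- _]; elim: w => [|z w IH] //; rewrite inE => /orP[/eqP ->|/IH] /=; lia.
Qed.

Lemma luk_word w : luk w -> word (size w) (size w) w.
Proof. by move=> lw; rewrite /word eqxx /=; apply/allP => y; apply: letter_lt_luk. Qed.

Lemma PGW_dfs_le n (A : set tree) (B : pred (seq nat)) :
  (forall t, A t -> tsize t = n /\ B (dfs_word t)) ->
  PGW mu A <= Pr mu n n (fun w => luk w && B w).
Proof.
move=> H; apply: (@PGW_le _ _ _ dfs_word).
- by move=> t _; exact: tweight_dfs.
- move=> t /H[tn ->]; have lw := dfs_word_luk t; rewrite lw andbT /=.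
  by have := luk_word lw; rewrite size_dfs_word tn => ->.
- by move=> t t' _ _; apply: dfs_word_inj.
Qed.

Lemma PGW_bfs_le n (A : set tree) (B : pred (seq nat)) :
  (forall t, A t -> tsize t = n /\ B (bfs_word n [:: t])) ->
  PGW mu A <= Pr mu n n (fun w => luk w && B w).
Proof.
have fs t : forest_size [:: t] = tsize t by rewrite /forest_size /= addn0.
move=> H; apply: (@PGW_le _ _ _ (fun t => bfs_word n [:: t])).
- by move=> t /H[tn _]; rewrite -tweight_bfs ?fs ?tn // big_seq1.
- move=> t /H[tn ->]; have := bfs_word_luk t; rewrite tn => lw; rewrite lw andbT /=.
  by have := luk_word lw; rewrite size_bfs_word fs tn // => ->.
- move=> t t' /H[tn _] /H[tn' _] /bfs_word_inj; rewrite !fs tn tn'.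
  by move=> /(_ (leqnn _) (leqnn _) erefl) [].
Qed.

Lemma PGW_size_ge M n : Pr mu M n luk <= PGW mu [set t | tsize t = n].
Proof.
set A := [set t | _].
(* Finiteness is needed for a lower bound, because [fine] sends an infinite value to zero. *)
have fin : (\esum_(t in A) (tweight mu t)%:E)%E \is a fin_num.
  rewrite ge0_fin_numE ?esum_tweight_ge0 //.
  apply: le_lt_trans (ltry (Pr mu n n xpredT)); apply: (@esum_tweight_le _ _ _ dfs_word).
  - by move=> t _; exact: tweight_dfs.
  - by move=> t tn; have := luk_word (dfs_word_luk t); rewrite size_dfs_word tn => ->.
  - by move=> t t' _ _; apply: dfs_word_inj.
rewrite -lee_fin /PGW fineK //; apply: esum_ge.
pose dec (w : seq nat) : tree := xget (Node [::]) [set t | dfs_word t = w].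
have decK w : luk w -> dfs_word (dec w) = w.
  by move=> /luk_dfs_word[t tw]; rewrite /dec; apply: (@xgetPex _ _ [set t | dfs_word t = w]); exists t.
pose l := map dec (seq.filter luk (words M n)).
have ul : uniq l.
  rewrite map_inj_in_uniq ?filter_uniq ?words_uniq // => w w'.
  by rewrite !mem_filter => /andP[lw _] /andP[lw' _] /(congr1 dfs_word); rewrite !decK.
exists [set` l]; first (split; first exact: finite_seq).
  move=> t /mapP[w]; rewrite mem_filter mem_words => /andP[lw /andP[/eqP sw _]] ->.
  by rewrite /A /= -size_dfs_word decK.
rewrite -fsbig_seq //= sumEFin lee_fin big_map /Pr Ex_words big_filter [leRHS]big_mkcond /=.
apply: ler_sum => w _; case: ifP => lw; rewrite ?mulr1 ?mulr0 //.
by rewrite tweight_dfs decK.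
Qed.

End TreeMeasure.

(** * Slow variation: bounds uniform over an octave *)

Section SlowVariation.
Variable R : realType.

Lemma lebesgue_measure_translate (c : R) (A : set R) : measurable A ->
  lebesgue_measure [set x | A (x + c)] = lebesgue_measure A.
Proof.
move=> mA; transitivity (pushforward (@lebesgue_measure R)
  ((fun x => x + c) : _ -> measurableTypeR R) A) => //.
apply/esym/lebesgue_measure_unique => //=; first exact: measurable_funD.
move=> _ _ [[a b] _ <-]; rewrite /pushforward /=.
have -> : (fun x : R => x + c) @^-1` `]a, b] = `]a - c, b - c]%classic.
  by apply/seteqP; split => x /=; rewrite !in_itv /= ltrBlDr lerBrDr.
rewrite !lebesgue_measure_itv /= !lte_fin ltrD2r; case: ifP => // _.
by rewrite -!EFinB opprB addrA subrK.
Qed.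

(** Continuity from below: the sets where the property holds from rank [n] on increase to the whole
    interval. *)
Lemma eventually_measure (N : nat) (G : nat -> set R) :
  (forall m, measurable (G m)) ->
  (forall u, 0 <= u <= N%:R -> \forall m \near \oo, G m u) ->
  \forall n \near \oo, ((N%:R - 4^-1)%:E <
    lebesgue_measure ((`[0%R : R, N%:R]%classic) `&` \bigcap_(m in [set m | (n <= m)%N]) G m))%E.
Proof.
move=> mG HG.
pose F (n : nat) : set R := `[0, N%:R] `&` \bigcap_(m in [set m | (n <= m)%N]) G m.
have mF n : measurable (F n).
  by apply: measurableI => //; apply: bigcap_measurableType.
have UF : \bigcup_n F n = `[0, N%:R]%classic.
  apply/seteqP; split=> [u [n _ [] //]|u u0N].
  have [n _ Hn] := HG u ltac:(by move: u0N; rewrite /= in_itv).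
  by exists n => //; split=> // m /= nm; apply: Hn.
have ndF : {homo F : n m / (n <= m)%N >-> (n <= m)%O}.
  move=> n m nm; apply/subsetPset => u [uN Hu]; split=> // k /= mk.
  by apply: Hu => /=; apply: leq_trans mk.
have cF := @nondecreasing_cvg_mu _ _ _ (@lebesgue_measure R) F mF
  ltac:(by rewrite UF) ndF.
have mU : lebesgue_measure (\bigcup_n F n) = (N%:R)%:E.
  rewrite UF lebesgue_measure_itv /= lte_fin ltr0n lt0n; case: eqP => [->|_] //=.
  by rewrite -EFinB subr0.
have {}cF : (lebesgue_measure \o F) n @[n --> \oo] --> ((N%:R)%:E : \bar R).
  by rewrite -mU; exact: cF.
have /fine_cvgP[finF cF'] := cF.
have h : \forall t \near \oo, N%:R - 4^-1 < fine (lebesgue_measure (F t)).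
  by apply: (cvgr_gt _ cF'); rewrite ltrBlDr ltrDl invr_gt0 ltr0n.
near=> n; rewrite -/(F n).
have fn : (lebesgue_measure (F n)) \is a fin_num by near: n.
by rewrite -(fineK fn) lte_fin; near: n.
Unshelve. all: by end_near. Qed.

Variable L : R -> R.
Hypothesis L_ge0 : forall x, 0 <= x -> 0 <= L x.
Hypothesis L_sv : slowly_varying L.

Lemma sv_good_seq (x : nat -> R) : (forall m : nat, m%:R <= x m) ->
  forall u, \forall m \near \oo, 2^-1 < L (expR u * x m) / L (x m) < 2.
Proof.
move=> xm u; have [_ /(_ (expR u) (expR_gt0 u)) cL] := L_sv.
have xoo : x m @[m --> \oo] --> +oo.
  apply/cvgryPge => A; near=> m; apply: le_trans (xm m).
  by near: m; exact: nbhs_infty_ger.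
have c2 : (L (expR u * x m) / L (x m)) @[m --> \oo] --> (1 : R) := cvg_comp _ _ xoo cL.
near=> m; apply/andP; split; near: m.
  by apply: (cvgr_gt _ c2); rewrite invf_lt1 ?ltr1n.
by apply: (cvgr_lt _ c2); rewrite ltr1n.
Unshelve. all: by end_near. Qed.

Lemma sv_good_measurable (x : R) : measurable [set u | 2^-1 < L (expR u * x) / L x < 2].
Proof.
have [mL _] := L_sv.
have mf : measurable_fun setT (fun u : R => L (expR u * x) / L x).
  apply: measurable_funM => //; apply: (@measurableT_comp _ _ _ _ _ _ L) => //.
  by apply: measurable_funM => //; exact: measurable_expR.
rewrite (_ : [set u | _] = setT `&` (fun u => L (expR u * x) / L x) @^-1` `]2^-1, 2[).
  by apply: mf.
by rewrite setTI; apply/seteqP; split => u /=; rewrite in_itv.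
Qed.

(* The measure-theoretic part of the uniform convergence theorem for slowly
   varying functions: two large subsets of an interval must intersect. *)
Lemma sv_octave : exists x0 : R, 0 < x0 /\ forall x c, x0 <= x -> 1 <= c <= 2 ->
  [/\ 0 < L x, L (c * x) <= 4 * L x & L x <= 4 * L (c * x)].
Proof.
apply: contrapT => /forallNP H.
have {}H (m : nat) : {xc : R * R | [/\ m%:R + 1 <= xc.1, 1 <= xc.2 <= 2 &
    ~ [/\ 0 < L xc.1, L (xc.2 * xc.1) <= 4 * L xc.1 & L xc.1 <= 4 * L (xc.2 * xc.1)]]}.
  apply: cid; apply: contrapT => /forallNP H'; apply: (H (m%:R + 1)).
  split; first by rewrite ltr_wpDl.
  move=> x c hx hc; apply: contrapT => H2; exact: (H' (x, c)).
pose x m := (projT1 (H m)).1; pose c m := (projT1 (H m)).2.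
have hx m : m%:R + 1 <= x m by rewrite /x; case: (projT2 (H m)).
have hc m : 1 <= c m <= 2 by rewrite /c; case: (projT2 (H m)).
have hbad m : ~ [/\ 0 < L (x m), L (c m * x m) <= 4 * L (x m) & L (x m) <= 4 * L (c m * x m)].
  by rewrite /x /c; case: (projT2 (H m)).
have hx' m : m%:R <= x m by apply: le_trans (hx m); rewrite lerDl.
have hcx m : m%:R <= c m * x m.
  apply: le_trans (hx' m) _; rewrite ler_peMl //; last by case/andP: (hc m).
  by apply: le_trans (hx' m).
pose GA m : set R := [set u | 2^-1 < L (expR u * x m) / L (x m) < 2].
pose GB m : set R := [set u | 2^-1 < L (expR u * (c m * x m)) / L (c m * x m) < 2].
pose A n : set R := `[0%R, 2%:R]%classic `&` \bigcap_(m in [set m | (n <= m)%N]) GA m.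
pose B n : set R := `[0%R, 1%:R]%classic `&` \bigcap_(m in [set m | (n <= m)%N]) GB m.
have hA : \forall n \near \oo, ((2 - 4^-1)%:E < lebesgue_measure (A n))%E.
  exact: (@eventually_measure 2 GA (fun m => sv_good_measurable _) (fun u _ => sv_good_seq hx' u)).
have hB : \forall n \near \oo, ((1 - 4^-1)%:E < lebesgue_measure (B n))%E.
  exact: (@eventually_measure 1 GB (fun m => sv_good_measurable _) (fun u _ => sv_good_seq hcx u)).
have [n [hAn hBn]] : exists n, ((2 - 4^-1)%:E < lebesgue_measure (A n))%E /\
    ((1 - 4^-1)%:E < lebesgue_measure (B n))%E.
  have [n1 _ h1] := hA; have [n2 _ h2] := hB; exists (maxn n1 n2); split.
    by apply: h1; rewrite /= leq_maxl.
  by apply: h2; rewrite /= leq_maxr.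
have mA : measurable (A n).
  by apply: measurableI => //; apply: bigcap_measurableType => k _; exact: sv_good_measurable.
have mB : measurable (B n).
  by apply: measurableI => //; apply: bigcap_measurableType => k _; exact: sv_good_measurable.
pose s := ln (c n).
have c0 : 0 < c n by apply: lt_le_trans (ltr01) _; case/andP: (hc n).
have es : expR s = c n by rewrite lnK.
have s0 : 0 <= s by rewrite /s ln_ge0; case/andP: (hc n).
have s1 : s <= 1.
  rewrite -ler_expR es; apply: (@le_trans _ _ 2); first by case/andP: (hc n).
  by have := @expR_ge1Dx R 1; rewrite -natr1.
(* Since [0 <= s <= 1], the translate [C] of [B n] stays in the interval from 0 to 2, where measures
   above [2 - 4^-1] and [1 - 4^-1] cannot be disjoint. At a common point [u], the value
   [L (expR u * x n)] is comparable with both [L (x n)] and [L (c n * x n)]. *)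
pose C : set R := [set u | B n (u + - s)].
have mC : measurable C.
  rewrite -[C]setTI; apply: (_ : measurable_fun setT (fun x : R => x + - s)) => //.
  exact: measurable_funD.
have hC : lebesgue_measure C = lebesgue_measure (B n) by apply: lebesgue_measure_translate.
have [u [Au Cu]] : (A n `&` C) !=set0.
  apply/set0P/negP => /eqP AC0.
  have : (lebesgue_measure (A n `|` C) <= lebesgue_measure (`[0%R, 2%R] : set R))%E.
    apply: le_measure; rewrite ?inE //; first exact: measurableU.
    move=> u [[] //|[]] /=; rewrite !in_itv /= => /andP[h1 h2] _.
    by apply/andP; split; lra.
  rewrite measureU // lebesgue_measure_itv /= lte_fin ltr0n /= -EFinB subr0 hC.
  apply/negP; rewrite -ltNge; apply: lt_trans (lteD hAn hBn).
  by rewrite -EFinD lte_fin; lra.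
apply: (hbad n).
have /andP[a1 a2] : 2^-1 < L (expR u * x n) / L (x n) < 2.
  by case: Au => _ /(_ n); apply => /=.
have /andP[b1 b2] : 2^-1 < L (expR u * x n) / L (c n * x n) < 2.
  case: Cu => _ /(_ n) /(_ (leqnn _)) /=.
  rewrite /GB /=; have -> // : expR (u - s) * (c n * x n) = expR u * x n.
  by rewrite mulrA -es -expRD subrK.
have xn0 : 0 <= x n by apply: le_trans (hx' n).
(* Division by zero gives zero, so a quotient above [2^-1] forces a nonzero denominator. *)
have pos y : 0 <= y -> 2^-1 < L (expR u * x n) / L y -> 0 < L y.
  move=> y0; case: (ltrgtP 0 (L y)) (L_ge0 y0) => // <- _.
  by rewrite invr0 mulr0 ltNge invr_ge0 ler0n.
have Lx := pos _ xn0 a1.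
have Lcx := pos _ (mulr_ge0 (ltW c0) xn0) b1.
rewrite ltr_pdivlMr // in a1; rewrite ltr_pdivlMr // in b1.
rewrite ltr_pdivrMr // in a2; rewrite ltr_pdivrMr // in b2.
split=> //; lra.
Qed.

End SlowVariation.

(** * Sums of powers, tails of the offspring law, Potter bounds *)

Section SqrtSums.
Variable R : realType.

Definition rt (k : nat) : R := Num.sqrt k%:R.

Lemma rt_gt0 k : (0 < k)%N -> 0 < rt k.
Proof. by move=> k0; rewrite /rt sqrtr_gt0 ltr0n. Qed.

Lemma rt_sqr k : rt k * rt k = k%:R.
Proof. by rewrite -expr2 sqr_sqrtr ?ler0n. Qed.

Lemma rt_ge1 k : (0 < k)%N -> 1 <= rt k.
Proof. by move=> k0; rewrite -[leLHS]sqrtr1 ler_sqrt ?ltr0n // ler1n. Qed.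

Lemma rt_le j k : (j <= k)%N -> rt j <= rt k.
Proof. by move=> jk; rewrite ler_wsqrtr // ler_nat. Qed.

Lemma sum_inv_rt b : \sum_(1 <= j < b.+1) (rt j)^-1 <= 2 * rt b.
Proof.
elim: b => [|b IH]; first by rewrite big_geq // mulr_ge0 ?sqrtr_ge0.
rewrite big_nat_recr //=; apply: le_trans (lerD IH (lexx _)) _.
have s0 := @rt_gt0 b.+1 isT.
rewrite -(ler_pM2r s0) mulrDl mulVf ?gt_eqF //.
have := rt_sqr b.+1; have := rt_sqr b; rewrite -natr1.
move: (rt b) (rt b.+1) => t s h1 h2; have : 0 <= (s - t) * (s - t) by rewrite -expr2 sqr_ge0.
nra.
Qed.

(** Comparison with the telescoping differences of [4 / rt j]. *)
Lemma sum_inv_rt3 k N : (0 < k)%N -> \sum_(k <= j < N) (j%:R * rt j)^-1 <= 4 / rt k.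
Proof.
have step j : (0 < j)%N -> (j%:R * rt j)^-1 <= 4 / rt j - 4 / rt j.+1.
  move=> j0; have t0 := rt_gt0 j0; have s0 := @rt_gt0 j.+1 isT.
  rewrite -rt_sqr; have := rt_sqr j; have := rt_sqr j.+1; have := rt_ge1 j0.
  rewrite -natr1; move: (rt j) (rt j.+1) t0 s0 => t s t0 s0 t1 h1 h2.
  have -> : 4 / t - 4 / s = (4 * (s - t)) / (t * s) by field; rewrite !gt_eqF.
  rewrite -[leLHS]mul1r ler_pdivrMr ?mulr_gt0 //.
  have -> : 4 * (s - t) / (t * s) * (t * t * t) = (4 * (s - t) * (t * t)) / s by field; rewrite !gt_eqF.
  rewrite ler_pdivlMr // mul1r.
  have := sqr_ge0 (s - t); rewrite expr2 => h3.
  rewrite -(ler_pM2r (addr_gt0 s0 t0)).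
  have -> : 4 * (s - t) * (t * t) * (s + t) = 4 * (t * t) * (s * s - t * t) by ring.
  nra.
move=> k0; have [Nk|kN] := leqP N k.
  by rewrite big_geq // divr_ge0 // sqrtr_ge0.
suff : \sum_(k <= j < N) (j%:R * rt j)^-1 <= 4 / rt k - 4 / rt N.
  by move/le_trans; apply; rewrite lerBlDr lerDl divr_ge0 // sqrtr_ge0.
rewrite -(subnKC (ltnW kN)); elim: (N - k)%N => [|i IH].
  by rewrite addn0 big_geq // subrr.
rewrite addnS big_nat_recr ?leq_addr //=; apply: le_trans (lerD IH (step _ _)) _; first by lia.
by rewrite addrA subrK.
Qed.

End SqrtSums.

Section Tails.
Variables (R : realType) (mu : nat -> R).

(** As mass and mean are both one, [T0 m] is [P(Y >= m)] and [T1 m] is [E[Y; Y >= m]], obtained from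
    finite sums. At positive integers, [ell] coincides with the slowly varying function [L]. *)
Definition T0 (m : nat) : R := 1 - \sum_(0 <= k < m) mu k.
Definition T1 (m : nat) : R := 1 - \sum_(0 <= k < m) k%:R * mu k.
Definition ell (k : nat) : R := k%:R ^+ 2 * mu k.

Lemma tail_sum_lim (f : nat -> R) (x : R) (m : nat) (l : R) :
  (\sum_(0 <= k < N) f k) @[N --> \oo] --> l ->
  (forall k : nat, (x <= k%:R) = (m <= k)%N) ->
  fine (\sum_(k <oo | (x <= k%:R)%R) (f k)%:E)%E = l - \sum_(0 <= k < m) f k.
Proof.
move=> cf xm.
suff -> : (\sum_(k <oo | (x <= k%:R)%R) (f k)%:E)%E = (l - \sum_(0 <= k < m) f k)%:E by [].
apply: cvg_lim => //.
rewrite (_ : (fun n => _) = EFin \o (fun n => \sum_(0 <= k < n | (m <= k)%N) f k)); last first.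
  apply/funext => n /=; rewrite sumEFin; congr EFin; apply: eq_bigl => k; exact: xm.
apply: cvg_EFin; first by near=> n.
rewrite (_ : fine \o _ = (fun n => \sum_(0 <= k < n | (m <= k)%N) f k)) //.
apply: cvg_trans (cvgB cf (cvg_cst (\sum_(0 <= k < m) f k))).
apply: near_eq_cvg; near=> n.
have mn : (m <= n)%N by near: n; exists m.
transitivity (\sum_(0 <= k < n) f k - \sum_(0 <= k < m) f k) => //.
rewrite [X in X - _ = _](@big_cat_nat _ _ _ m) //= addrAC subrr add0r.
have z : \sum_(0 <= k < m | (m <= k)%N) f k = 0.
  by rewrite big_nat_cond big1 // => k /andP[/andP[_ km] mk]; lia.
rewrite [RHS](@big_cat_nat _ _ _ m) //= z add0r.
by rewrite [LHS]big_nat_cond [RHS]big_nat_cond; apply: eq_bigl => k; lia.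
Unshelve. all: by end_near. Qed.

Hypothesis Hmu : H_mu mu.

Lemma mu_ge0 k : 0 <= mu k. Proof. by case: Hmu. Qed.

Lemma T0_0 : T0 0 = 1. Proof. by rewrite /T0 big_geq // subr0. Qed.
Lemma T1_0 : T1 0 = 1. Proof. by rewrite /T1 big_geq // subr0. Qed.

Lemma T0S m : T0 m = mu m + T0 m.+1.
Proof. by rewrite /T0 big_nat_recr //= opprD addrCA (addrC (mu m)) subrK. Qed.
Lemma T1S m : T1 m = m%:R * mu m + T1 m.+1.
Proof. by rewrite /T1 big_nat_recr //= opprD addrCA (addrC (_ * mu m)) subrK. Qed.

Lemma T0_cat a b : (a <= b)%N -> T0 a = \sum_(a <= k < b) mu k + T0 b.
Proof. by move=> ab; rewrite /T0 [X in _ = _ + (1 - X)](@big_cat_nat _ _ _ a) //=; ring. Qed.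
Lemma T1_cat a b : (a <= b)%N -> T1 a = \sum_(a <= k < b) k%:R * mu k + T1 b.
Proof. by move=> ab; rewrite /T1 [X in _ = _ + (1 - X)](@big_cat_nat _ _ _ a) //=; ring. Qed.

Lemma T0_cvg : T0 m @[m --> \oo] --> (0 : R).
Proof.
case: Hmu => _ [c0 _]; rewrite -[X in _ --> X](subrr 1).
by apply: cvgB => //; exact: cvg_cst.
Qed.
Lemma T1_cvg : T1 m @[m --> \oo] --> (0 : R).
Proof.
case: Hmu => _ [_ [c0 _]]; rewrite -[X in _ --> X](subrr 1).
by apply: cvgB => //; exact: cvg_cst.
Qed.

Lemma T0_le a b : (a <= b)%N -> T0 b <= T0 a.
Proof. by move=> ab; rewrite (T0_cat ab) lerDr; apply: sumr_ge0 => k _; exact: mu_ge0. Qed.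
Lemma T1_le a b : (a <= b)%N -> T1 b <= T1 a.
Proof.
by move=> ab; rewrite (T1_cat ab) lerDr; apply: sumr_ge0 => k _; rewrite mulr_ge0 // mu_ge0.
Qed.

Lemma nonincr_cvg0_ge0 (f : nat -> R) : (forall a b, (a <= b)%N -> f b <= f a) ->
  f m @[m --> \oo] --> (0 : R) -> forall m, 0 <= f m.
Proof.
move=> fn fc m; rewrite leNgt; apply/negP => fm0.
have [N _ HN] := cvgr_gt _ fc _ fm0.
by have := HN (maxn N m) (leq_maxl _ _); rewrite /= ltNge fn // leq_maxr.
Qed.

Lemma T0_ge0 m : 0 <= T0 m. Proof. exact: (nonincr_cvg0_ge0 T0_le T0_cvg). Qed.
Lemma T1_ge0 m : 0 <= T1 m. Proof. exact: (nonincr_cvg0_ge0 T1_le T1_cvg). Qed.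
Lemma T0_le1 m : T0 m <= 1. Proof. by rewrite -T0_0; apply: T0_le. Qed.
Lemma T1_le1 m : T1 m <= 1. Proof. by rewrite -T1_0; apply: T1_le. Qed.

Lemma sum_mu m : \sum_(0 <= k < m) mu k = 1 - T0 m.
Proof. by rewrite /T0 opprB addrC subrK. Qed.
Lemma sum_mu_le1 m : \sum_(0 <= k < m) mu k <= 1.
Proof. by rewrite sum_mu lerBlDr lerDl T0_ge0. Qed.

Lemma nat_ceil (x : R) : exists m, forall k : nat, (x <= k%:R) = (m <= k)%N.
Proof.
have ex : exists m, x <= m%:R.
  by exists (Num.bound `|x|); apply: le_trans (ler_norm x) (ltW (archi_boundP (normr_ge0 x))).
exists (ex_minn ex) => k; case: ex_minnP => m xm min; apply/idP/idP => [/min //|mk].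
by apply: le_trans xm _; rewrite ler_nat.
Qed.

Lemma tailE_T1 (x : R) m : (forall k : nat, (x <= k%:R) = (m <= k)%N) -> tailE mu x = T1 m.
Proof. by move=> xm; case: Hmu => _ [_ [c1 _]]; exact: (tail_sum_lim c1 xm). Qed.

Lemma tailP_T0 (x : R) m : (forall k : nat, (x <= k%:R) = (m <= k)%N) -> tailP mu x = T0 m.
Proof. by move=> xm; case: Hmu => _ [c1 _]; exact: (tail_sum_lim c1 xm). Qed.

Lemma tailE_nat m : tailE mu m%:R = T1 m.
Proof. by apply: tailE_T1 => k; rewrite ler_nat. Qed.

Lemma tailE_le (x y : R) : x <= y -> tailE mu y <= tailE mu x.
Proof.
move=> xy; have [m xm] := nat_ceil x; have [n yn] := nat_ceil y.
rewrite (tailE_T1 xm) (tailE_T1 yn); apply: T1_le.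
by rewrite -xm (le_trans xy) // yn.
Qed.

(** Potter bounds with exponent one half, denominators cleared: [ell] changes between [j] and [k] by
    a factor at most [4 * rt k / rt j]. Far out, each doubling costs at most the square root of 2,
    and [sv_octave] supplies the factor 4 for the last incomplete octave. *)
Lemma potter : exists k0, (0 < k0)%N /\ forall j k, (k0 <= j)%N -> (j <= k)%N ->
  [/\ 0 < mu j, ell k * rt R j <= 4 * rt R k * ell j & ell j * rt R j <= 4 * rt R k * ell k].
Proof.
case: Hmu => _ [_ [_ [L [L0 [svL muL]]]]].
have [x0 [x00 oct]] := sv_octave L0 svL.
have s2 : 1 < Num.sqrt 2 :> R by rewrite -[ltLHS]sqrtr1 ltr_sqrt ?ltr1n.
have s20 : 0 < Num.sqrt 2 :> R by apply: lt_trans s2.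
have [x1 [x10 dbl]] : exists x1, 0 < x1 /\ forall x, x1 <= x ->
    L (2 * x) <= Num.sqrt 2 * L x /\ L x <= Num.sqrt 2 * L (2 * x).
  have [_ /(_ 2 ltac:(by [])) c2] := svL.
  have : \forall x \near +oo_R, (Num.sqrt 2)^-1 < L (2 * x) / L x < Num.sqrt 2.
    near=> x; apply/andP; split; near: x.
      by apply: (cvgr_gt _ c2); rewrite invf_lt1.
    exact: (cvgr_lt _ c2).
  move=> [A [Areal HA]]; exists (Num.max (A + 1) x0); split; first by rewrite lt_max x00 orbT.
  move=> x; rewrite ge_max => /andP[Ax x0x].
  have /andP[h1 h2] : (Num.sqrt 2)^-1 < L (2 * x) / L x < Num.sqrt 2.
    by apply: HA; apply: lt_le_trans Ax; rewrite ltrDl.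
  have [Lx _ _] := oct x 1 x0x ltac:(by rewrite lexx ler1n).
  rewrite ltr_pdivlMr // ltr_pdivrMl // in h1; rewrite ltr_pdivrMr // in h2.
  by split; apply: ltW.
have main i x y : Num.max x0 x1 <= x -> 2 ^+ i * x <= y <= 2 ^+ i.+1 * x ->
    L y <= 4 * Num.sqrt 2 ^+ i * L x /\ L x <= 4 * Num.sqrt 2 ^+ i * L y.
  elim: i x y => [|i IH] x y hx /andP[hy1 hy2].
    rewrite ge_max in hx; case/andP: hx => hx0 hx1.
    have xp : 0 < x by apply: lt_le_trans hx0.
    have [|_] := oct x (y / x) hx0 _.
      by rewrite ler_pdivlMr // ler_pdivrMr // -[2]/(2 ^+ 1) hy2 andbT -[1](expr0 2).
    by rewrite divfK ?gt_eqF // expr0 mulr1.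
  have hx' : Num.max x0 x1 <= 2 * x.
    apply: (le_trans hx); rewrite ler_peMl ?ler1n //.
    by apply: le_trans (hx); rewrite le_max (ltW x00).
  have [|a1 a2] := IH (2 * x) y hx'; first by rewrite !mulrA -!exprSr hy1.
  have [b1 b2] := dbl x ltac:(by move: hx; rewrite ge_max => /andP[]).
  rewrite exprS; have P : 0 < 4 * Num.sqrt 2 ^+ i :> R by rewrite mulr_gt0 // exprn_gt0.
  split.
    apply: le_trans a1 _.
    have -> : 4 * (Num.sqrt 2 * Num.sqrt 2 ^+ i) * L x = 4 * Num.sqrt 2 ^+ i * (Num.sqrt 2 * L x) by ring.
    by rewrite ler_pM2l.
  apply: le_trans b2 _.
  have -> : 4 * (Num.sqrt 2 * Num.sqrt 2 ^+ i) * L y = Num.sqrt 2 * (4 * Num.sqrt 2 ^+ i * L y) by ring.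
  by rewrite ler_pM2l.
pose k0 := (Num.bound (Num.max x0 x1)).+1.
have k0x : Num.max x0 x1 <= k0%:R.
  apply: (@le_trans _ _ (Num.bound (Num.max x0 x1))%:R); last by rewrite ler_nat.
  by apply/ltW/archi_boundP; rewrite le_max (ltW x00).
exists k0; split=> // j k k0j jk.
have j0 : (0 < j)%N by apply: leq_trans k0j.
have k00 : (0 < k)%N by apply: leq_trans jk.
have hj : Num.max x0 x1 <= j%:R by apply: (le_trans k0x); rewrite ler_nat.
have ellL n : (0 < n)%N -> ell n = L n%:R.
  by move=> n0; rewrite /ell muL // mulrC divfK // expf_neq0 // pnatr_eq0 -lt0n.
have Lj : 0 < L j%:R.
  have [] // := oct j%:R 1 _ ltac:(by rewrite lexx ler1n).
  by apply: le_trans hj; rewrite le_max lexx.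
pose i := trunc_log 2 (k %/ j).
have q0 : (0 < k %/ j)%N by rewrite divn_gt0.
have i1 : (2 ^ i * j <= k)%N by rewrite -leq_divRL // trunc_logP.
have i2 : (k < 2 ^ i.+1 * j)%N by rewrite -ltn_divLR // trunc_log_ltn.
have [|h1 h2] := main i j%:R k%:R hj.
  by rewrite -!natrX -!natrM !ler_nat i1 ltnW.
have si : Num.sqrt 2 ^+ i * rt R j <= rt R k.
  rewrite -(@ler_pXn2r _ 2%N) ?nnegrE ?mulr_ge0 ?exprn_ge0 ?sqrtr_ge0 //.
  rewrite exprMn exprAC !sqr_sqrtr ?ler0n //.
  by rewrite -natrX -natrM ler_nat.
have r0 : 0 <= rt R j by exact: sqrtr_ge0.
have Lk : 0 <= L k%:R by apply: L0.
split.
- by rewrite muL // divr_gt0 // exprn_gt0 // ltr0n.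
- rewrite !ellL //; apply: le_trans (ler_wpM2r r0 h1) _.
  by rewrite mulrAC ler_wpM2r ?(ltW Lj) // -mulrA ler_wpM2l.
- rewrite !ellL //; apply: le_trans (ler_wpM2r r0 h2) _.
  by rewrite mulrAC ler_wpM2r // -mulrA ler_wpM2l.
Unshelve. all: by end_near. Qed.

End Tails.

(** * Karamata estimates for the tails *)

Section Karamata.
Variables (R : realType) (mu : nat -> R).
Hypothesis Hmu : H_mu mu.
Local Notation T0 := (T0 mu).
Local Notation T1 := (T1 mu).
Local Notation ell := (ell mu).
Local Notation rt := (rt R).

Lemma ell_ge0 k : 0 <= ell k.
Proof. by rewrite /ell mulr_ge0 ?sqr_ge0 // mu_ge0. Qed.

Lemma mu_pos_near : \forall k \near \oo, 0 < mu k.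
Proof.
have [k0 [_ H]] := potter Hmu.
by exists k0 => // k /= kk; have [] := H k k kk (leqnn _).
Qed.

Lemma T1_gt0 m : 0 < T1 m.
Proof.
have [k0 [k00 H]] := potter Hmu; pose k := maxn k0 m.
apply: lt_le_trans (T1_le Hmu (leq_maxr k0 m)); rewrite T1S ltr_pwDl ?T1_ge0 //.
rewrite mulr_gt0 ?ltr0n //; first by rewrite leq_max k00.
by have [] := H _ _ (leq_maxl k0 m) (leqnn _).
Qed.

Lemma ell_double i : \forall k \near \oo, ell k <= 2 * ell (2 ^ i * k)%N.
Proof.
case: (Hmu) => _ [_ [_ [L [L0 [svL muL]]]]].
have [x0 [x00 oct]] := sv_octave L0 svL.
have [_ /(_ (2 ^+ i) ltac:(by rewrite exprn_gt0))] := svL => c2.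
have [A [_ HA]] : \forall x \near +oo_R, 2^-1 < L (2 ^+ i * x) / L x.
  by apply: (cvgr_gt _ c2); rewrite invf_lt1 ?ltr1n.
exists (Num.bound `|Num.max (A + 1) x0|).+1 => // k /= kb.
have k0 : (0 < k)%N by apply: leq_trans kb.
have : Num.max (A + 1) x0 <= k%:R.
  apply: le_trans (ler_norm _) _; apply: le_trans (ltW (archi_boundP (normr_ge0 _))) _.
  by rewrite ler_nat ltnW.
rewrite ge_max => /andP[Ak xk].
have ellL n : (0 < n)%N -> ell n = L n%:R.
  by move=> n0; rewrite /ell muL // mulrC divfK // expf_neq0 // pnatr_eq0 -lt0n.
rewrite !ellL ?muln_gt0 ?expn_gt0 //.
have [Lk _ _] := oct k%:R 1 xk ltac:(by rewrite lexx ler1n).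
have := HA k%:R; rewrite ltr_pdivlMr // natrM natrX => h.
have : 2^-1 * L k%:R < L (2 ^+ i * k%:R) by apply: h; apply: lt_le_trans Ak; rewrite ltrDl.
lra.
Qed.

Lemma rt_double k j : (j <= k.*2)%N -> rt j <= 2 * rt k.
Proof.
move=> jk; apply: le_trans (rt_le R jk) _.
rewrite -(@ler_pXn2r _ 2%N) ?nnegrE ?mulr_ge0 ?sqrtr_ge0 //.
rewrite exprMn !sqr_sqrtr ?ler0n // -natrX -natrM ler_nat; lia.
Qed.

Lemma ell_octave : exists k0, (0 < k0)%N /\ forall k j, (k0 <= k)%N -> (k <= j < k.*2)%N ->
  ell k <= 8 * ell j.
Proof.
have [k0 [k00 H]] := potter Hmu; exists k0; split=> // k j kk /andP[kj jk].
have [_ _ h] := H k j kk kj.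
have rk : 0 < rt k by rewrite rt_gt0 //; lia.
have r2 : rt j <= 2 * rt k by apply: rt_double; lia.
rewrite -(ler_pM2r rk); apply: le_trans h _.
have := ell_ge0 j; nra.
Qed.

Lemma T1_double : exists k0, (0 < k0)%N /\ forall k, (k0 <= k)%N ->
  16^-1 * ell k + T1 (k.*2) <= T1 k.
Proof.
have [k0 [k00 H]] := ell_octave; exists k0; split=> // k kk.
rewrite (@T1_cat _ mu k k.*2); last by lia.
rewrite lerD2r; have k0' : 0 < k%:R :> R by rewrite ltr0n; lia.
have -> : 16^-1 * ell k = \sum_(k <= j < k.*2) (16^-1 * ell k / k%:R).
  rewrite sumr_const_nat (_ : (k.*2 - k)%N = k); last by lia.
  by rewrite -[RHS]mulr_natr divfK // gt_eqF.
rewrite [leLHS]big_nat_cond [leRHS]big_nat_cond; apply: ler_sum => j /andP[/andP[kj jk] _].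
have := H k j kk ltac:(by rewrite kj jk).
have j2 : j%:R <= 2 * k%:R :> R by rewrite -natrM ler_nat; lia.
have j0 : k%:R <= j%:R :> R by rewrite ler_nat.
rewrite {2}/ell ler_pdivrMr //.
move: (mu_ge0 Hmu j) => m0 h.
have : 16^-1 * ell k <= 2^-1 * (j%:R ^+ 2 * mu j) by lra.
move/le_trans; apply.
rewrite expr2; have : 0 <= j%:R * mu j by rewrite mulr_ge0.
nra.
Qed.

(** Each of the [m] dyadic blocks that follow [k] contributes at least [ell k / 32] to [T1 k], and
    [m] is at least [32 / e]. Only finitely many blocks are used, so slow variation applies to all
    of them at once. *)
Lemma ell_small (e : R) : 0 < e -> \forall k \near \oo, ell k <= e * T1 k.
Proof.
move=> e0; have [k0 [k00 H]] := T1_double.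
have dy m : forall k, (k0 <= k)%N -> \sum_(0 <= i < m) 16^-1 * ell (2 ^ i * k) <= T1 k.
  elim: m => [|m IH] k kk; first by rewrite big_geq // T1_ge0.
  rewrite big_nat_recl //= expn0 mul1n; apply: le_trans (H k kk); rewrite lerD2l.
  apply: le_trans (IH k.*2 _); last by lia.
  by apply: ler_sum => i _; rewrite expnS mulnAC mul2n mulnC.
pose m := (Num.bound (32 / e)).+1.
have hm : 32 / e <= m%:R.
  apply: le_trans (ltW (archi_boundP _)) _; first by rewrite divr_ge0 // ltW.
  by rewrite ler_nat.
have dbl : \forall k \near \oo, forall i, (i < m)%N -> ell k <= 2 * ell (2 ^ i * k)%N.
  elim: (m) => [|m' IH]; first by near=> k.
  have h := ell_double m'; near=> k => i; rewrite ltnS leq_eqVlt => /orP[/eqP ->|].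
    by near: k.
  by move: i; near: k.
near=> k.
have kk : (k0 <= k)%N by near: k; exists k0.
have hk : forall i, (i < m)%N -> ell k <= 2 * ell (2 ^ i * k)%N by near: k.
have : m%:R * (32^-1 * ell k) <= T1 k.
  apply: le_trans (dy m k kk); rewrite mulr_natl -[X in _ *+ X]subn0 -sumr_const_nat.
  rewrite [leLHS]big_nat_cond [leRHS]big_nat_cond; apply: ler_sum => i /andP[/andP[_ im] _].
  have := hk i im; lra.
have := ell_ge0 k; move: hm; rewrite ler_pdivrMr // => hm l0 h.
have : 32 * ell k <= m%:R * e * ell k by rewrite ler_wpM2r.
have : e * (m%:R * (32^-1 * ell k)) <= e * T1 k by rewrite ler_pM2l.
lra.
Unshelve. all: by end_near. Qed.

Lemma rt_large (A : R) : \forall k \near \oo, A <= rt k.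
Proof.
near=> k; apply: le_trans (ler_norm A) _.
rewrite -(@ler_pXn2r _ 2%N) ?nnegrE ?sqrtr_ge0 // sqr_sqrtr ?ler0n //.
near: k; exact: nbhs_infty_ger.
Unshelve. all: by end_near. Qed.

(** By [potter], [ell k] decreases no faster than [1 / rt k]. *)
Lemma kell_large (A : R) : \forall k \near \oo, A <= k%:R * ell k.
Proof.
have [k0 [k00 H]] := potter Hmu.
have [m0 _ _] := H k0 k0 (leqnn _) (leqnn _).
pose c := ell k0 * rt k0.
have c0 : 0 < c by rewrite /c /ell !mulr_gt0 ?exprn_gt0 ?rt_gt0 ?ltr0n.
near=> k.
have kk : (k0 <= k)%N by near: k; exists k0.
have [_ _] := H k0 k (leqnn _) kk; rewrite -/c => hc.
have rk : 4 * `|A| / c <= rt k by near: k; exact: rt_large.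
rewrite -rt_sqr; apply: le_trans (ler_norm A) _.
have r0 : 0 <= rt k by exact: sqrtr_ge0.
rewrite ler_pdivrMr // in rk.
have : 4 * `|A| <= rt k * (4 * rt k * ell k).
  by apply: le_trans rk _; rewrite ler_wpM2l.
lra.
Unshelve. all: by end_near. Qed.

(** Potter bounds give [8] for the indices from [k0] on; the fixed initial sum is absorbed once
    [k * ell k] exceeds it. *)
Lemma sum_ell_le : \forall k \near \oo, \sum_(0 <= j < k) ell j <= 9 * (k%:R * ell k).
Proof.
have [k0 [k00 H]] := potter Hmu; near=> k.
have kk : (k0 <= k)%N by near: k; exists k0.
have hK : \sum_(0 <= j < k0) ell j <= k%:R * ell k by near: k; exact: kell_large.
rewrite (big_cat_nat (leq0n k0) kk) //=.
suff : \sum_(k0 <= j < k) ell j <= 8 * (k%:R * ell k) by lra.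
apply: (@le_trans _ _ (\sum_(k0 <= j < k) 4 * rt k * ell k * (rt j)^-1)).
  rewrite [leLHS]big_nat_cond [leRHS]big_nat_cond; apply: ler_sum => j /andP[/andP[kj jk] _].
  have [_ _ h] := H j k kj (ltnW jk).
  by rewrite ler_pdivlMr // rt_gt0 //; lia.
rewrite -big_distrr /=.
have : \sum_(k0 <= j < k) (rt j)^-1 <= 2 * rt k.
  apply: le_trans (sum_inv_rt R k); rewrite (@big_cat_nat _ _ _ k0 1 k.+1) //=; last by lia.
  apply: ler_wpDl; first by apply: sumr_ge0 => j _; rewrite invr_ge0 sqrtr_ge0.
  by rewrite big_nat_recr //= lerDl invr_ge0 sqrtr_ge0.
move=> h; have r0 : 0 <= rt k by exact: sqrtr_ge0.
apply: le_trans (ler_wpM2l _ h) _; first by rewrite (mulr_ge0 _ (ell_ge0 k)) // mulr_ge0.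
by rewrite -(rt_sqr R k) le_eqVlt; apply/orP; left; apply/eqP; ring.
Unshelve. all: by end_near. Qed.

Lemma T0_le_ell : \forall k \near \oo, k%:R * T0 k <= 16 * ell k.
Proof.
have [k0 [k00 H]] := potter Hmu; exists k0 => // k /= kk.
have kp : (0 < k)%N by lia.
have kp' : 0 < k%:R :> R by rewrite ltr0n.
have r0 := rt_gt0 R kp.
have part N : \sum_(k <= j < N) mu j <= 16 * ell k / k%:R.
  apply: (@le_trans _ _ (\sum_(k <= j < N) (4 * ell k / rt k) * (j%:R * rt j)^-1)).
    rewrite [leLHS]big_nat_cond [leRHS]big_nat_cond; apply: ler_sum => j /andP[/andP[kj jk] _].
    have [_ h _] := H k j kk kj.
    have jp : 0 < j%:R :> R by rewrite ltr0n; lia.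
    have rj : 0 < rt j by rewrite rt_gt0 //; lia.
    rewrite -(ler_pM2r (_ : 0 < rt k * (j%:R * rt j))); last by rewrite !mulr_gt0.
    have -> : 4 * ell k / rt k / (j%:R * rt j) * (rt k * (j%:R * rt j)) = 4 * ell k.
      by field; rewrite !gt_eqF.
    rewrite -(ler_pM2r rj); move: h; rewrite /ell expr2.
    rewrite [X in _ <= X -> _](_ : _ = 4 * (k%:R ^+ 2 * mu k) * rt j); last by ring.
    move/(le_trans _); apply; rewrite le_eqVlt; apply/orP; left; apply/eqP.
    rewrite -{2}(rt_sqr R j); ring.
  rewrite -big_distrr /=; apply: le_trans (ler_wpM2l _ (sum_inv_rt3 R N kp)) _.
    by rewrite divr_ge0 ?(mulr_ge0 _ (ell_ge0 k)) // ltW.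
  rewrite -(rt_sqr R k) le_eqVlt; apply/orP; left; apply/eqP; field; by rewrite gt_eqF.
rewrite mulrC -ler_pdivlMr //; apply/ler_addgt0Pr => e e0.
have [N _ HN] := cvgr_lt _ (T0_cvg Hmu) _ e0.
rewrite (T0_cat mu (leq_maxr N k)) lerD //.
by apply/ltW/HN; rewrite /= leq_maxl.
Qed.

Lemma T0_ge_ell : \forall k \near \oo, ell k <= 32 * (k%:R * T0 k).
Proof.
have [k0 [k00 H]] := ell_octave; exists k0 => // k /= kk.
rewrite (@T0_cat _ mu k k.*2); last by lia.
have k0' : 0 < k%:R :> R by rewrite ltr0n; lia.
have : \sum_(k <= j < k.*2) (32^-1 * ell k / k%:R ^+ 2) <= \sum_(k <= j < k.*2) mu j.
  rewrite [leLHS]big_nat_cond [leRHS]big_nat_cond; apply: ler_sum => j /andP[/andP[kj jk] _].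
  have := H k j kk ltac:(by rewrite kj jk).
  have j2 : j%:R <= 2 * k%:R :> R by rewrite -natrM ler_nat; lia.
  have j0 : k%:R <= j%:R :> R by rewrite ler_nat.
  rewrite {2}/ell ler_pdivrMr ?exprn_gt0 // !expr2.
  move: (mu_ge0 Hmu j) => m0 h.
  have : j%:R * j%:R <= 4 * (k%:R * k%:R) :> R by nra.
  nra.
rewrite sumr_const_nat (_ : (k.*2 - k)%N = k); last by lia.
rewrite -[X in X <= _ -> _]mulr_natr.
have -> : 32^-1 * ell k / k%:R ^+ 2 * k%:R = 32^-1 * ell k / k%:R by field; rewrite gt_eqF.
rewrite ler_pdivrMr // => h; have := T0_ge0 Hmu k.*2; nra.
Qed.

(** The bound grows only like the square root of [b / a]. This allows [scale_fix] to compare the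
    tails at [m n] and [B n], whose ratio is unbounded. *)
Lemma T1_diff : exists k0, (0 < k0)%N /\ forall a b, (k0 <= a)%N -> (a <= b)%N ->
  (T1 a - T1 b) * rt a <= 8 * rt b * ell a.
Proof.
have [k0 [k00 H]] := potter Hmu; exists k0; split=> // a b ka ab.
rewrite (T1_cat mu ab) addrK.
have ra : 0 < rt a by rewrite rt_gt0 //; lia.
have : \sum_(a <= j < b) j%:R * mu j <= \sum_(a <= j < b) (4 * ell a / rt a) * (rt j)^-1.
  rewrite [leLHS]big_nat_cond [leRHS]big_nat_cond; apply: ler_sum => j /andP[/andP[aj jb] _].
  have [_ h _] := H a j ka aj.
  have rj : 0 < rt j by rewrite rt_gt0 //; lia.
  have jp : 0 < j%:R :> R by rewrite ltr0n; lia.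
  rewrite ler_pdivlMr // -mulrA -mulrA [_ * (_^-1)]mulrC mulrA.
  rewrite mulrC mulrA ler_pdivlMr // mulrC.
  rewrite -(ler_pM2r rj) [leRHS](_ : _ = 4 * rt j * ell a); last by ring.
  apply: le_trans h; rewrite /ell expr2 -{2}(rt_sqr R j).
  by rewrite le_eqVlt; apply/orP; left; apply/eqP; ring.
rewrite -big_distrr /=.
have h : \sum_(a <= j < b) (rt j)^-1 <= 2 * rt b.
  apply: le_trans (sum_inv_rt R b); rewrite (@big_cat_nat _ _ _ a 1 b.+1) //=; try lia.
  apply: ler_wpDl; first by apply: sumr_ge0 => j _; rewrite invr_ge0 sqrtr_ge0.
  by rewrite big_nat_recr //= lerDl invr_ge0 sqrtr_ge0.
move=> h2; rewrite -ler_pdivlMr //; apply: le_trans h2 _.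
apply: le_trans (ler_wpM2l _ h) _; first by rewrite divr_ge0 ?(mulr_ge0 _ (ell_ge0 a)) // ltW.
rewrite le_eqVlt; apply/orP; left; apply/eqP; field; by rewrite gt_eqF.
Qed.

Lemma T1_slow (A : nat) (e : R) : 0 < e -> \forall k \near \oo,
  forall j, (k <= j <= A * k)%N -> (1 - e) * T1 k <= T1 j.
Proof.
move=> e0; have [k0 [k00 H]] := T1_diff; near=> k => j /andP[kj jA].
have kk : (k0 <= k)%N by near: k; exists k0.
have := H k j kk kj.
have lk : ell k <= e / (8 * A.+1%:R) * T1 k.
  by near: k; apply: ell_small; rewrite divr_gt0 // mulr_gt0.
have rk : 0 < rt k by rewrite rt_gt0 //; lia.
have rj : rt j <= A.+1%:R * rt k.
  rewrite -(@ler_pXn2r _ 2%N) ?nnegrE ?mulr_ge0 ?sqrtr_ge0 //.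
  rewrite exprMn !sqr_sqrtr ?ler0n // -natrX -natrM ler_nat; nia.
move=> h; have : (T1 k - T1 j) * rt k <= e * T1 k * rt k.
  apply: le_trans h _.
  apply: (@le_trans _ _ (8 * (A.+1%:R * rt k) * ell k)).
    by rewrite ler_wpM2r ?ell_ge0 // ler_wpM2l.
  apply: (@le_trans _ _ (8 * (A.+1%:R * rt k) * (e / (8 * A.+1%:R) * T1 k))).
    by rewrite ler_wpM2l // !mulr_ge0 // ltW.
  rewrite le_eqVlt; apply/orP; left; apply/eqP; field.
  by rewrite addrC natr1 pnatr_eq0.
rewrite ler_pM2r // => h2; lra.
Unshelve. all: by end_near. Qed.

(** Potter bounds yield the exponent [5 / 2], rounded up to an integer. *)
Lemma mu_le_pow3 : exists k0, (0 < k0)%N /\ forall d b, (k0 <= d)%N -> (d <= b)%N ->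
  mu d * d%:R ^+ 3 <= 4 * b%:R ^+ 3 * mu b.
Proof.
have [k0 [k00 H]] := potter Hmu; exists k0; split=> // d b kd db.
have [_ _ h] := H d b kd db.
have rd : 0 < rt d by rewrite rt_gt0 //; lia.
have rb : rt d <= rt b by apply: rt_le.
rewrite -(ler_pM2r rd).
apply: (@le_trans _ _ (d%:R * (ell d * rt d))).
  by rewrite le_eqVlt; apply/orP; left; apply/eqP; rewrite /ell; ring.
apply: le_trans (ler_wpM2l _ h) _ => //.
rewrite -(rt_sqr R d) /ell.
have -> : 4 * b%:R ^+ 3 * mu b * rt d = 4 * (b%:R ^+ 2 * mu b) * (rt b * rt b * rt d).
  by rewrite rt_sqr; ring.
have -> : rt d * rt d * (4 * rt b * (b%:R ^+ 2 * mu b)) =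
  4 * (b%:R ^+ 2 * mu b) * (rt b * rt d * rt d) by ring.
rewrite ler_wpM2l ?mulr_ge0 ?exprn_ge0 ?(mu_ge0 Hmu) // -!mulrA.
have r1 : 0 <= rt b * rt d by rewrite mulr_ge0 // ltW // (lt_le_trans rd).
by rewrite mulrA [leRHS]mulrCA; nra.
Qed.

(** The decay of order two outweighs the Potter exponent one half; the proof counts in powers of
    [rt]. *)
Lemma mu_le_const : exists k0, (0 < k0)%N /\ forall b d, (k0 <= b)%N -> (b <= d)%N ->
  mu d <= 4 * mu b.
Proof.
have [k0 [k00 H]] := potter Hmu; exists k0; split=> // b d kb bd.
have [_ h _] := H b d kb bd.
have rb : 0 < rt b by rewrite rt_gt0 //; lia.
have rd : rt b <= rt d by apply: rt_le.
have rd0 : 0 < rt d by apply: lt_le_trans rd.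
have P : 0 < rt b ^+ 5 by rewrite exprn_gt0.
have : mu d * (rt d ^+ 4 * rt b) <= 4 * mu b * (rt d * rt b ^+ 4).
  move: h; rewrite /ell -!rt_sqr => /(le_trans _) => h.
  by apply: le_trans (h _ _) _; rewrite le_eqVlt; apply/orP; left; apply/eqP; ring.
have -> : mu d * (rt d ^+ 4 * rt b) = (mu d * rt d ^+ 3) * (rt d * rt b) by ring.
have -> : 4 * mu b * (rt d * rt b ^+ 4) = (4 * mu b * rt b ^+ 3) * (rt d * rt b) by ring.
rewrite ler_pM2r ?mulr_gt0 // => h2.
have P3 : 0 < rt b ^+ 3 by rewrite exprn_gt0.
rewrite -(ler_pM2r P3); apply: le_trans h2; rewrite ler_wpM2l ?(mu_ge0 Hmu) //.
by rewrite lerXn2r // nnegrE ltW.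
Qed.

End Karamata.

(** * Exponential inequalities and the weak law for truncated steps *)

Section ExpBounds.
Variable R : realType.

Lemma expR_le_quad (x : R) : x <= 2^-1 -> expR x <= 1 + x + 2 * x ^+ 2.
Proof.
move=> x2; have x1 : 0 < 1 - x by lra.
have : 1 - x <= expR (- x) by exact: expR_ge1Dx.
rewrite expRN => h; have e0 := expR_gt0 x.
have h2 : (1 - x) * expR x <= 1.
  by rewrite -[leRHS](mulVf (lt0r_neq0 e0)) ler_wpM2r // ltW.
rewrite -(ler_pM2l x1); apply: le_trans h2 _.
rewrite (_ : (1 - x) * (1 + x + 2 * x ^+ 2) = 1 + x ^+ 2 * (1 - 2 * x)); last by ring.
by rewrite lerDl mulr_ge0 ?sqr_ge0 //; lra.
Qed.

Lemma expRN_le_inv (x : R) : 0 < x -> expR (- x) <= x^-1.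
Proof.
move=> x0; rewrite expRN lef_pV2 ?posrE ?expR_gt0 //.
by apply: le_trans (expR_ge1Dx x); rewrite lerDr.
Qed.

(** The fourth power is chosen to exceed the cube in [mu_le_pow3]; see [local_double]. *)
Lemma expRN_le_inv4 (x : R) : 0 < x -> expR (- x) <= (4 / x) ^+ 4.
Proof.
move=> x0; have -> : - x = 4%:R * - (x / 4) by field.
rewrite expRM_natl lerXn2r ?nnegrE ?expR_ge0 ?divr_ge0 ?(ltW x0) //.
apply: le_trans (expRN_le_inv _) _; first by rewrite divr_gt0.
by rewrite invf_div.
Qed.

End ExpBounds.

Section LawOfLargeNumbers.
Variables (R : realType) (mu : nat -> R).
Hypothesis Hmu : H_mu mu.
Local Notation T0 := (T0 mu).
Local Notation T1 := (T1 mu).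
Local Notation ell := (ell mu).
Let mu0 := mu_ge0 Hmu.

Definition walk (w : seq nat) : R := \sum_(y <- w) (y%:R - 1).

Lemma walkE w : walk w = (sumn w)%:R - (size w)%:R.
Proof.
rewrite /walk; elim: w => [|y w IH] /=; first by rewrite big_nil subrr.
by rewrite big_cons IH natrD -natr1; ring.
Qed.

(** A bound for the second moment of the step [y - 1] over letters below [c]; the summand 1 accounts
    for [y = 0]. *)
Definition trvar (c : nat) : R := 1 + \sum_(0 <= y < c) ell y.

Lemma trvar_ge0 c : 0 <= trvar c.
Proof. by rewrite addr_ge0 // sumr_ge0 // => y _; exact: ell_ge0. Qed.

Lemma trvar_le c : \sum_(0 <= y < c) mu y * (y%:R - 1) ^+ 2 <= trvar c.
Proof.
rewrite /trvar; case: c => [|c]; first by rewrite !big_geq // addr0.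
rewrite !big_nat_recl //= lerD //.
  rewrite sub0r sqrrN expr1n mulr1; apply: le_trans (sum_mu_le1 Hmu 1).
  by rewrite big_nat1.
rewrite -[leLHS]add0r lerD ?ell_ge0 //.
apply: ler_sum => y _; rewrite /ell mulrC ler_wpM2r //.
by rewrite -natr1 addrK lerXn2r ?nnegrE // lerDl.
Qed.

(** Criticality makes the truncated mean equal to minus a tail, up to [T0 c]: this is the source of
    the downward drift. *)
Lemma sum_step c : \sum_(0 <= y < c) mu y * (y%:R - 1) = T0 c - T1 c.
Proof.
rewrite /T0 /T1 (eq_bigr (fun y => y%:R * mu y - mu y)); last by move=> y _; ring.
by rewrite sumrB; ring.
Qed.

Lemma mgf_up c (t : R) : 0 <= t -> t * c%:R <= 2^-1 -> (0 < c)%N ->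
  \sum_(0 <= y < c) mu y * expR (t * (y%:R - 1)) <= expR (- t * T1 c + 2 * t ^+ 2 * trvar c).
Proof.
move=> t0 tc c0.
apply: (@le_trans _ _ (\sum_(0 <= y < c) (mu y + t * (mu y * (y%:R - 1)) +
   2 * t ^+ 2 * (mu y * (y%:R - 1) ^+ 2)))).
  rewrite [leLHS]big_nat_cond [leRHS]big_nat_cond; apply: ler_sum => y /andP[/andP[_ yc] _].
  rewrite [leRHS](_ : _ = mu y * (1 + t * (y%:R - 1) + 2 * (t * (y%:R - 1)) ^+ 2)); last by ring.
  rewrite ler_wpM2l // expR_le_quad //; apply: le_trans tc; rewrite ler_wpM2l //.
  by rewrite lerBlDr natr1 ler_nat ltnW // ltnS ltnW.
rewrite big_split /= big_split /= -!big_distrr /= sum_step sum_mu.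
apply: le_trans (expR_ge1Dx _).
have h1 := trvar_le c; have h2 := T0_ge0 Hmu c.
have t1 : t <= 1.
  have : 1 <= c%:R :> R by rewrite ler1n.
  nra.
have : 2 * t ^+ 2 * \sum_(0 <= y < c) mu y * (y%:R - 1) ^+ 2 <= 2 * t ^+ 2 * trvar c.
  by rewrite ler_wpM2l // mulr_ge0 ?sqr_ge0.
nra.
Qed.

(** Downward steps are at most one, so the admissible [t] do not depend on [c], in contrast with
    [mgf_up]. *)
Lemma mgf_dn c (t : R) : 0 <= t <= 2^-1 ->
  \sum_(0 <= y < c) mu y * expR (t * (1 - y%:R)) <= expR (t * T1 c + 2 * t ^+ 2 * trvar c).
Proof.
move=> /andP[t0 t1].
apply: (@le_trans _ _ (\sum_(0 <= y < c) (mu y - t * (mu y * (y%:R - 1)) +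
   2 * t ^+ 2 * (mu y * (y%:R - 1) ^+ 2)))).
  apply: ler_sum => y _.
  rewrite [leRHS](_ : _ = mu y * (1 + t * (1 - y%:R) + 2 * (t * (1 - y%:R)) ^+ 2)); last by ring.
  rewrite ler_wpM2l // expR_le_quad //; apply: le_trans t1.
  by rewrite -[leRHS]mulr1 ler_wpM2l // lerBlDr lerDl.
rewrite big_split /= sumrB -!big_distrr /= sum_step sum_mu.
apply: le_trans (expR_ge1Dx _).
have h1 := trvar_le c; have h2 := T0_ge0 Hmu c.
have : 2 * t ^+ 2 * \sum_(0 <= y < c) mu y * (y%:R - 1) ^+ 2 <= 2 * t ^+ 2 * trvar c.
  by rewrite ler_wpM2l // mulr_ge0 ?sqr_ge0.
nra.
Qed.

Lemma chernoff_up c m (t x : R) : 0 <= t -> t * c%:R <= 2^-1 -> (0 < c)%N ->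
  Pr mu c m (fun w => x <= walk w) <= expR (- t * x + m%:R * (- t * T1 c + 2 * t ^+ 2 * trvar c)).
Proof.
move=> t0 tc c0.
have : expR (t * x) * Pr mu c m (fun w => x <= walk w) <=
   Ex mu c m (fun w => \prod_(y <- w) expR (t * (y%:R - 1))).
  apply: markov_word => // w _; first by apply: prodr_ge0 => y _; exact: expR_ge0.
  move=> xw; rewrite -expR_sum -big_distrr /= ler_expR ler_wpM2l //.
rewrite Ex_prod // => h.
have : (\sum_(0 <= y < c) mu y * expR (t * (y%:R - 1))) ^+ m <=
    expR (m%:R * (- t * T1 c + 2 * t ^+ 2 * trvar c)).
  rewrite expRM_natl lerXn2r ?nnegrE ?expR_ge0 ?mgf_up //.
  by apply: sumr_ge0 => y _; rewrite mulr_ge0 ?expR_ge0.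
move/(le_trans h) => {}h.
by rewrite expRD mulNr expRN mulrC ler_pdivlMr ?expR_gt0 // mulrC.
Qed.

Lemma chernoff_dn c m (t x : R) : 0 <= t <= 2^-1 ->
  Pr mu c m (fun w => walk w <= - x) <= expR (- t * x + m%:R * (t * T1 c + 2 * t ^+ 2 * trvar c)).
Proof.
move=> t01; have /andP[t0 t1] := t01.
have : expR (t * x) * Pr mu c m (fun w => walk w <= - x) <=
   Ex mu c m (fun w => \prod_(y <- w) expR (t * (1 - y%:R))).
  apply: markov_word => // w _; first by apply: prodr_ge0 => y _; exact: expR_ge0.
  move=> xw; rewrite -expR_sum -big_distrr /= ler_expR ler_wpM2l //.
  rewrite (eq_bigr (fun y => - (y%:R - 1))); last by move=> y _; rewrite opprB.
  by rewrite sumrN lerNr.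
rewrite Ex_prod // => h.
have : (\sum_(0 <= y < c) mu y * expR (t * (1 - y%:R))) ^+ m <=
    expR (m%:R * (t * T1 c + 2 * t ^+ 2 * trvar c)).
  rewrite expRM_natl lerXn2r ?nnegrE ?expR_ge0 ?mgf_dn //.
  by apply: sumr_ge0 => y _; rewrite mulr_ge0 ?expR_ge0.
move/(le_trans h) => {}h.
by rewrite expRD mulNr expRN mulrC ler_pdivlMr ?expR_gt0 // mulrC.
Qed.

Lemma Pr_trunc_le M c m A : Pr mu M m A <= Pr mu c m A + m%:R * T0 c.
Proof.
elim: m A => [|m IH] A; first by rewrite mul0r addr0.
have [Mc|cM] := leqP M c.
  apply: ler_wpDr; first by rewrite mulr_ge0 // T0_ge0.
  by apply: Ex_le_trunc => // w _; rewrite ler0n.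
rewrite /Pr /= (big_cat_nat (leq0n c) (ltnW cM)) //=.
have h1 : \sum_(0 <= y < c) mu y * Ex mu M m (fun s => (A (y :: s))%:R) <=
  \sum_(0 <= y < c) mu y * Ex mu c m (fun s => (A (y :: s))%:R) + m%:R * T0 c.
  apply: (@le_trans _ _ (\sum_(0 <= y < c) (mu y * Ex mu c m (fun s => (A (y :: s))%:R) + mu y * (m%:R * T0 c)))).
    apply: ler_sum => y _; rewrite -mulrDr ler_wpM2l //; exact: IH.
  rewrite big_split /= lerD2l -big_distrl /= ler_piMl ?(sum_mu_le1 Hmu) //.
  by rewrite mulr_ge0 // T0_ge0.
have h2 : \sum_(c <= y < M) mu y * Ex mu M m (fun s => (A (y :: s))%:R) <= T0 c.
  apply: (@le_trans _ _ (\sum_(c <= y < M) mu y)).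
    apply: ler_sum => y _; rewrite -[leRHS]mulr1 ler_wpM2l //.
    by apply: (Pr_le1 mu0 (sum_mu_le1 Hmu M) m (fun s => A (y :: s))).
  by rewrite (T0_cat mu (ltnW cM)) lerDl T0_ge0.
apply: le_trans (lerD h1 h2) _; rewrite -natr1 mulrDl mul1r; lra.
Qed.

Lemma Pr_true_ge M m : 1 - m%:R * T0 M <= Pr mu M m xpredT.
Proof.
elim: m => [|m IH]; first by rewrite mul0r subr0 /Pr.
have -> : Pr mu M m.+1 xpredT = (1 - T0 M) * Pr mu M m xpredT.
  by rewrite /Pr /= -big_distrl /= sum_mu.
have := T0_ge0 Hmu M; have := T0_le1 Hmu M; rewrite -natr1 => h1 h0.
have : (1 - T0 M) * (1 - m%:R * T0 M) <= (1 - T0 M) * Pr mu M m xpredT.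
  by rewrite ler_wpM2l // subr_ge0.
have : 0 <= m%:R * (T0 M * T0 M) by rewrite !mulr_ge0.
nra.
Qed.

Variable B : nat -> nat.
Hypothesis B_large : forall K : nat, \forall n \near \oo, (K <= B n)%N.
Hypothesis B_scale : forall e : R, 0 < e ->
  \forall n \near \oo, (1 - e) * (B n)%:R <= n%:R * T1 (B n) <= (1 + e) * (B n)%:R.

Lemma near_B (P : nat -> Prop) : (\forall k \near \oo, P k) -> \forall n \near \oo, P (B n).
Proof.
move=> [K _ HK]; have [N _ HN] := B_large K; exists N => // n /= nN.
exact/HK/HN.
Qed.

Lemma near_Bdiv (K : nat) (P : nat -> Prop) : (0 < K)%N -> (\forall k \near \oo, P k) ->
  \forall n \near \oo, P (B n %/ K)%N.
Proof.
move=> K0 [k _ HK]; have [N _ HN] := B_large (k * K); exists N => // n /= nN.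
by apply: HK; rewrite /= leq_divRL //; apply: HN.
Qed.

Lemma B_le_n (A : nat) : \forall n \near \oo, (A * B n <= n)%N.
Proof.
near=> n.
have /andP[h _] : (1 - 2^-1) * (B n)%:R <= n%:R * T1 (B n) <= (1 + 2^-1) * (B n)%:R.
  by near: n; apply: B_scale.
have h2 : T1 (B n) < (2 * A.+1%:R)^-1.
  by near: n; apply: (@near_B (fun k => T1 k < _)); apply: (cvgr_lt _ (T1_cvg Hmu)); rewrite invr_gt0 mulr_gt0.
have A0 : 0 < A.+1%:R :> R by rewrite ltr0n.
have : n%:R * T1 (B n) <= n%:R * (2 * A.+1%:R)^-1 by rewrite ler_wpM2l // ltW.
move/(le_trans h); rewrite ler_pdivlMr ?mulr_gt0 // => h3.
rewrite -(ler_nat R) natrM; move: h3.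
have AA : A%:R <= A.+1%:R :> R by rewrite ler_nat.
have : 0 <= (B n)%:R :> R by [].
nra.
Unshelve. all: by end_near. Qed.

(** Slow variation of [T1] allows [B n] to be replaced by [c = B n %/ K] in [B_scale]. The variance
    and the number of larger letters are governed by [n * ell c], which is negligible against
    [n * T1 c], hence against [B n]. *)
Lemma scale_facts (K : nat) (e : R) : (0 < K)%N -> 0 < e -> \forall n \near \oo,
  [/\ (0 < B n %/ K)%N, `|n%:R * T1 (B n %/ K) - (B n)%:R| <= e * (B n)%:R,
      n%:R * trvar (B n %/ K) <= e * (B n)%:R ^+ 2 & n%:R * T0 (B n %/ K) <= e].
Proof.
move=> K0 e0; pose e1 := Num.min (e / 4) (4^-1).
have e10 : 0 < e1 by rewrite lt_min divr_gt0 //= invr_gt0.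
have e1e : e1 <= e / 4 by rewrite ge_min lexx.
have e14 : e1 <= 4^-1 by rewrite ge_min lexx orbT.
clearbody e1; pose e2 := e / (64 * K%:R).
have Kr : 0 < K%:R :> R by rewrite ltr0n.
have K1 : 1 <= K%:R :> R by rewrite ler1n.
have e20 : 0 < e2 by rewrite divr_gt0 // mulr_gt0.
have e2K : e2 * (64 * K%:R) = e by rewrite divfK // mulf_neq0 // gt_eqF.
clearbody e2.
have hs := B_scale e10.
have hl := ell_small Hmu e20.
have hsl := T1_slow Hmu (2 * K) e10.
near=> n; set b := (B n)%:R; set c := (B n %/ K)%N.
have c0 : (0 < c)%N by rewrite /c; near: n; apply: (@near_Bdiv _ (fun c => (0 < c)%N)) => //; exists 1%N.
have cr : 0 < c%:R :> R by rewrite ltr0n.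
have cK : (c * K <= B n)%N by rewrite leq_trunc_div.
have cB : (c <= B n <= (2 * K) * c)%N.
  by have := ltn_ceil (B n) K0; rewrite -/c; nia.
have /andP[cB1 cB2] := cB.
have b0 : 0 < b by rewrite ltr0n; lia.
have bc : b <= 2 * K%:R * c%:R by rewrite -!natrM ler_nat; lia.
have bc2 : c%:R <= b by rewrite ler_nat.
have /andP[s1 s2] : (1 - e1) * b <= n%:R * T1 (B n) <= (1 + e1) * b.
  by rewrite /b; near: n; exact: hs.
have sl : (1 - e1) * T1 c <= T1 (B n).
  have : forall j, (c <= j <= (2 * K) * c)%N -> (1 - e1) * T1 c <= T1 j.
    rewrite /c; near: n.
    apply: (@near_Bdiv _ (fun c => forall j, (c <= j <= (2 * K) * c)%N -> (1 - e1) * T1 c <= T1 j)) => //.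
  exact.
have Tc : T1 (B n) <= T1 c by apply: T1_le.
have lc : ell c <= e2 * T1 c by rewrite /c; near: n; apply: (@near_Bdiv _ (fun c => ell c <= e2 * T1 c)) => //; exact: hl.
have sc : \sum_(0 <= j < c) ell j <= 9 * (c%:R * ell c).
  rewrite /c; near: n.
  apply: (@near_Bdiv _ (fun c => \sum_(0 <= j < c) ell j <= 9 * (c%:R * ell c))) => //.
  exact: sum_ell_le.
have kc : 1 <= c%:R * ell c by rewrite /c; near: n; apply: (@near_Bdiv _ (fun c => 1 <= c%:R * ell c)) => //; apply: kell_large.
have tc : c%:R * T0 c <= 16 * ell c by rewrite /c; near: n; apply: (@near_Bdiv _ (fun c => c%:R * T0 c <= 16 * ell c)) => //; apply: T0_le_ell.
have n0 : 0 <= n%:R :> R by [].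
have u1 : (1 - e1) * (n%:R * T1 c) <= (1 + e1) * b.
  by apply: le_trans s2; rewrite mulrCA ler_wpM2l.
have u2 : n%:R * T1 c <= 2 * b.
  have : 0 <= n%:R * T1 c by rewrite mulr_ge0 // T1_ge0.
  nra.
have l1 : (1 - e1) * b <= n%:R * T1 c by apply: (le_trans s1); rewrite ler_wpM2l.
have nl : n%:R * ell c <= e2 * (2 * b).
  apply: (@le_trans _ _ (n%:R * (e2 * T1 c))); first by rewrite ler_wpM2l.
  by rewrite mulrCA ler_wpM2l // ltW.
split=> //.
- rewrite ler_norml; apply/andP; split; nra.
- rewrite /trvar; have : n%:R * (1 + \sum_(0 <= y < c) ell y) <= n%:R * (10 * (c%:R * ell c)).
    by rewrite ler_wpM2l //; lra.
  move/le_trans; apply.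
  have : 10 * c%:R * (n%:R * ell c) <= 10 * c%:R * (e2 * (2 * b)).
    by rewrite ler_wpM2l.
  have -> : n%:R * (10 * (c%:R * ell c)) = 10 * c%:R * (n%:R * ell c) by ring.
  move/le_trans; apply.
  have e2e : e2 * 20 <= e.
    by rewrite -e2K ler_wpM2l ?ltW //; lra.
  have : e2 * 20 * (c%:R * b) <= e * (b * b).
    apply: ler_pM => //; first by rewrite mulr_ge0 // ltW.
      by rewrite mulr_ge0 // ltW.
    by rewrite ler_wpM2r // ltW.
  rewrite expr2; lra.
- rewrite -(ler_pM2l cr).
  have : n%:R * (c%:R * T0 c) <= n%:R * (16 * ell c) by rewrite ler_wpM2l.
  have -> : c%:R * (n%:R * T0 c) = n%:R * (c%:R * T0 c) by ring.
  move/le_trans; apply.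
  have : e2 * b <= e2 * (2 * K%:R * c%:R) by rewrite ler_wpM2l // ltW.
  have : e2 * (2 * K%:R * c%:R) * 32 = e * c%:R by rewrite -e2K; ring.
  lra.
Unshelve. all: by end_near. Qed.

Lemma lln (e kappa : R) : 0 < e -> 0 < kappa -> \forall n \near \oo, forall m M, (m <= n)%N ->
  Pr mu M m (fun w => e * (B n)%:R <= walk w + m%:R / n%:R * (B n)%:R) <= kappa /\
  Pr mu M m (fun w => walk w + m%:R / n%:R * (B n)%:R <= - (e * (B n)%:R)) <= kappa.
Proof.
(* The tilt is [A / B n]. This [A] makes the exponent [- A * e / 2 = - 2 / kappa], hence a
   probability at most [kappa / 2]; [K >= 2 * A] makes the tilt admissible for letters below
   [B n %/ K]; [d] absorbs the errors in drift and variance and pays [kappa / 2] for the larger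
   letters. *)
move=> e0 k0; pose A : R := 4 / (e * kappa).
have A0 : 0 < A by rewrite divr_gt0 // mulr_gt0.
pose K := (Num.bound (2 * A)).+1.
have KA : 2 * A <= K%:R.
  apply: le_trans (ltW (archi_boundP _)) _; first by rewrite mulr_ge0 // ltW.
  by rewrite ler_nat.
have Kr : 0 < K%:R :> R by rewrite ltr0n.
pose d := Num.min (e / (2 * (1 + 2 * A))) (kappa / 2).
have d0 : 0 < d.
  by rewrite lt_min !divr_gt0 // mulr_gt0 // addr_gt0 // mulr_gt0.
have d1 : d <= e / (2 * (1 + 2 * A)) by rewrite ge_min lexx.
have d2 : d <= kappa / 2 by rewrite ge_min lexx orbT.
near=> n => m M mn; set b := (B n)%:R; set c := (B n %/ K)%N.
have [c0 h1 h2 h3] : [/\ (0 < c)%N, `|n%:R * T1 c - b| <= d * b,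
      n%:R * trvar c <= d * b ^+ 2 & n%:R * T0 c <= d].
  by rewrite /b /c; near: n; apply: scale_facts.
have b0 : 0 < b.
  by rewrite ltr0n; apply: leq_trans c0 _; rewrite /c leq_div.
have n0 : 0 < n%:R :> R by rewrite ltr0n; near: n; exists 1%N.
have tb : A / b * c%:R <= 2^-1.
  have cK : c%:R * K%:R <= b by rewrite -natrM ler_nat leq_trunc_div.
  rewrite mulrAC ler_pdivrMr //.
  have : 2 * A * c%:R <= K%:R * c%:R by rewrite ler_wpM2r.
  lra.
have t0 : 0 <= A / b by rewrite divr_ge0 // ltW.
have t01 : 0 <= A / b <= 2^-1.
  rewrite t0 /=; apply: le_trans tb; rewrite ler_peMr // ler1n //.
have mT : m%:R * T0 c <= kappa / 2.
  apply: le_trans d2; apply: le_trans h3; rewrite ler_wpM2r ?T0_ge0 // ler_nat //.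
have mV : m%:R * trvar c <= d * b ^+ 2.
  by apply: le_trans h2; rewrite ler_wpM2r ?trvar_ge0 // ler_nat.
set f := m%:R / n%:R.
have f0 : 0 <= f by rewrite divr_ge0.
have f1 : f <= 1 by rewrite ler_pdivrMr // mul1r ler_nat.
have fT : `|m%:R * T1 c - f * b| <= d * b.
  have -> : m%:R * T1 c - f * b = f * (n%:R * T1 c - b).
    by rewrite /f; field; rewrite gt_eqF.
  rewrite normrM (ger0_norm f0); apply: le_trans h1.
  by rewrite ler_piMl.
have V2 : m%:R * (2 * (A / b) ^+ 2 * trvar c) <= 2 * A ^+ 2 * d.
  have -> : m%:R * (2 * (A / b) ^+ 2 * trvar c) = 2 * (A / b) ^+ 2 * (m%:R * trvar c) by ring.
  have : 2 * (A / b) ^+ 2 * (m%:R * trvar c) <= 2 * (A / b) ^+ 2 * (d * b ^+ 2).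
    by rewrite ler_wpM2l // mulr_ge0 ?sqr_ge0.
  move/le_trans; apply; rewrite le_eqVlt; apply/orP; left; apply/eqP; field.
  by rewrite gt_eqF.
have fin : A * d + 2 * A ^+ 2 * d <= A * e / 2.
  have P : 0 < 2 * (1 + 2 * A) by rewrite mulr_gt0 // addr_gt0 // mulr_gt0.
  move: d1; rewrite ler_pdivlMr // => d1.
  have : A * (d * (2 * (1 + 2 * A))) <= A * e by rewrite ler_wpM2l // ltW.
  rewrite expr2; nra.
have expk : expR (- (A * e / 2)) <= kappa / 2.
  have -> : A * e / 2 = 2 / kappa by rewrite /A; field; rewrite !gt_eqF.
  apply: le_trans (expRN_le_inv _) _; first by rewrite divr_gt0.
  by rewrite invf_div.
have [g1 g2] : - (d * b) <= m%:R * T1 c - f * b /\ m%:R * T1 c - f * b <= d * b.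
  by move: fT; rewrite ler_norml => /andP[].
have Ab : A / b * b = A by rewrite divfK // gt_eqF.
split.
- apply: le_trans (Pr_trunc_le _ c _ _) _.
  suff : Pr mu c m (fun w => e * b <= walk w + f * b) <= kappa / 2 by lra.
  apply: le_trans (_ : Pr mu c m (fun w => e * b - f * b <= walk w) <= _).
    by apply: Pr_le => // w _; lra.
  apply: le_trans (chernoff_up m _ t0 tb c0) _; apply: le_trans expk; rewrite ler_expR.
  rewrite [m%:R * (_ + _)]mulrDr.
  have : A / b * (f * b - m%:R * T1 c) <= A / b * (d * b) by rewrite ler_wpM2l //; lra.
  rewrite (_ : A / b * (d * b) = d * (A / b * b)); last by ring.
  rewrite Ab => h.
  have -> : - (A / b) * (e * b - f * b) = - (e * (A / b * b)) + A / b * (f * b) by ring.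
  rewrite Ab.
  have : A / b * (f * b - m%:R * T1 c) = A / b * (f * b) + m%:R * (- (A / b) * T1 c) by ring.
  lra.
- apply: le_trans (Pr_trunc_le _ c _ _) _.
  suff : Pr mu c m (fun w => walk w + f * b <= - (e * b)) <= kappa / 2 by lra.
  apply: le_trans (_ : Pr mu c m (fun w => walk w <= - (e * b + f * b)) <= _).
    by apply: Pr_le => // w _; lra.
  apply: le_trans (chernoff_dn c m _ t01) _; apply: le_trans expk; rewrite ler_expR.
  rewrite [m%:R * (_ + _)]mulrDr.
  have : A / b * (m%:R * T1 c - f * b) <= A / b * (d * b) by rewrite ler_wpM2l //; lra.
  rewrite (_ : A / b * (d * b) = d * (A / b * b)); last by ring.
  rewrite Ab => h.
  have -> : - (A / b) * (e * b + f * b) = - (e * (A / b * b)) - A / b * (f * b) by ring.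
  rewrite Ab.
  have : A / b * (m%:R * T1 c - f * b) = m%:R * (A / b * T1 c) - A / b * (f * b) by ring.
  lra.
Unshelve. all: by end_near. Qed.

End LawOfLargeNumbers.

(** * Words with a marked letter, and uniform deviations of the walk *)

Section LocalEstimates.
Variables (R : realType) (mu : nat -> R).
Hypothesis Hmu : H_mu mu.
Local Notation T0 := (T0 mu).
Local Notation T1 := (T1 mu).
Local Notation ell := (ell mu).
Let mu0 := mu_ge0 Hmu.
Local Notation walk := (@walk R).

Lemma Pr_all_lt M c n A : Pr mu M n (fun w => A w && all (fun y => (y < c)%N) w) <= Pr mu c n A.
Proof.
have [Mc|cM] := leqP M c.
  apply: (@le_trans _ _ (Pr mu M n A)); first by apply: Pr_le => // w _ /andP[].
  by apply: Ex_le_trunc => // w _; rewrite ler0n.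
rewrite /Pr (Ex_trunc _ _ _ (ltnW cM)) //; apply: Ex_le => // w _.
by case: (A w); case: all; rewrite ?mulr1 ?mul1r ?mul0r.
Qed.

Lemma sum_indic_sub M n (u : seq nat) (D : pred nat) :
  \sum_(0 <= d < M | D d) ((d + sumn u)%N == n)%:R <= (D (n - sumn u)%N)%:R :> R.
Proof.
rewrite big_mkcond /= (eq_bigr (fun d => (D d && ((d + sumn u)%N == n))%:R)); last first.
  by move=> d _; case: ifP.
apply: le_trans (sum_indic_uniq _ _) _ => [i j _ _ /andP[_ /eqP h1] /andP[_ /eqP h2]|]; first by lia.
rewrite ler_nat; case: hasP => //= -[d _ /andP[Dd /eqP E]].
by have -> : (n - sumn u)%N = d by [lia]; rewrite Dd.
Qed.

(** The marked letter is rotated to the front, at the cost of the factor [n]; the prescribed sum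
    then forces its value to be [n.-1 - sumn u]. *)
Lemma Pr_has_big M n (D : pred nat) (C : R) : 0 <= C ->
  (forall d, (d < M)%N -> D d -> mu d <= C) ->
  Pr mu M n (fun w => ((sumn w).+1 == n) && has D w) <=
  n%:R * C * Pr mu M n.-1 (fun u => D (n.-1 - sumn u)%N).
Proof.
case: n => [|n] C0 HC.
  by rewrite !mul0r -[leRHS](Ex_zero mu M 0); apply: Ex_le => // w _.
rewrite -pred_Sn.
apply: (@le_trans _ _ (n.+1%:R * \sum_(0 <= d < M | D d) mu d * Pr mu M n (fun u => (d + sumn u)%N == n))).
  apply: le_trans (Pr_big_letter mu0 M n D (fun d u => (d + sumn u)%N == n)).
  apply: Pr_le => // w /andP[/eqP sw _] /andP[/eqP sn /(has_nthP 0%N)[i iw Di]].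
  apply/hasP; exists i; first by rewrite mem_iota /= -sw.
  rewrite /rot (drop_nth 0%N) // cat_cons /= Di /= sumn_cat addnA.
  have := sumn_take_drop i w; rewrite (drop_nth 0%N) //= => E; apply/eqP; lia.
rewrite -mulrA ler_wpM2l //.
apply: (@le_trans _ _ (\sum_(0 <= d < M | D d) C * Pr mu M n (fun u => (d + sumn u)%N == n))).
  rewrite [leLHS]big_nat_cond [leRHS]big_nat_cond; apply: ler_sum => d /andP[/andP[_ dM] Dd].
  by rewrite ler_wpM2r ?Pr_ge0 ?HC.
rewrite -big_distrr /= ler_wpM2l // -Ex_sum //; apply: Ex_le => // u _.
exact: sum_indic_sub.
Qed.

Lemma count1_nth_uniq (P : pred nat) (w : seq nat) i j : count P w = 1%N ->
  (i < size w)%N -> (j < size w)%N -> P (nth 0%N w i) -> P (nth 0%N w j) -> i = j.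
Proof.
wlog ij : i j / (i <= j)%N => [H c hi hj Pi Pj|].
  by case/orP: (leq_total i j) => /H e; [apply: e|apply/esym/e].
move=> c hi hj Pi Pj; apply/eqP; rewrite eqn_leq ij leqNgt; apply/negP => ltij.
move: c; rewrite -(cat_take_drop j w) count_cat (drop_nth 0%N) //= Pj.
have : has P (take j w).
  apply/(has_nthP 0%N); exists i; first by rewrite size_takel // ltnW.
  by rewrite nth_take.
rewrite has_count; lia.
Qed.

(** As all other letters are below [c], the position of the marked one is unique, and the [n] events
    indexed by this position are disjoint. *)
Lemma Pr_one_big_ge M c n (D : pred nat) : (c <= M)%N -> (forall d, D d -> (c <= d)%N) ->
  n%:R * \sum_(0 <= d < M | D d) mu d * Pr mu c n.-1 (fun u => (d + sumn u)%N == n.-1) <=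
  Pr mu M n (fun w => (sumn w).+1 == n).
Proof.
move=> cM Dc; case: n => [|n]; first by rewrite mul0r Pr_ge0.
rewrite -pred_Sn.
pose H (w : seq nat) := if w is d :: u then
  [&& D d, all (fun y => (y < c)%N) u & (d + sumn u)%N == n] else false.
have -> : n.+1%:R * \sum_(0 <= d < M | D d) mu d * Pr mu c n (fun u => (d + sumn u)%N == n) =
  Ex mu M n.+1 (fun w => \sum_(0 <= i < n.+1) (H (rot i w))%:R).
  rewrite Ex_sum //.
  have E i : Ex mu M n.+1 (fun w => (H (rot i w))%:R) =
     \sum_(0 <= d < M | D d) mu d * Pr mu c n (fun u => (d + sumn u)%N == n).
    rewrite -(Ex_rot _ _ _ _ (fun w => (H w)%:R)) //= [RHS]big_mkcond /=.
    apply: eq_bigr => d _; case: ifP => Dd; last by rewrite /= Ex_zero mulr0.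
    rewrite /Pr (Ex_trunc _ _ _ cM) //; congr (_ * _); apply: Ex_ext => // u _ /=.
    by case: all; rewrite ?mul1r ?mul0r.
  by rewrite (eq_bigr _ (fun i _ => E i)) sumr_const_nat subn0 mulr_natl.
apply: Ex_le => // w /andP[/eqP sw _].
have nthE i : (i < n.+1)%N -> rot i w = nth 0%N w i :: drop i.+1 w ++ take i w.
  by move=> iw; rewrite /rot (drop_nth 0%N) ?sw.
have HP i : (i < n.+1)%N -> H (rot i w) ->
    [/\ count (fun y => (c <= y)%N) w = 1%N, (c <= nth 0%N w i)%N & (sumn w).+1 = n.+1].
  move=> iw; have := nthE i iw => E; rewrite E /H => /and3P[Dd au /eqP sn]; split.
  - have -> : forall P, count P w = count P (rot i w).
      by move=> P; rewrite /rot count_cat addnC -count_cat cat_take_drop.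
    rewrite E /= (Dc _ Dd) (_ : count _ _ = 0%N) //.
    apply/eqP; rewrite -leqn0 leqNgt -has_count -all_predC.
    by apply: sub_all au => y /=; rewrite ltnNge.
  - exact: Dc.
  - by rewrite -(sumn_rot i w) E /= sn.
apply: le_trans (sum_indic_uniq _ _) _ => [i j hi hj /(HP _ hi)[c1 n1 _] /(HP _ hj)[_ n2 _]|].
  by apply: (count1_nth_uniq c1); rewrite ?sw.
rewrite ler_nat; have [/hasP[i]|//] := boolP (has _ _).
by rewrite mem_iota add0n => /andP[_ hi] /(HP _ hi)[_ _ ->]; rewrite eqxx.
Qed.

Variable B : nat -> nat.
Hypothesis B_large : forall K : nat, \forall n \near \oo, (K <= B n)%N.
Hypothesis B_scale : forall e : R, 0 < e ->
  \forall n \near \oo, (1 - e) * (B n)%:R <= n%:R * T1 (B n) <= (1 + e) * (B n)%:R.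

(** At some time [j] the walk is at distance at least [e * b] from the line [- j * b / n]. Two
    one-sided crossings are used because [ottaviani] is one-sided. *)
Definition deviates (n : nat) (b e : R) (w : seq nat) : bool :=
  crosses (fun y => y%:R - 1 + b / n%:R) (e * b) w ||
  crosses (fun y => - (y%:R - 1 + b / n%:R)) (e * b) w.

Lemma sum_drift (a : R) w : \sum_(y <- w) (y%:R - 1 + a) = walk w + (size w)%:R * a.
Proof.
elim: w => [|y w IH]; first by rewrite /walk !big_nil mul0r addr0.
by rewrite /walk !big_cons IH /walk /= -natr1; ring.
Qed.

Lemma not_deviates n b e w j : ~~ deviates n b e w -> (j <= size w)%N ->
  `|walk (take j w) + j%:R / n%:R * b| < e * b.
Proof.
move=> /norP[/crossesP h1 /crossesP h2] js; rewrite ltr_norml; apply/andP.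
have sz : size (take j w) = j by rewrite size_takel.
split; rewrite ltNge; apply/negP => h; [apply: h2|apply: h1]; exists j => //.
  by rewrite sumrN sum_drift sz lerNr mulrA mulrAC.
by rewrite sum_drift sz mulrA mulrAC.
Qed.

Lemma walk_sup (e kappa : R) : 0 < e -> 0 < kappa -> \forall n \near \oo, forall m M,
  (m <= n)%N -> (B n <= M)%N -> Pr mu M m (deviates n (B n)%:R e) <= kappa.
Proof.
(* Taking [q = 2^-1] in [ottaviani] doubles the bound on each of the two sides, whence [kappa / 4].
   The cap [4^-1] ensures this [q]: words of length at most [n] with letters below [M] have mass at
   least [1 - 4^-1]. *)
move=> e0 k0; pose k1 := Num.min (kappa / 4) (4^-1).
have k10 : 0 < k1 by rewrite lt_min divr_gt0 //= invr_gt0.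
have k1k : k1 <= kappa / 4 by rewrite ge_min lexx.
have k14 : k1 <= 4^-1 by rewrite ge_min lexx orbT.
have e20 : 0 < e / 2 by rewrite divr_gt0.
have q0 : 0 < 4^-1 :> R by rewrite invr_gt0.
have hl := lln Hmu B_large B_scale e20 k10.
have hsc := scale_facts Hmu B_large B_scale (ltn0Sn 0) q0.
near=> n => m M mn BM; set b := (B n)%:R.
have [B0 _ _ tn] : [/\ (0 < B n %/ 1)%N, `|n%:R * T1 (B n %/ 1) - (B n)%:R| <= 4^-1 * (B n)%:R,
      n%:R * trvar mu (B n %/ 1) <= 4^-1 * (B n)%:R ^+ 2 & n%:R * T0 (B n %/ 1) <= 4^-1].
  by near: n; exact: hsc.
rewrite divn1 in tn B0.
have L : forall m M, (m <= n)%N ->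
  Pr mu M m (fun w => e / 2 * (B n)%:R <= walk w + m%:R / n%:R * (B n)%:R) <= k1 /\
  Pr mu M m (fun w => walk w + m%:R / n%:R * (B n)%:R <= - (e / 2 * (B n)%:R)) <= k1.
  by near: n; exact: hl.
have b0 : 0 < b by rewrite ltr0n.
have mass m' : (m' <= n)%N -> 1 - 4^-1 <= Pr mu M m' xpredT.
  move=> mn'; apply: le_trans (Pr_true_ge Hmu M m'); rewrite lerD2l lerN2.
  apply: le_trans tn; apply: ler_pM; rewrite ?T0_ge0 ?ler_nat //; exact: T0_le.
have half : 0 <= 2^-1 :> R by rewrite invr_ge0.
have dr m' w : word M m' w -> (size w)%:R * (b / n%:R) = m'%:R / n%:R * b.
  by move=> /andP[/eqP -> _]; rewrite mulrA mulrAC.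
have up : Pr mu M m (crosses (fun y => y%:R - 1 + b / n%:R) (e * b)) <= kappa / 2.
  have := @ottaviani _ mu mu0 M (sum_mu_le1 Hmu M) (fun y => y%:R - 1 + b / n%:R) m 2^-1 (e * b) (e / 2 * b) half.
  have H1 m' : (m' <= m)%N -> 2^-1 <= Pr mu M m' (fun w => - (e / 2 * b) <= \sum_(y <- w) (y%:R - 1 + b / n%:R)).
    move=> mm; have mn' : (m' <= n)%N by exact: leq_trans mm mn.
    have [_ L2] := L m' M mn'; have := mass m' mn'.
    have : Pr mu M m' xpredT <= Pr mu M m' (fun w => - (e / 2 * b) <= \sum_(y <- w) (y%:R - 1 + b / n%:R)) +
      Pr mu M m' (fun w => walk w + m'%:R / n%:R * (B n)%:R <= - (e / 2 * (B n)%:R)).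
      apply: Pr_union => // w hw _; rewrite sum_drift (dr _ _ hw) orbC.
      exact: le_total.
    lra.
  move=> /(_ H1) h.
  have : Pr mu M m (fun w => e * b - e / 2 * b <= \sum_(y <- w) (y%:R - 1 + b / n%:R)) <= k1.
    have [L1 _] := L m M mn; apply: le_trans L1; apply: Pr_le => // w hw.
    by rewrite sum_drift (dr _ _ hw); lra.
  lra.
have dn : Pr mu M m (crosses (fun y => - (y%:R - 1 + b / n%:R)) (e * b)) <= kappa / 2.
  have := @ottaviani _ mu mu0 M (sum_mu_le1 Hmu M) (fun y => - (y%:R - 1 + b / n%:R)) m 2^-1 (e * b) (e / 2 * b) half.
  have H1 m' : (m' <= m)%N -> 2^-1 <= Pr mu M m' (fun w => - (e / 2 * b) <= \sum_(y <- w) - (y%:R - 1 + b / n%:R)).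
    move=> mm; have mn' : (m' <= n)%N by exact: leq_trans mm mn.
    have [L2 _] := L m' M mn'; have := mass m' mn'.
    have : Pr mu M m' xpredT <= Pr mu M m' (fun w => - (e / 2 * b) <= \sum_(y <- w) - (y%:R - 1 + b / n%:R)) +
      Pr mu M m' (fun w => e / 2 * (B n)%:R <= walk w + m'%:R / n%:R * (B n)%:R).
      apply: Pr_union => // w hw _; rewrite sumrN sum_drift (dr _ _ hw) lerN2.
      exact: le_total.
    lra.
  move=> /(_ H1) h.
  have : Pr mu M m (fun w => e * b - e / 2 * b <= \sum_(y <- w) - (y%:R - 1 + b / n%:R)) <= k1.
    have [_ L1] := L m M mn; apply: le_trans L1; apply: Pr_le => // w hw.
    by rewrite sumrN sum_drift (dr _ _ hw); lra.
  lra.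
by apply: le_trans (Pr_or mu0 _ _ _ _) _; lra.
Unshelve. all: by end_near. Qed.

End LocalEstimates.

(** * Local estimates for the end point of the walk *)

Section LocalEstimates.
Variables (R : realType) (mu : nat -> R).
Hypothesis Hmu : H_mu mu.
Local Notation T0 := (T0 mu).
Local Notation T1 := (T1 mu).
Local Notation ell := (ell mu).
Let mu0 := mu_ge0 Hmu.
Local Notation walk := (@walk R).

Variable B : nat -> nat.
Hypothesis B_large : forall K : nat, \forall n \near \oo, (K <= B n)%N.
Hypothesis B_scale : forall e : R, 0 < e ->
  \forall n \near \oo, (1 - e) * (B n)%:R <= n%:R * T1 (B n) <= (1 + e) * (B n)%:R.

Lemma mu_window : exists k0, forall b d, (k0 <= b)%N -> (b <= d.*2)%N -> (d <= b.*2)%N ->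
  mu b <= 32 * mu d.
Proof.
have [k1 [_ H1]] := mu_le_const Hmu; have [k2 [k20 H2]] := mu_le_pow3 Hmu.
exists (maxn k1.*2 k2) => b d; rewrite geq_max => /andP[h1 h2] bd db.
have [dlb|bld] := leqP d b.
  have := H1 d b ltac:(lia) dlb; have := mu0 d; lra.
have := H2 b d h2 (ltnW bld).
have b0 : 0 < b%:R :> R by rewrite ltr0n; lia.
have d2 : d%:R <= 2 * b%:R :> R by rewrite -natrM ler_nat; lia.
have : d%:R ^+ 3 <= 8 * b%:R ^+ 3 :> R.
  have -> : 8 * b%:R ^+ 3 = (2 * b%:R) ^+ 3 :> R by ring.
  by rewrite lerXn2r ?nnegrE // mulr_ge0.
have b3 : 0 < b%:R ^+ 3 :> R by rewrite exprn_gt0.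
move=> h h'; rewrite -(ler_pM2r b3); apply: le_trans h' _.
have := mu0 d; nra.
Qed.

(** Only words with one letter between [B n / 2] and [2 * B n] and all others below [B n / 4] are
    kept. By [lln] the others require such a letter with probability at least [2^-1], and its weight
    is at least [mu (B n) / 32]. *)
Lemma local_lower : \forall n \near \oo, forall M, (2 * B n <= M)%N ->
  n%:R * mu (B n) / 64 <= Pr mu M n (fun w => (sumn w).+1 == n).
Proof.
have q0 : 0 < 4^-1 :> R by rewrite invr_gt0.
have q8 : 0 < 8^-1 :> R by rewrite invr_gt0.
have hl := lln Hmu B_large B_scale q0 q8.
have hsc := scale_facts Hmu B_large B_scale (ltn0Sn 3) q0.
have [k0 hmu] := mu_window.
have hk := B_large k0.
near=> n => M BM; set b := (B n)%:R : R; set c := (B n %/ 4)%N.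
have [c0 _ _ tn] : [/\ (0 < c)%N, `|n%:R * T1 c - (B n)%:R| <= 4^-1 * (B n)%:R,
      n%:R * trvar mu c <= 4^-1 * (B n)%:R ^+ 2 & n%:R * T0 c <= 4^-1].
  by rewrite /c; near: n; exact: hsc.
have L : forall m M, (m <= n)%N ->
  Pr mu M m (fun w => 4^-1 * (B n)%:R <= walk w + m%:R / n%:R * (B n)%:R) <= 8^-1 /\
  Pr mu M m (fun w => walk w + m%:R / n%:R * (B n)%:R <= - (4^-1 * (B n)%:R)) <= 8^-1.
  by near: n; exact: hl.
have kB : (k0 <= B n)%N by near: n; exact: hk.
have n4 : (4 <= n)%N by near: n; exists 4.
have cB : (c * 4 <= B n)%N by rewrite leq_trunc_div.
have n0 : (0 < n)%N by apply: leq_trans n4.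
set m := n.-1; have mE : n = m.+1 by rewrite /m prednK.
pose D d := (B n <= d.*2)%N && (d <= (B n).*2.-1)%N.
have b0 : 0 < b by rewrite ltr0n; lia.
have DP : Pr mu c m (fun u => D (m - sumn u)%N && (sumn u <= m)%N) >= 2^-1.
  have [L1 L2] := L m c (leq_pred n).
  have mass : 1 - 4^-1 <= Pr mu c m xpredT.
    apply: le_trans (Pr_true_ge Hmu c m); rewrite lerD2l lerN2.
    by apply: le_trans tn; rewrite ler_wpM2r ?T0_ge0 // ler_nat leq_pred.
  have : Pr mu c m xpredT <= Pr mu c m (fun u => D (m - sumn u)%N && (sumn u <= m)%N) +
      (Pr mu c m (fun w => 4^-1 * b <= walk w + m%:R / n%:R * b) +
       Pr mu c m (fun w => walk w + m%:R / n%:R * b <= - (4^-1 * b))).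
    apply: le_trans (lerD (lexx _) (Pr_or mu0 _ _ _ _)); apply: Pr_union => // w /andP[/eqP sw _] _.
    rewrite orbC; case: (lerP (4^-1 * b) _) => //= h1; case: (lerP _ (- _)) => //= h2.
    rewrite walkE sw in h1 h2.
    have f1 : m%:R / n%:R <= 1 :> R by rewrite ler_pdivrMr ?ltr0n ?mul1r ?ler_nat ?leq_pred.
    have f2 : 3 / 4 <= m%:R / n%:R :> R.
      rewrite ler_pdivlMr ?ltr0n //.
      have -> : n%:R = m%:R + 1 :> R by rewrite mE natr1.
      have : 3 <= m%:R :> R by rewrite ler_nat -ltnS -mE.
      by lra.
    have fb1 : 3 / 4 * b <= m%:R / n%:R * b by rewrite ler_wpM2r // ltW.
    have fb2 : m%:R / n%:R * b <= b by rewrite ler_piMl // ltW.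
    have h3 : (sumn w)%:R + 2^-1 * b < m%:R by lra.
    have h4 : m%:R < (sumn w)%:R + 2 * b by lra.
    have s1 : (sumn w < m)%N by rewrite -(ltr_nat R); lra.
    have s2 : (m < sumn w + 2 * B n)%N by rewrite -(ltr_nat R) natrD natrM.
    have s3 : (2 * sumn w + B n < 2 * m)%N by rewrite -(ltr_nat R) natrD !natrM; rewrite -/b; lra.
    by move: s1 s2 s3; rewrite /D; clear; lia.
  lra.
have cM : (c <= M)%N by lia.
have Dc d : D d -> (c <= d)%N by rewrite /D; move: cB; clear; lia.
apply: le_trans (Pr_one_big_ge Hmu n cM Dc).
have : n%:R * \sum_(0 <= d < M | D d) (mu (B n) / 32) * Pr mu c m (fun u => (d + sumn u)%N == m) <=
  n%:R * \sum_(0 <= d < M | D d) mu d * Pr mu c m (fun u => (d + sumn u)%N == m).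
  rewrite ler_wpM2l //; apply: ler_sum => d Dd; rewrite ler_wpM2r ?Pr_ge0 //.
  have := hmu (B n) d kB ltac:(move: Dd; rewrite /D; lia) ltac:(move: Dd; rewrite /D; lia).
  lra.
move/(le_trans _); apply; rewrite -mulrA ler_wpM2l // -big_distrr /=.
have : 2^-1 <= \sum_(0 <= d < M | D d) Pr mu c m (fun u => (d + sumn u)%N == m).
  apply: (le_trans DP); rewrite -Ex_sum //; apply: Ex_le => // u _.
  case: (boolP (D _ && _)) => [/andP[Du su]|_]; last by apply: sumr_ge0.
  rewrite big_mkcond (bigD1_seq (m - sumn u)%N) ?iota_uniq //=; last first.
    by rewrite mem_index_iota; move: Du; rewrite /D; lia.
  rewrite Du subnK // eqxx lerDl; apply: sumr_ge0 => d _; case: ifP => // _; exact: ler0n.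
have := mu0 (B n); nra.
Unshelve. all: by end_near. Qed.

Lemma trvar_small : exists c0, (0 < c0)%N /\ forall C, (c0 <= C)%N ->
  trvar mu C <= C%:R * T1 C / 4.
Proof.
have e0 : 0 < 40^-1 :> R by rewrite invr_gt0.
have [k1 _ H1] := sum_ell_le Hmu; have [k2 _ H2] := kell_large Hmu 1.
have [k3 _ H3] := ell_small Hmu e0.
exists (maxn 1 (maxn k1 (maxn k2 k3))); split; first by rewrite leq_maxl.
move=> C; rewrite !geq_max => /and4P[C0 c1 c2 c3].
have h1 := H1 C c1; have h2 := H2 C c2; have h3 := H3 C c3; rewrite /= in h1 h2 h3.
rewrite /trvar.
have : C%:R * ell C <= C%:R * (40^-1 * T1 C) by rewrite ler_wpM2l.
lra.
Qed.

(** With letters below [C <= B n] the drift over [m] steps is at least [2 / 3 * B n], by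
    monotonicity of [T1]. The tilt [(2 * C)^-1], whose quadratic term costs at most a quarter of the
    gain by the bound on [trvar], leaves the exponent [2^-1 - B n / (4 * C)]. *)
Lemma Pr_hit (c0 : nat) : (0 < c0)%N ->
  (forall C, (c0 <= C)%N -> trvar mu C <= C%:R * T1 C / 4) ->
  \forall n \near \oo, forall C m (x : R), (c0 <= C)%N -> (C <= B n)%N -> (n <= m.+1)%N -> x <= C%:R ->
  Pr mu C m (fun w => - x <= walk w) <= 2 * (16 * C%:R / (B n)%:R) ^+ 4.
Proof.
move=> c00 Hc0; have e0 : 0 < 10^-1 :> R by rewrite invr_gt0.
have hs := B_scale e0; near=> n => C m x cC CB nm xC; set b := (B n)%:R : R.
have /andP[s1 _] : (1 - 10^-1) * b <= n%:R * T1 (B n) <= (1 + 10^-1) * b.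
  by rewrite /b; near: n; exact: hs.
have n9 : (10 <= n)%N by near: n; exists 10%N.
have C0 : 0 < C%:R :> R by rewrite ltr0n; lia.
have b0 : 0 < b by rewrite ltr0n; lia.
have t0 : 0 <= (2 * C%:R)^-1 :> R by rewrite invr_ge0 mulr_ge0.
have tC : (2 * C%:R)^-1 * C%:R <= 2^-1 :> R by rewrite invfM -mulrA mulVf ?mulr1 // gt_eqF.
apply: le_trans (chernoff_up Hmu m (- x) t0 tC (leq_trans c00 cC)) _.
have mT : 2 / 3 * b <= m%:R * T1 C.
  have : m%:R * T1 (B n) <= m%:R * T1 C by rewrite ler_wpM2l // T1_le.
  have : 9 / 10 * (n%:R * T1 (B n)) <= m%:R * T1 (B n).
    rewrite mulrA ler_wpM2r ?T1_ge0 //.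
    have : n%:R <= m%:R + 1 :> R by rewrite natr1 ler_nat.
    have : 10 <= n%:R :> R by rewrite ler_nat.
    lra.
  lra.
have V : m%:R * (2 * ((2 * C%:R)^-1) ^+ 2 * trvar mu C) <= 8^-1 / C%:R * (m%:R * T1 C).
  have -> : m%:R * (2 * ((2 * C%:R)^-1) ^+ 2 * trvar mu C) =
     2^-1 / C%:R ^+ 2 * (m%:R * trvar mu C) by field; rewrite gt_eqF.
  have -> : 8^-1 / C%:R * (m%:R * T1 C) = 2^-1 / C%:R ^+ 2 * (m%:R * (C%:R * T1 C / 4)).
    by field; rewrite gt_eqF.
  rewrite ler_wpM2l ?divr_ge0 ?exprn_ge0 ?invr_ge0 // ler_wpM2l //; exact: Hc0.
have E : - (2 * C%:R)^-1 * - x + m%:R * (- (2 * C%:R)^-1 * T1 C + 2 * (2 * C%:R)^-1 ^+ 2 * trvar mu C)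
   <= 2^-1 - b / (4 * C%:R).
  rewrite [m%:R * (_ + _)]mulrDr.
  have x1 : (2 * C%:R)^-1 * x <= 2^-1 by apply: le_trans tC; rewrite ler_wpM2l.
  have : (8^-1 - 2^-1) / C%:R * (m%:R * T1 C) <= - (b / (4 * C%:R)).
    have -> : - (b / (4 * C%:R)) = (8^-1 - 2^-1) / C%:R * (2 / 3 * b) by field; rewrite gt_eqF.
    rewrite ler_wnM2l //; rewrite mulr_le0_ge0 ?invr_ge0 //; lra.
  have : m%:R * (- (2 * C%:R)^-1 * T1 C) = - 2^-1 / C%:R * (m%:R * T1 C) by field; rewrite gt_eqF.
  lra.
apply: (@le_trans _ _ (expR (2^-1 - b / (4 * C%:R)))); first by rewrite ler_expR.
rewrite expRD; apply: ler_pM; rewrite ?expR_ge0 //.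
  by apply: le_trans (@expR_le_quad R 2^-1 (lexx _)) _; lra.
apply: le_trans (expRN_le_inv4 _) _; first by rewrite divr_gt0 // mulr_gt0.
rewrite le_eqVlt; apply/orP; left; apply/eqP; field; by rewrite !gt_eqF.
Unshelve. all: by end_near. Qed.

(** The extra words contain a letter of size between [C] and [2 * C], of weight at most
    [4 * (b / C)^3 * mu b]; the other letters must end above [- 2 * C], which costs a fourth power
    of [C / b]. One factor [C / b] survives. *)
Lemma local_double k1 (H3 : forall d b, (k1 <= d)%N -> (d <= b)%N ->
    mu d * d%:R ^+ 3 <= 4 * b%:R ^+ 3 * mu b) n b C :
  (k1 <= C)%N -> (0 < C)%N -> (2 * C <= b)%N ->
  Pr mu (2 * C) n.-1 (fun w => - (2 * C)%:R <= walk w) <= 2 * (16 * (2 * C)%:R / b%:R) ^+ 4 ->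
  Pr mu (2 * C) n (fun w => (sumn w).+1 == n) <=
  Pr mu C n (fun w => (sumn w).+1 == n) + n%:R * mu b * (8 * 32 ^+ 4 * C%:R / b%:R).
Proof.
move=> kC C0' CB hit.
have C0 : 0 < C%:R :> R by rewrite ltr0n.
have b0 : 0 < b%:R :> R by rewrite ltr0n; lia.
pose D d := (C <= d < 2 * C)%N.
pose Cs := 4 * (b%:R / C%:R) ^+ 3 * mu b.
have Cs0 : 0 <= Cs by rewrite !mulr_ge0 ?exprn_ge0 ?divr_ge0.
have HCs d : (d < 2 * C)%N -> D d -> mu d <= Cs.
  move=> dC /andP[Cd _]; have := H3 d b (leq_trans kC Cd) (leq_trans (ltnW dC) CB).
  have Cd' : C%:R <= d%:R :> R by rewrite ler_nat.
  have d0 : 0 < d%:R :> R by apply: lt_le_trans Cd'.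
  rewrite -ler_pdivlMr ?exprn_gt0 // => h; apply: le_trans h _; rewrite /Cs.
  have -> : 4 * b%:R ^+ 3 * mu b / d%:R ^+ 3 = 4 * (b%:R ^+ 3 * mu b) * d%:R ^- 3 by ring.
  have -> : 4 * (b%:R / C%:R) ^+ 3 * mu b = 4 * (b%:R ^+ 3 * mu b) * C%:R ^- 3.
    by field; rewrite gt_eqF.
  rewrite ler_wpM2l ?mulr_ge0 ?exprn_ge0 //.
  by rewrite lef_pV2 ?posrE ?exprn_gt0 // lerXn2r ?nnegrE // ltW.
have h3 := @Pr_has_big _ mu Hmu (2 * C) n D Cs Cs0 HCs.
have h2 : Pr mu (2 * C) n (fun w => (sumn w).+1 == n) <= Pr mu C n (fun w => (sumn w).+1 == n) +
    Pr mu (2 * C) n (fun w => ((sumn w).+1 == n) && has D w).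
  apply: (@le_trans _ _ (Pr mu (2 * C) n (fun w => ((sumn w).+1 == n) && all (fun y => (y < C)%N) w) +
     Pr mu (2 * C) n (fun w => ((sumn w).+1 == n) && has D w))).
    apply: Pr_union => // w /andP[_ aw] -> /=.
    case: (boolP (all _ w)) => //= /allPn[d dw]; rewrite -leqNgt => Cd.
    apply/hasP; exists d => //; rewrite /D Cd /=; exact: (allP aw).
  by rewrite lerD2r; exact: Pr_all_lt.
have h1 : Pr mu (2 * C) n.-1 (fun u => D (n.-1 - sumn u)%N) <= 2 * (16 * (2 * C)%:R / b%:R) ^+ 4.
  apply: le_trans hit; apply: Pr_le => // u /andP[/eqP su _] /andP[_ h].
  rewrite walkE su lerNl opprB lerBlDr -natrD ler_nat; lia.
apply: (le_trans h2); rewrite lerD2l; apply: le_trans h3 _.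
apply: le_trans (ler_wpM2l _ h1) _; first by rewrite mulr_ge0.
rewrite /Cs natrM le_eqVlt; apply/orP; left; apply/eqP; field.
by rewrite !gt_eqF.
Qed.

(** At the fixed level [c0] the probability is of order at most [(B n)^-4], while [n * mu (B n)] is
    at least [(B n)^-2] by [kell_large] and [B n <= n]. Doubling the level up to [B n %/ K] adds a
    geometric sum, dominated by its last term, of relative size at most [C2 / K]. *)
Lemma local_small (kappa : R) : 0 < kappa -> exists K, (0 < K)%N /\ \forall n \near \oo,
  exists c, [/\ (0 < c)%N, (B n <= 2 * K * c)%N &
    Pr mu c n (fun w => (sumn w).+1 == n) <= kappa * (n%:R * mu (B n))].
Proof.
move=> k0; have [c1 [c10 Hc1]] := trvar_small.
have [k1 [k10 H3]] := mu_le_pow3 Hmu.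
pose c0 := maxn c1 k1; have c00 : (0 < c0)%N by rewrite leq_max c10.
have Hc0 C : (c0 <= C)%N -> trvar mu C <= C%:R * T1 C / 4.
  by rewrite geq_max => /andP[h _]; exact: Hc1.
have Hk1 : (k1 <= c0)%N by rewrite leq_maxr.
clearbody c0.
have hit := Pr_hit c00 Hc0.
pose C2 : R := 8 * 32 ^+ 4.
have C2E : C2 = 8 * 32 ^+ 4 by [].
have C20 : 0 < C2 by rewrite mulr_gt0 // exprn_gt0.
pose K := (Num.bound (2 * C2 / kappa)).+1.
have KC : 2 * C2 / kappa <= K%:R.
  apply: le_trans (ltW (archi_boundP _)) _; last by rewrite ler_nat.
  by rewrite divr_ge0 ?mulr_ge0 // ltW.
have K0 : (0 < K)%N by [].
have Kr : 0 < K%:R :> R by rewrite ltr0n.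
clearbody K C2; exists K; split=> //.
have hB := near_B B_large (kell_large Hmu 1).
have hB1 := B_large (c0 * K).
have hB2 := near_B B_large (nbhs_infty_ger (4 * (16 * c0%:R) ^+ 4 / kappa : R)).
have hBn := B_le_n Hmu B_large B_scale 1.
near=> n.
have Ht : forall C m (x : R), (c0 <= C)%N -> (C <= B n)%N -> (n <= m.+1)%N -> x <= C%:R ->
  Pr mu C m (fun w => - x <= walk w) <= 2 * (16 * C%:R / (B n)%:R) ^+ 4 by near: n; exact: hit.
have bl : 1 <= (B n)%:R * ell (B n) by near: n; exact: hB.
have bK : (c0 * K <= B n)%N by near: n; exact: hB1.
have b4 : 4 * (16 * c0%:R) ^+ 4 / kappa <= (B n)%:R by near: n; exact: hB2.
have bn : (1 * B n <= n)%N by near: n; exact: hBn.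
rewrite mul1n in bn; set b := (B n)%:R : R in Ht bl b4 *.
have n1 : (0 < n)%N by near: n; exists 1%N.
have c0B : (c0 <= B n)%N by apply: leq_trans bK; rewrite leq_pmulr.
have b1 : 1 <= b by rewrite ler1n; lia.
have b0 : 0 < b by lra.
pose F C := Pr mu C n (fun w => (sumn w).+1 == n).
have F0 : F c0 <= kappa / 2 * (n%:R * mu (B n)).
  apply: (@le_trans _ _ (Pr mu c0 n (fun w => - 1 <= walk w))).
    apply: Pr_le => // w /andP[/eqP sw _] /eqP E; rewrite walkE sw -E -natr1.
    by rewrite opprD addrA subrr sub0r.
  apply: le_trans (Ht c0 n 1 _ _ _ _) _; rewrite ?ler1n //.
  have : b * mu (B n) <= n%:R * mu (B n) by rewrite ler_wpM2r // ler_nat.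
  have : b ^-2 <= b * mu (B n).
    rewrite -[b^-2]mul1r ler_pdivrMr ?exprn_gt0 //; apply: (le_trans bl).
    by rewrite le_eqVlt; apply/orP; left; apply/eqP; rewrite /ell -/b; ring.
  move=> h1 h2; apply: (@le_trans _ _ (kappa / 2 * b^-2)); last first.
    by rewrite ler_wpM2l ?(le_trans h1) // divr_ge0 // ltW.
  rewrite -(ler_pM2r (_ : 0 < b ^+ 4)) ?exprn_gt0 //.
  have -> : 2 * (16 * c0%:R / b) ^+ 4 * b ^+ 4 = 2 * (16 * c0%:R) ^+ 4 by field; rewrite gt_eqF.
  have -> : kappa / 2 * b ^- 2 * b ^+ 4 = kappa / 2 * (b * b) by field; rewrite gt_eqF.
  rewrite ler_pdivrMr // in b4.
  have : kappa * b <= kappa * (b * b) by rewrite ler_wpM2l ?(ltW k0) // ler_peMl // ltW.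
  lra.
have FS C : (c0 <= C)%N -> (2 * C <= B n)%N -> F (2 * C)%N <= F C + n%:R * mu (B n) * (C2 * C%:R / b).
  move=> cC CB; rewrite C2E; apply: (local_double H3 (leq_trans Hk1 cC) (leq_trans c00 cC) CB) => //.
  have g : (n <= n.-1.+1)%N by rewrite prednK.
  apply: Ht => //; apply: (leq_trans cC); rewrite leq_pmull //.
have Fj j : (2 ^ j * c0 <= B n)%N -> F (2 ^ j * c0)%N <=
   kappa / 2 * (n%:R * mu (B n)) + n%:R * mu (B n) * (C2 * (2 ^ j * c0)%:R / b).
  have nm : 0 <= n%:R * mu (B n) by rewrite mulr_ge0.
  elim: j => [|j IH] hj.
    rewrite expn0 mul1n; apply: ler_wpDr => //.
    by rewrite mulr_ge0 // divr_ge0 ?mulr_ge0 // ltW.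
  have hj' : (2 * (2 ^ j * c0) <= B n)%N by rewrite mulnA -expnS.
  rewrite expnS -mulnA; apply: le_trans (FS _ _ hj') _.
    by rewrite leq_pmull // expn_gt0.
  have := IH (leq_trans (leq_pmull _ (isT : (0 < 2)%N)) hj'); rewrite [X in _ -> _ <= _ + _ * (_ * X / _)]natrM => {}IH.
  have -> : C2 * (2 * (2 ^ j * c0)%:R) / b = C2 * (2 ^ j * c0)%:R / b + C2 * (2 ^ j * c0)%:R / b by ring.
  rewrite mulrDr; lra.
pose j := trunc_log 2 (B n %/ K %/ c0).
have BK : (c0 <= B n %/ K)%N by rewrite leq_divRL.
have q0 : (0 < B n %/ K %/ c0)%N by rewrite divn_gt0.
have i1 : (2 ^ j * c0 <= B n %/ K)%N by rewrite -leq_divRL // trunc_logP.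
have i2 : (B n %/ K < 2 ^ j.+1 * c0)%N by rewrite -ltn_divLR // trunc_log_ltn.
have i3 : (2 ^ j * c0 * K <= B n)%N by rewrite -leq_divRL.
exists (2 ^ j * c0)%N; split.
- by rewrite muln_gt0 expn_gt0.
- apply: leq_trans (ltnW (ltn_ceil (B n) K0)) _.
  have -> : (2 * K * (2 ^ j * c0) = 2 ^ j.+1 * c0 * K)%N by rewrite expnS; ring.
  by rewrite leq_mul2r i2 orbT.
- apply: le_trans (Fj j _) _; first by apply: leq_trans i1 _; rewrite leq_div.
  have : C2 * (2 ^ j * c0)%:R / b <= kappa / 2.
    rewrite ler_pdivrMr //; move: KC; rewrite ler_pdivrMr // => KC.
    have : (2 ^ j * c0)%:R * K%:R <= b by rewrite -natrM ler_nat.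
    have : 0 <= (2 ^ j * c0)%:R :> R by [].
    move: (2 ^ j * c0)%:R => y y0 yK.
    have : 2 * C2 * y <= K%:R * kappa * y by rewrite ler_wpM2r.
    have : kappa * (y * K%:R) <= kappa * b by rewrite ler_wpM2l // ltW.
    lra.
  have nm : 0 <= n%:R * mu (B n) by rewrite mulr_ge0.
  move=> h; have := ler_wpM2l nm h; lra.
Unshelve. all: by end_near. Qed.

(** Either all letters are below the level [c] of [local_small], or some letter [d >= c] is far from
    [B n]. In the second case [mu d] is at most a constant times [mu (B n)], and the other letters
    must deviate from their drift, which [lln] makes unlikely. *)
Lemma local_upper (e kappa : R) : 0 < e -> 0 < kappa -> \forall n \near \oo, forall M,
  Pr mu M n (fun w => ((sumn w).+1 == n) && all (fun d => e * (B n)%:R < `|d%:R - (B n)%:R|) w)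
  <= kappa * (n%:R * mu (B n)).
Proof.
move=> e0 k0; have k20 : 0 < kappa / 2 by rewrite divr_gt0.
have [K [K0 HK]] := local_small k20.
have Kr : 0 < K%:R :> R by rewrite ltr0n.
have [k1 [k10 H1]] := mu_le_const Hmu; have [k2 [k20' H2]] := mu_le_pow3 Hmu.
pose C : R := 4 * (2 * K%:R) ^+ 3.
have CE : C = 4 * (2 * K%:R) ^+ 3 by [].
have C4 : 4 <= C.
  rewrite /C ler_peMr // exprn_ege1 //.
  have : 1 <= K%:R :> R by rewrite ler1n.
  lra.
pose k3 := kappa / (4 * C).
have k30 : 0 < k3 by rewrite divr_gt0 // mulr_gt0 //; lra.
have k3C : C * k3 = kappa / 4 by rewrite /k3; field; rewrite gt_eqF //; lra.
have e20 : 0 < e / 2 by rewrite divr_gt0.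
have hl := lln Hmu B_large B_scale e20 k30.
have hb := B_large (maxn k1 (k2 * (2 * K))).
have hn := nbhs_infty_ger (2 / e : R).
clearbody k3 C.
near=> n => M.
have [c [c0 Bc Fc]] : exists c, [/\ (0 < c)%N, (B n <= 2 * K * c)%N &
    Pr mu c n (fun w => (sumn w).+1 == n) <= kappa / 2 * (n%:R * mu (B n))] by near: n; exact: HK.
have L : forall m M, (m <= n)%N ->
  Pr mu M m (fun w => e / 2 * (B n)%:R <= walk w + m%:R / n%:R * (B n)%:R) <= k3 /\
  Pr mu M m (fun w => walk w + m%:R / n%:R * (B n)%:R <= - (e / 2 * (B n)%:R)) <= k3.
  by near: n; exact: hl.
have bk : (maxn k1 (k2 * (2 * K)) <= B n)%N by near: n; exact: hb.
have ne : 2 / e <= n%:R by near: n; exact: hn.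
have n1 : (0 < n)%N by near: n; exists 1%N.
move: bk; rewrite geq_max => /andP[bk1 bk2].
set b := (B n)%:R : R.
have B0 : (0 < B n)%N by apply: leq_trans bk2; rewrite !muln_gt0 k20' K0.
have b0 : 0 < b by rewrite ltr0n.
pose D d := (c <= d)%N && (e * b < `|d%:R - b|).
pose Cs := C * mu (B n).
have Cs0 : 0 <= Cs by rewrite mulr_ge0 //; lra.
have HCs d : (d < M)%N -> D d -> mu d <= Cs.
  move=> _ /andP[cd _]; have [Bd|dB] := leqP (B n) d.
    apply: le_trans (H1 _ _ bk1 Bd) _; rewrite ler_wpM2r //.
  have kd : (k2 <= d)%N.
    have : (k2 * (2 * K) <= d * (2 * K))%N.
      by rewrite (leq_trans bk2) // (leq_trans Bc) // mulnC leq_mul2r cd orbT.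
    by rewrite leq_pmul2r // muln_gt0.
  have := H2 d (B n) kd (ltnW dB).
  have d0 : 0 < d%:R :> R by rewrite ltr0n (leq_trans c0).
  have bd : b <= 2 * K%:R * d%:R.
    by rewrite -!natrM ler_nat (leq_trans Bc) // leq_mul2l cd orbT.
  have b3 : b ^+ 3 <= (2 * K%:R * d%:R) ^+ 3.
    by rewrite lerXn2r ?nnegrE ?mulr_ge0 // ltW.
  have d3 : 0 < d%:R ^+ 3 :> R by rewrite exprn_gt0.
  rewrite -ler_pdivlMr // => h; apply: le_trans h _; rewrite ler_pdivrMr // /Cs -/b.
  have : b ^+ 3 * mu (B n) <= (2 * K%:R * d%:R) ^+ 3 * mu (B n) by rewrite ler_wpM2r.
  have -> : (2 * K%:R * d%:R) ^+ 3 = (2 * K%:R) ^+ 3 * d%:R ^+ 3 :> R by ring.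
  rewrite CE; lra.
have h1 := @Pr_has_big _ mu Hmu M n D Cs Cs0 HCs.
have h2 : Pr mu M n (fun w => ((sumn w).+1 == n) && all (fun d => e * b < `|d%:R - b|) w) <=
  Pr mu c n (fun w => (sumn w).+1 == n) + Pr mu M n (fun w => ((sumn w).+1 == n) && has D w).
  apply: (@le_trans _ _ (Pr mu M n (fun w => ((sumn w).+1 == n) && all (fun y => (y < c)%N) w) +
    Pr mu M n (fun w => ((sumn w).+1 == n) && has D w))).
    apply: Pr_union => // w _ /andP[-> aw] /=.
    case: (boolP (all _ w)) => //= /allPn[d dw]; rewrite -leqNgt => Cd.
    by apply/hasP; exists d => //; rewrite /D Cd (allP aw).
  by rewrite lerD2r; exact: Pr_all_lt.
have h3 : Pr mu M n.-1 (fun u => D (n.-1 - sumn u)%N) <= k3 + k3.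
  have [L1 L2] := L n.-1 M (leq_pred n).
  apply: le_trans (lerD L1 L2); apply: Pr_union => // u /andP[/eqP su _] /andP[cd].
  rewrite -/b walkE su.
  have -> : (n.-1 - sumn u)%:R = n.-1%:R - (sumn u)%:R :> R.
    by rewrite natrB //; move: cd c0; clear; lia.
  have nr : 0 < n%:R :> R by rewrite ltr0n.
  have n1E : n.-1%:R = n%:R - 1 :> R by rewrite -[in RHS](prednK n1) -natr1 addrK.
  have fE : n.-1%:R / n%:R * b = b - b / n%:R by rewrite n1E; field; rewrite gt_eqF.
  have bn : b / n%:R <= e / 2 * b.
    rewrite ler_pdivrMr //; move: ne; rewrite ler_pdivrMr // => ne.
    have : b * 2 <= b * (n%:R * e) by rewrite ler_wpM2l // ltW.
    lra.
  rewrite fE ltr_normr => h.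
  case: (lerP (e / 2 * b) _) => //= g1; rewrite leNgt; apply/negP => g2.
  have eb : 0 < e * b by rewrite mulr_gt0.
  have bn0 : 0 <= b / n%:R by rewrite divr_ge0 // ltW.
  by case/orP: h; lra.
apply: (le_trans h2).
have : n%:R * Cs * Pr mu M n.-1 (fun u => D (n.-1 - sumn u)%N) <= n%:R * Cs * (k3 + k3).
  by rewrite ler_wpM2l // mulr_ge0.
have -> : n%:R * Cs * (k3 + k3) = kappa / 2 * (n%:R * mu (B n)).
  rewrite /Cs (_ : n%:R * (C * mu (B n)) * (k3 + k3) = 2 * (C * k3) * (n%:R * mu (B n))); last by ring.
  by rewrite k3C; field.
lra.
Unshelve. all: by end_near. Qed.

End LocalEstimates.

(** * Survival probabilities of the unconditioned tree *)

Section Survival.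
Variables (R : realType) (mu : nat -> R).
Hypothesis Hmu : H_mu mu.
Local Notation T0 := (T0 mu).
Local Notation T1 := (T1 mu).
Local Notation ell := (ell mu).
Local Notation tl := (tailE mu).
Let mu0 := mu_ge0 Hmu.

Definition pgf (s : R) : R := limn (fun N => \sum_(0 <= y < N) mu y * s ^+ y).

Lemma pgf_bounds s M : 0 <= s <= 1 ->
  \sum_(0 <= y < M) mu y * s ^+ y <= pgf s <= \sum_(0 <= y < M) mu y * s ^+ y + T0 M.
Proof.
move=> /andP[s0 s1]; pose u N := \sum_(0 <= y < N) mu y * s ^+ y.
have nd : nondecreasing_seq u.
  apply/nondecreasing_seqP => N; rewrite /u big_nat_recr //= lerDl.
  by rewrite mulr_ge0 // exprn_ge0.
have ub N : u N <= u M + T0 M.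
  have [NM|MN] := leqP N M.
    by apply: (le_trans (nd _ _ NM)); rewrite lerDl T0_ge0.
  rewrite /u (big_cat_nat (leq0n M) (ltnW MN)) //= lerD2l.
  apply: (@le_trans _ _ (\sum_(M <= y < N) mu y)).
    by apply: ler_sum => y _; rewrite ler_piMr // exprn_ile1.
  by rewrite (T0_cat mu (ltnW MN)) lerDl T0_ge0.
have cu : cvgn u.
  by apply: nondecreasing_is_cvgn => //; exists (u M + T0 M) => _ [N _ <-].
apply/andP; split; first exact: nondecreasing_cvgn_le.
by apply: limr_le => //; near=> N; exact: ub.
Unshelve. all: by end_near. Qed.

Lemma pgf01 s : 0 <= s <= 1 -> 0 <= pgf s <= 1.
Proof.
move=> hs; have := pgf_bounds 0 hs; rewrite big_geq // T0_0 add0r.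
by [].
Qed.

Definition phi (q : R) : R := pgf (1 - q) - (1 - q).

Lemma bernoulli_le (q : R) y : 0 <= q <= 1 -> 1 - q * y%:R <= (1 - q) ^+ y.
Proof.
move=> /andP[q0 q1]; elim: y => [|y IH]; first by rewrite mulr0 subr0 expr0.
rewrite exprS -natr1; have y0 : 0 <= y%:R :> R by [].
have : (1 - q) * (1 - q * y%:R) <= (1 - q) * (1 - q) ^+ y by rewrite ler_wpM2l // subr_ge0.
have : 0 <= q * q * y%:R by rewrite !mulr_ge0.
lra.
Qed.

Lemma bernoulli_ge (q : R) y : 0 <= q <= 1 ->
  (1 - q) ^+ y <= 1 - q * y%:R + q ^+ 2 * y%:R ^+ 2.
Proof.
move=> /andP[q0 q1]; elim: y => [|y IH].
  by rewrite expr0; lra.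
rewrite exprS -natr1; have y0 : 0 <= y%:R :> R by [].
apply: le_trans (ler_wpM2l _ IH) _; first by rewrite subr_ge0.
have : 0 <= q * q * y%:R by rewrite !mulr_ge0.
have : 0 <= q * q * q * (y%:R * y%:R) by rewrite !mulr_ge0.
have : 0 <= q * q by rewrite mulr_ge0.
rewrite !expr2; lra.
Qed.

Lemma bernoulli_sq (q : R) y : 0 <= q <= 1 -> (2 <= y)%N -> 1 - q * y%:R + q ^+ 2 <= (1 - q) ^+ y.
Proof.
move=> q01; have /andP[q0 q1] := q01; elim: y => // y IH; rewrite leq_eqVlt => /orP[/eqP <-|hy].
  by rewrite le_eqVlt; apply/orP; left; apply/eqP; ring.
have := IH hy; rewrite [(1 - q) ^+ y.+1]exprS -natr1 !expr2 => {}IH.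
have : (1 - q) * (1 - q) ^+ y = (1 - q) ^+ y - q * (1 - q) ^+ y by ring.
have : q * (1 - q) ^+ y <= q * 1.
  by rewrite ler_wpM2l // exprn_ile1 ?subr_ge0 // lerBlDr lerDl.
lra.
Qed.

(** Letters below [m] are expanded to first and second order; the others contribute at most [T0 m].
    The level [m] is free and will be [1 / q] rounded up. *)
Lemma phi_bounds q m : 0 <= q <= 1 ->
  q * T1 m - T0 m <= phi q <= q * T1 m + q ^+ 2 * \sum_(0 <= y < m) ell y.
Proof.
move=> q01; have /andP[q0 q1] := q01.
have q01' : 0 <= 1 - q <= 1 by rewrite subr_ge0 q1 lerBlDr lerDl.
have /andP[h1 h2] := pgf_bounds m q01'.
have E : \sum_(0 <= y < m) mu y * (1 - q * y%:R) = (1 - T0 m) - q * (1 - T1 m).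
  rewrite (eq_bigr (fun y => mu y - q * (y%:R * mu y))); last by move=> y _; ring.
  by rewrite sumrB -big_distrr /= /T0 /T1; ring.
have l : \sum_(0 <= y < m) mu y * (1 - q * y%:R) <= \sum_(0 <= y < m) mu y * (1 - q) ^+ y.
  by apply: ler_sum => y _; rewrite ler_wpM2l // bernoulli_le.
have u : \sum_(0 <= y < m) mu y * (1 - q) ^+ y <=
    \sum_(0 <= y < m) mu y * (1 - q * y%:R) + q ^+ 2 * \sum_(0 <= y < m) ell y.
  rewrite big_distrr /= -big_split /=; apply: ler_sum => y _.
  apply: le_trans (ler_wpM2l (mu0 y) (bernoulli_ge y q01)) _.
  by rewrite le_eqVlt; apply/orP; left; apply/eqP; rewrite /ell; ring.
rewrite E in l u; rewrite /phi; apply/andP; split; lra.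
Qed.

(** A crude bound, but valid on the whole interval: it shows that [Q] decreases to zero before the
    asymptotics of [phi] become available. *)
Lemma phi_ge_sq : exists2 k : R, 0 < k & forall q, 0 <= q <= 1 -> k * q ^+ 2 <= phi q.
Proof.
have [y [y2 my]] : exists y, (2 <= y)%N /\ 0 < mu y.
  have [N _ HN] := mu_pos_near Hmu; exists (maxn N 2).
  by split; [rewrite leq_maxr|apply: HN; rewrite /= leq_maxl].
exists (mu y) => // q q01; have /andP[q0 q1] := q01.
have q01' : 0 <= 1 - q <= 1 by rewrite subr_ge0 q1 lerBlDr lerDl.
apply/ler_addgt0Pr => e e0.
have [N _ HN] := cvgr_lt _ (T0_cvg Hmu) _ e0.
pose m := maxn N y.+1.
have Tm : T0 m < e by apply: HN; rewrite /= leq_maxl.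
have ym : (y < m)%N by rewrite leq_maxr.
have /andP[h1 _] := pgf_bounds m q01'.
have E : \sum_(0 <= i < m) mu i * (1 - q * i%:R) = (1 - T0 m) - q * (1 - T1 m).
  rewrite (eq_bigr (fun y => mu y - q * (y%:R * mu y))); last by move=> i _; ring.
  by rewrite sumrB -big_distrr /= /T0 /T1; ring.
have l : \sum_(0 <= i < m) mu i * (1 - q * i%:R) + mu y * q ^+ 2 <= \sum_(0 <= i < m) mu i * (1 - q) ^+ i.
  rewrite (bigD1_seq y) ?iota_uniq ?mem_index_iota //= [leRHS](bigD1_seq y) ?iota_uniq ?mem_index_iota //=.
  have : \sum_(0 <= i < m | i != y) mu i * (1 - q * i%:R) <= \sum_(0 <= i < m | i != y) mu i * (1 - q) ^+ i.
    by apply: ler_sum => i _; rewrite ler_wpM2l // bernoulli_le.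
  have : mu y * (1 - q * y%:R + q ^+ 2) <= mu y * (1 - q) ^+ y by rewrite ler_wpM2l // bernoulli_sq.
  lra.
rewrite E in l; rewrite /phi; have := T1_ge0 Hmu m => t1.
have : 0 <= q * T1 m by rewrite mulr_ge0.
lra.
Qed.

Lemma phi_lt q : 0 < q <= 1 -> phi q < q.
Proof.
move=> /andP[q0 q1]; rewrite /phi.
have q01' : 0 <= 1 - q <= 1 by rewrite subr_ge0 q1 lerBlDr lerDl ltW.
have [y [y1 my]] : exists y, (0 < y)%N /\ 0 < mu y.
  have [N _ HN] := mu_pos_near Hmu; exists (maxn N 1).
  by split; [rewrite leq_maxr|apply: HN; rewrite /= leq_maxl].
have /andP[_ h2] := pgf_bounds y.+1 q01'.
suff : pgf (1 - q) < 1 by lra.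
apply: le_lt_trans h2 _; rewrite big_nat_recr //=.
have : \sum_(0 <= i < y) mu i * (1 - q) ^+ i <= \sum_(0 <= i < y) mu i.
  by apply: ler_sum => i _; rewrite ler_piMr // exprn_ile1 //; case/andP: q01'.
have : mu y * (1 - q) ^+ y < mu y.
  by rewrite gtr_pMr // exprn_ilt1 // -?lt0n //; lra.
rewrite sum_mu (T0S mu y); lra.
Qed.

Fixpoint Q (h : nat) : R := if h is h'.+1 then 1 - pgf (1 - Q h') else 1.

Lemma Q01 h : 0 <= Q h <= 1.
Proof.
elim: h => [|h /andP[IH0 IH1]] /=; first by rewrite ler01 lexx.
have /pgf01/andP[p0 p1] : 0 <= 1 - Q h <= 1 by rewrite subr_ge0 lerBlDr lerDl IH0 IH1.
by rewrite subr_ge0 lerBlDr lerDl p0 p1.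
Qed.

Lemma Q01C h : 0 <= 1 - Q h <= 1.
Proof. by have /andP[h0 h1] := Q01 h; rewrite subr_ge0 h1 lerBlDr lerDl. Qed.

Lemma QS h : Q h.+1 = Q h - phi (Q h).
Proof. by rewrite /= /phi; ring. Qed.

Lemma QS_le M h : \sum_(0 <= y < M) mu y * (1 - Q h) ^+ y <= 1 - Q h.+1.
Proof.
rewrite /= subKr; by case/andP: (pgf_bounds M (Q01C h)).
Qed.

Lemma QS_ge M h : 1 - Q h.+1 <=
  \sum_(0 <= y < M) mu y * (1 - Q h) ^+ y + (1 - \sum_(0 <= y < M) mu y).
Proof.
rewrite /= subKr; by case/andP: (pgf_bounds M (Q01C h)).
Qed.

Lemma Q_gt0 h : 0 < Q h.
Proof.
elim: h => [|h IH]; first exact: ltr01.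
rewrite QS subr_gt0 phi_lt // IH /=; by case/andP: (Q01 h).
Qed.

Lemma phi_ge0 q : 0 <= q <= 1 -> 0 <= phi q.
Proof.
move=> q01; have [k k0 hk] := phi_ge_sq; apply: le_trans (hk q q01).
by rewrite mulr_ge0 ?sqr_ge0 // ltW.
Qed.

Lemma Q_le h h' : (h <= h')%N -> Q h' <= Q h.
Proof.
elim: h' => [|h' IH]; first by rewrite leqn0 => /eqP ->.
rewrite leq_eqVlt => /orP[/eqP -> //|]; rewrite ltnS => /IH; apply: le_trans.
by rewrite QS lerBlDr lerDl phi_ge0 // Q01.
Qed.

Lemma Q_small (q : R) : 0 < q -> exists h, Q h < q.
Proof.
move=> q0; have [k k0 hk] := phi_ge_sq; apply: contrapT => /forallNP H.
have {}H h : q <= Q h by rewrite leNgt; apply/negP/H.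
have dec h : Q h <= 1 - h%:R * (k * q ^+ 2).
  elim: h => [|h IH]; first by rewrite mul0r subr0.
  rewrite QS -natr1 mulrDl mul1r.
  have : k * q ^+ 2 <= phi (Q h).
    apply: le_trans (hk _ (Q01 h)); rewrite ler_pM2l // lerXn2r ?nnegrE ?(ltW q0) //.
    by rewrite ltW // Q_gt0.
  lra.
pose h := Num.bound (1 / (k * q ^+ 2)).
have P : 0 < k * q ^+ 2 by rewrite mulr_gt0 // exprn_gt0.
have : 1 / (k * q ^+ 2) < h%:R by apply: archi_boundP; rewrite divr_ge0 // ltW.
rewrite ltr_pdivrMr // => h1.
have := dec h; have := Q_gt0 h; lra.
Qed.

Lemma tailE_slow (A : nat) (e : R) : 0 < e -> exists2 x0 : R, 0 < x0 &
  forall x y, x0 <= x -> x <= y -> y <= A%:R * x -> (1 - e) * tl x <= tl y.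
Proof.
move=> e0; have [N _ HN] := T1_slow Hmu A e0.
exists N.+1%:R => // x y Nx xy yA.
have [m xm] := nat_ceil x; have [k yk] := nat_ceil y.
rewrite (tailE_T1 Hmu xm) (tailE_T1 Hmu yk).
apply: HN => /=.
  by rewrite -(ler_nat R); apply: le_trans (ltW (_ : N%:R < N.+1%:R)) _;
     rewrite ?ltr_nat // (le_trans Nx) // xm.
rewrite -xm -yk; apply/andP; split.
  by apply: (le_trans xy); rewrite yk.
by apply: (le_trans yA); rewrite natrM ler_wpM2l // xm.
Qed.

Lemma tailE_gt0 x : 0 < tl x.
Proof. by have [m xm] := nat_ceil x; rewrite (tailE_T1 Hmu xm) T1_gt0. Qed.

Lemma tailE_small (e : R) : 0 < e -> exists2 x0 : R, 0 < x0 & forall x, x0 <= x -> tl x <= e.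
Proof.
move=> e0; have [N _ HN] := cvgr_lt _ (T1_cvg Hmu) _ e0.
exists N.+1%:R => // x Nx; apply: le_trans (tailE_le Hmu Nx) _.
by rewrite tailE_nat //; apply/ltW/HN; rewrite /= leqnSn.
Qed.

(** With [m] the ceiling of [1 / q], so that [q * m] lies between 1 and 2, both errors in
    [phi_bounds] are of order [q * ell m], negligible against [q * T1 m]. *)
Lemma phi_asym (e : R) : 0 < e -> exists2 x0 : R, 1 <= x0 &
  forall q, 0 < q -> x0 <= q^-1 -> (1 - e) * (q * tl q^-1) <= phi q <= (1 + e) * (q * tl q^-1).
Proof.
move=> e0; have e32 : 0 < e / 32 by rewrite divr_gt0.
have [N1 _ H1] := ell_small Hmu e32; have [N2 _ H2] := sum_ell_le Hmu.
have [N3 _ H3] := T0_le_ell Hmu.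
pose N := (maxn N1 (maxn N2 N3)).+1.
exists N%:R; first by rewrite ler1n.
move=> q q0 Nq; have [m xm] := nat_ceil q^-1.
rewrite (tailE_T1 Hmu xm).
have Nm : (N <= m)%N by rewrite -(ler_nat R) (le_trans Nq) // xm.
have m0 : (0 < m)%N by apply: leq_trans Nm.
have q1 : q <= 1 by rewrite -invf_ge1 // (le_trans _ Nq) // ler1n.
have q01 : 0 <= q <= 1 by rewrite ltW.
have mr : 0 < m%:R :> R by rewrite ltr0n.
have qm : 1 <= q * m%:R by rewrite -ler_pdivrMl // mulr1 xm.
have qm2 : q * m%:R <= 2.
  have : m.-1%:R < q^-1 by rewrite ltNge xm -ltnNge prednK.
  rewrite -(ltr_pM2l q0) mulfV ?gt_eqF // => h.
  have -> : m%:R = m.-1%:R + 1 :> R by rewrite natr1 prednK.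
  lra.
have N1m : (N1 <= m)%N by move: Nm; rewrite /N; clear; lia.
have N2m : (N2 <= m)%N by move: Nm; rewrite /N; clear; lia.
have N3m : (N3 <= m)%N by move: Nm; rewrite /N; clear; lia.
have h1 := H1 m N1m; have h2 := H2 m N2m; have h3 := H3 m N3m; rewrite /= in h1 h2 h3.
have /andP[b1 b2] := phi_bounds m q01.
have t1 := T1_ge0 Hmu m.
apply/andP; split.
  have : T0 m <= e * (q * T1 m).
    rewrite -(ler_pM2l mr); apply: (le_trans h3).
    have : e / 2 * T1 m * 1 <= e / 2 * T1 m * (q * m%:R).
      by rewrite ler_wpM2l // mulr_ge0 // divr_ge0 // ltW.
    have : 0 <= e * (q * m%:R) * T1 m by rewrite !mulr_ge0 // ltW.
    lra.
  lra.
have : q ^+ 2 * \sum_(0 <= y < m) ell y <= e * (q * T1 m).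
  apply: le_trans (ler_wpM2l _ h2) _; first by rewrite sqr_ge0.
  have -> : q ^+ 2 * (9 * (m%:R * ell m)) = 9 * q * (q * m%:R) * ell m by ring.
  have : 9 * q * (q * m%:R) * ell m <= 9 * q * 2 * (e / 32 * T1 m).
    have q9 : 0 <= 9 * q by rewrite mulr_ge0 // ltW.
    apply: ler_pM => //; last by rewrite ler_wpM2l.
      by rewrite mulr_ge0 // mulr_ge0 // ltW.
    exact: ell_ge0.
  have : 0 <= e * q * T1 m by rewrite !mulr_ge0 // ltW.
  lra.
lra.
Qed.

End Survival.

(** * The integral [Gr] and its relation to the survival probabilities *)

Section HeightScale.
Variables (R : realType) (mu : nat -> R).
Hypothesis Hmu : H_mu mu.
Local Notation tl := (tailE mu).
Local Notation Q := (Q mu).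
Local Notation phi := (phi mu).
Let tl0 := tailE_gt0 Hmu.

Definition Gr (y : R) : R :=
  fine (\int[lebesgue_measure]_(x in `[1%R, y]) ((x * tl x)^-1)%:E)%E.

Let f (u : R) : \bar R := ((u * tl u)^-1)%:E.

Let f_measurable (D : set R) : measurable D -> D `<=` `[1, +oo[%classic -> measurable_fun D f.
Proof.
move=> mD D1; apply/measurable_EFinP.
(* The maximum with 1 makes the first factor monotone on the whole line without changing it on
   [D]. *)
apply: (@eq_measurable_fun _ _ _ _ _ (fun u : R => (Num.max u 1)^-1 * (tl u)^-1)).
  move=> u; rewrite inE => /D1 /=; rewrite in_itv /= andbT => u1.
  by rewrite (max_idPl u1) invfM.
apply: measurable_funM.
  apply: nonincreasing_measurable => // u v uv.
  rewrite lef_pV2 ?posrE ?lt_max ?ltr01 ?orbT //.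
  by rewrite ge_max !le_max uv lexx orbT.
apply: nondecreasing_measurable => // u v uv.
by rewrite lef_pV2 ?posrE //; exact: tailE_le.
Qed.

Let f_ge0 (u : R) : 1 <= u -> (0 <= f u)%E.
Proof. by move=> u1; rewrite lee_fin invr_ge0 mulr_ge0 // ?(ltW (tl0 _)) //; lra. Qed.

Let f_int_le x y (i : interval R) : [set` i] `<=` `[x, y]%classic -> 1 <= x -> x <= y ->
  lebesgue_measure ([set` i] : set R) = (y - x)%:E ->
  (((y - x) / (y * tl x))%:E <= \int[lebesgue_measure]_(u in [set` i]) f u)%E /\
  (\int[lebesgue_measure]_(u in [set` i]) f u <= ((y - x) / (x * tl y))%:E)%E.
Proof.
move=> ixy x1 xy li.
have x0 : 0 < x by lra.
have y0 : 0 < y by lra.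
have mi : measurable ([set` i] : set R) by [].
have iP u : [set` i] u -> x <= u <= y by move/ixy; rewrite /= in_itv.
have mf : measurable_fun [set` i] f.
  apply: f_measurable => // u /iP /andP[xu _]; rewrite /= in_itv /= andbT; lra.
have i0 u : [set` i] u -> (0 <= f u)%E by move=> /iP/andP[xu _]; apply: f_ge0; lra.
split.
  have -> : ((y - x) / (y * tl x))%:E = (\int[lebesgue_measure]_(u in [set` i]) cst ((y * tl x)^-1)%:E u)%E.
    rewrite (@integral_cst _ _ R lebesgue_measure [set` i] mi) EFinM muleC; congr (_ * _)%E; exact/esym/li.
  apply: ge0_le_integral => //.
    by move=> u _; rewrite lee_fin invr_ge0 mulr_ge0 // ltW.
  move=> u /iP/andP[xu uy]; rewrite lee_fin lef_pV2 ?posrE ?mulr_gt0 //; last by lra.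
  apply: ler_pM => //; rewrite ?(ltW (tl0 _)) //; first by lra.
  by apply: tailE_le.
have -> : ((y - x) / (x * tl y))%:E = (\int[lebesgue_measure]_(u in [set` i]) cst ((x * tl y)^-1)%:E u)%E.
  rewrite (@integral_cst _ _ R lebesgue_measure [set` i] mi) EFinM muleC; congr (_ * _)%E; exact/esym/li.
apply: ge0_le_integral => //.
move=> u /iP/andP[xu uy]; rewrite lee_fin lef_pV2 ?posrE ?mulr_gt0 //; last by lra.
apply: ler_pM => //; rewrite ?(ltW (tl0 _)) //; first by lra.
by apply: tailE_le.
Qed.

Lemma Gr_diff x y : 1 <= x -> x <= y ->
  (y - x) / (y * tl x) <= Gr y - Gr x <= (y - x) / (x * tl y).
Proof.
move=> x1 xy.
have mI (a b : R) : a <= b -> lebesgue_measure (`[a, b]%classic : set R) = (b - a)%:E.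
  rewrite lebesgue_measure_itv /= lte_fin le_eqVlt => /orP[/eqP ->|->].
    by rewrite ltxx subrr.
  by rewrite EFinB.
have mJ : lebesgue_measure (`]x, y]%classic : set R) = (y - x)%:E.
  rewrite lebesgue_measure_itv /= lte_fin; move: xy; rewrite le_eqVlt => /orP[/eqP ->|->].
    by rewrite ltxx subrr.
  by rewrite EFinB.
have [_ b1] := @f_int_le 1 x `[1, x] (@subset_refl _ _) (lexx _) x1 (mI _ _ x1).
have sJ : (`]x, y]%classic : set R) `<=` `[x, y]%classic.
  by move=> u /=; rewrite !in_itv /= => /andP[h ->]; rewrite ltW.
have [b2 b3] := @f_int_le x y `]x, y] sJ x1 xy mJ.
have E : (\int[lebesgue_measure]_(u in `[1%R, y]) f u =
   \int[lebesgue_measure]_(u in `[1%R, x]) f u + \int[lebesgue_measure]_(u in `]x, y]) f u)%E.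
  have -> : (`[1, y]%classic : set R) = `[1, x]%classic `|` `]x, y]%classic.
    by apply: itv_bndbnd_setU; rewrite bnd_simp.
  apply: ge0_integral_setU => //.
  - apply: f_measurable; first exact: measurableU.
    move=> u [] /=; rewrite !in_itv /= andbT => /andP[h _]; lra.
  - move=> u [] /=; rewrite !in_itv /= => /andP[h _]; apply: f_ge0; lra.
  - apply/disj_setPS => u [] /=; rewrite !in_itv /= => /andP[_ h1] /andP[h2 _]; lra.
have g0 (i : interval R) : (forall u, [set` i] u -> 1 <= u) -> (0 <= \int[lebesgue_measure]_(u in [set` i]) f u)%E.
  by move=> H; apply: integral_ge0 => u /H; exact: f_ge0.
have f1 : (\int[lebesgue_measure]_(u in `[1%R, x]) f u)%E \is a fin_num.
  rewrite ge0_fin_numE ?(le_lt_trans b1) ?ltry //; apply: g0 => u /=.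
  by rewrite in_itv /= => /andP[].
have f2 : (\int[lebesgue_measure]_(u in `]x, y]) f u)%E \is a fin_num.
  rewrite ge0_fin_numE ?(le_lt_trans b3) ?ltry //; apply: g0 => u /=.
  by rewrite in_itv /= => /andP[h _]; lra.
have -> : Gr y - Gr x = fine (\int[lebesgue_measure]_(u in `]x, y]) f u)%E.
  by rewrite /Gr -/f E fineD // addrAC subrr add0r.
by rewrite -!lee_fin fineK // b2 b3.
Qed.

Lemma Gr_1 : Gr 1 = 0.
Proof.
rewrite /Gr (_ : (\int[_]_(_ in _) _)%E = 0%E) //.
apply/eqP; rewrite eq_le; apply/andP; split; last first.
  by apply: integral_ge0 => u /=; rewrite in_itv /= => /andP[u1 _]; exact: f_ge0.
have m1 : lebesgue_measure (`[1, 1]%classic : set R) = (1 - 1)%:E.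
  by rewrite lebesgue_measure_itv /= lte_fin ltxx subrr.
by have [_] := @f_int_le 1 1 `[1, 1] (@subset_refl _ _) (lexx _) (lexx _) m1; rewrite subrr mul0r.
Qed.

Lemma Gr_le x y : 1 <= x -> x <= y -> Gr x <= Gr y.
Proof.
move=> x1 xy; have /andP[h _] := Gr_diff x1 xy; rewrite -subr_ge0; apply: le_trans h.
by rewrite divr_ge0 ?subr_ge0 // mulr_ge0 ?(ltW (tl0 _)) //; lra.
Qed.

Lemma Gr_ge0 x : 1 <= x -> 0 <= Gr x.
Proof. by move=> x1; rewrite -Gr_1 Gr_le. Qed.

(* Each of the last [m] dyadic blocks below [b] contributes at least
   [(2 l(b))^-1], up to the slow variation of the tail [l]. *)
Lemma Gr_large (C : R) : exists2 b0 : R, 1 <= b0 & forall b, b0 <= b -> C <= Gr b * tl b.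
Proof.
have [m hm] : exists m, 4 * `|C| <= m%:R.
  by exists (Num.bound (4 * `|C|)); apply/ltW/archi_boundP; rewrite mulr_ge0.
have h2 : 0 < 2^-1 :> R by rewrite invr_gt0.
have [x0 x00 Hx0] := tailE_slow Hmu (2 ^ m) h2.
have [M ME] : exists M : R, M = 2 ^+ m by exists (2 ^+ m).
have M1 : 1 <= M by rewrite ME exprn_ege1 // ler1n.
exists (M * (1 + x0)); first by rewrite mulr_ege1 //; lra.
move=> b hb.
have part j y : 1 <= y -> j%:R / (2 * tl y) <= Gr (2 ^+ j * y).
  move=> y1; elim: j => [|j IH]; first by rewrite mul0r expr0 mul1r Gr_ge0.
  have P : 1 <= 2 ^+ j :> R by rewrite exprn_ege1 // ler1n.
  have Py : y <= 2 ^+ j * y by rewrite ler_peMl //; lra.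
  have Py0 : 0 < 2 ^+ j * y by lra.
  rewrite exprS -mulrA; have Pz := Py; move: (2 ^+ j * y) IH Py Py0 {P Pz} => z IH Py Py0.
  have /andP[h _] := @Gr_diff z (2 * z) ltac:(lra) ltac:(lra).
  have : (2 * tl y)^-1 <= (2 * z - z) / (2 * z * tl z).
    have -> : (2 * z - z) / (2 * z * tl z) = (2 * tl z)^-1 by field; rewrite !gt_eqF.
    by rewrite lef_pV2 ?posrE ?mulr_gt0 // ler_pM2l // tailE_le.
  move=> h'; rewrite -[j.+1%:R]natr1 mulrDl mul1r.
  by apply: le_trans (lerD IH (le_trans h' h)) _; rewrite addrC subrK.
pose y := b / M.
have M0 : 0 < M by exact: lt_le_trans M1.
have y1 : 1 + x0 <= y by rewrite ler_pdivlMr // mulrC.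
have bE : b = M * y by rewrite /y mulrC divfK // gt_eqF.
clearbody y.
have := part m y ltac:(lra); rewrite -ME -bE.
have : (1 - 2^-1) * tl y <= tl b.
  apply: Hx0; [lra| |by rewrite bE natrX ME].
  by rewrite bE ler_peMl //; lra.
rewrite ler_pdivrMr ?mulr_gt0 // => h1 h3.
have := ler_norm C => hC.
have G0 : 0 <= Gr b by apply: Gr_ge0; rewrite bE mulr_ege1 //; lra.
have : Gr b * ((1 - 2^-1) * tl y) <= Gr b * tl b by rewrite ler_wpM2l.
lra.
Qed.

Lemma tailE_le1 x : tl x <= 1.
Proof. by have [m xm] := nat_ceil x; rewrite (tailE_T1 Hmu xm) T1_le1. Qed.

Lemma Gr_unbounded (C : R) : exists2 b0 : R, 1 <= b0 & forall b, b0 <= b -> C <= Gr b.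
Proof.
have [b0 b1 H] := Gr_large C; exists b0 => // b hb; apply: le_trans (H b hb) _.
by rewrite ler_piMr ?tailE_le1 // Gr_ge0 // (le_trans b1).
Qed.

(** The increment from [b] to [A * b] is at most of order [A / tl b], and [Gr_large] makes this
    negligible against [Gr b]. *)
Lemma Gr_slow (A : nat) (e : R) : (0 < A)%N -> 0 < e -> exists2 b0 : R, 1 <= b0 &
  forall b, b0 <= b -> Gr (A%:R * b) <= (1 + e) * Gr b.
Proof.
move=> A0 e0; have A1 : 1 <= A%:R :> R by rewrite ler1n.
have h2 : 0 < 2^-1 :> R by rewrite invr_gt0.
have [x0 x00 Hx0] := tailE_slow Hmu A h2.
have [b0 b01 Hb0] := Gr_large (2 * A%:R / e).
exists (b0 + x0); first by lra.
move=> b hb; have b1 : 1 <= b by lra.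
have bA : b <= A%:R * b by rewrite ler_peMl //; lra.
have /andP[_ h] := Gr_diff b1 bA.
have t1 : (1 - 2^-1) * tl b <= tl (A%:R * b) by apply: Hx0 => //; lra.
have := Hb0 b ltac:(lra); rewrite ler_pdivrMr // => h3.
have t0 := tl0 b; have tA0 := tl0 (A%:R * b).
suff : (A%:R * b - b) / (b * tl (A%:R * b)) <= e * Gr b by lra.
rewrite ler_pdivrMr ?mulr_gt0 //; last by lra.
have G0 : 0 <= e * Gr b by rewrite mulr_ge0 ?(ltW e0) // Gr_ge0.
have : e * Gr b * ((1 - 2^-1) * tl b) <= e * Gr b * tl (A%:R * b) by rewrite ler_wpM2l.
have -> : e * Gr b * (b * tl (A%:R * b)) = b * (e * Gr b * tl (A%:R * b)) by ring.
move=> h4; have : b * A%:R <= b * (e * Gr b * tl (A%:R * b)).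
  by rewrite ler_wpM2l //; lra.
lra.
Qed.

Definition xQ h := (Q h)^-1.

Lemma xQ_ge1 h : 1 <= xQ h.
Proof. by rewrite /xQ invf_ge1 ?Q_gt0 //; case/andP: (Q01 Hmu h). Qed.

Lemma xQ_le h h' : (h <= h')%N -> xQ h <= xQ h'.
Proof. by move=> hh; rewrite /xQ lef_pV2 ?posrE ?Q_gt0 // Q_le. Qed.

(** One generation moves [x = 1 / Q h] by about [x * tl x], the inverse of the integrand of [Gr]: in
    the scale [Gr] the motion has asymptotic speed one. *)
Lemma Gr_step (e : R) : 0 < e -> exists h0, forall h, (h0 <= h)%N ->
  1 - e <= Gr (xQ h.+1) - Gr (xQ h) <= 1 + e.
Proof.
(* These bounds give [1 + d <= (1 + e) * (1 - d)^2]; the two factors [1 - d] come from replacing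
   [Q h.+1] by [Q h] and the tail at [xQ h.+1] by the one at [xQ h]. *)
move=> e0; have [d [d0 de d4]] : exists d : R, [/\ 0 < d, d <= e / 8 & d <= 4^-1].
  by exists (Num.min (e / 8) 4^-1); rewrite lt_min divr_gt0 //= invr_gt0 // !ge_min !lexx orbT.
have [x1 x11 H1] := phi_asym Hmu d0.
have [x2 x20 H2] := tailE_slow Hmu 2 d0.
have d20 : 0 < d / 2 by rewrite divr_gt0.
have [x3 x30 H3] := tailE_small Hmu d20.
have X0 : 0 < x1 + x2 + x3 by lra.
have [h0 hh0] := @Q_small _ _ Hmu (x1 + x2 + x3)^-1 ltac:(by rewrite invr_gt0).
exists h0 => h hh.
have q0 := Q_gt0 Hmu h; have q0' := Q_gt0 Hmu h.+1.
have xh : x1 + x2 + x3 <= xQ h.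
  rewrite /xQ -[leLHS]invrK lef_pV2 ?posrE ?invr_gt0 //.
  by apply: le_trans (ltW hh0); apply: Q_le.
have xh1 := xQ_ge1 h; have xx : xQ h <= xQ h.+1 by apply: xQ_le.
have /andP[p1 p2] := H1 (Q h) q0 ltac:(rewrite -/(xQ h); lra).
have /andP[g1 g2] := Gr_diff xh1 xx.
have t3 : tl (xQ h) <= d / 2 by apply: (H3 _); lra.
have t0 := tl0 (xQ h); have t0' := tl0 (xQ h.+1).
rewrite -/(xQ h) in p1 p2.
have QSE := QS mu h.
have L : (xQ h.+1 - xQ h) / (xQ h.+1 * tl (xQ h)) = phi (Q h) / (Q h * tl (xQ h)).
  move: t0; rewrite /xQ; move: (tl _) => t t0; rewrite (_ : phi (Q h) = Q h - Q h.+1); last by lra.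
  by field; rewrite !gt_eqF.
have U : (xQ h.+1 - xQ h) / (xQ h * tl (xQ h.+1)) = phi (Q h) / (Q h.+1 * tl (xQ h.+1)).
  move: t0'; rewrite /xQ; move: (tl _) => t t0'; rewrite (_ : phi (Q h) = Q h - Q h.+1); last by lra.
  by field; rewrite !gt_eqF.
rewrite L in g1; rewrite U in g2; apply/andP; split.
  apply: le_trans g1; rewrite ler_pdivlMr ?mulr_gt0 //; apply: le_trans p1.
  by rewrite ler_wpM2r ?mulr_ge0 ?ltW //; lra.
apply: (le_trans g2); rewrite ler_pdivrMr ?mulr_gt0 //; apply: (le_trans p2).
have qt : Q h * tl (xQ h) <= Q h * (d / 2) by rewrite ler_wpM2l // ltW.
have ph : phi (Q h) <= d * Q h.
  apply: (le_trans p2); apply: le_trans (ler_wpM2l _ qt) _; first by lra.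
  have : d * (d * Q h) <= 1 * (d * Q h) by rewrite ler_wpM2r ?mulr_ge0 ?ltW //; lra.
  lra.
have qq : (1 - d) * Q h <= Q h.+1 by lra.
have y2 : xQ h.+1 <= 2%:R * xQ h.
  rewrite /xQ -[leRHS]invrK invfM invrK lef_pV2 ?posrE ?mulr_gt0 ?invr_gt0 //.
  have : (1 - 4^-1) * Q h <= (1 - d) * Q h by rewrite (ler_wpM2r (ltW q0)) //; lra.
  lra.
have tt : (1 - d) * tl (xQ h) <= tl (xQ h.+1) by apply: H2 => //; lra.
have prod : ((1 - d) * Q h) * ((1 - d) * tl (xQ h)) <= Q h.+1 * tl (xQ h.+1).
  by apply: ler_pM => //; rewrite mulr_ge0 ?ltW //; lra.
have e1 : 0 <= 1 + e by lra.
apply: le_trans (ler_wpM2l e1 prod).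
have -> : (1 + e) * ((1 - d) * Q h * ((1 - d) * tl (xQ h))) =
   ((1 + e) * (1 - d) ^+ 2) * (Q h * tl (xQ h)) by ring.
rewrite (ler_wpM2r (mulr_ge0 (ltW q0) (ltW t0))) //.
have : (1 + 8 * d) * (1 - d) ^+ 2 <= (1 + e) * (1 - d) ^+ 2.
  by rewrite ler_wpM2r ?sqr_ge0 //; lra.
have : 0 <= d * (5 - 15 * d + 8 * d ^+ 2).
  by rewrite mulr_ge0 ?ltW //; have := sqr_ge0 d; lra.
rewrite !expr2; lra.
Qed.

Lemma Gr_xQ_bounds (e : R) : 0 < e -> exists h0, forall h, (h0 <= h)%N ->
  (1 - e) * (h%:R - h0%:R) <= Gr (xQ h) <= Gr (xQ h0) + (1 + e) * (h%:R - h0%:R).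
Proof.
move=> e0; have [h0 H] := Gr_step e0; exists h0 => h hh.
rewrite -(subnKC hh); elim: (h - h0)%N => [|k /andP[I1 I2]].
  by rewrite addn0 subrr !mulr0 addr0 lexx Gr_ge0 // xQ_ge1.
have /andP[s1 s2] := H (h0 + k)%N (leq_addr _ _).
rewrite addnS -natr1; apply/andP; split; lra.
Qed.

(** Otherwise [xQ h < A * b], and [Gr_slow] gives [Gr (xQ h) <= (1 + d) * Gr b], whereas [Gr (xQ h)]
    is almost [h]. The factor [A] is thus arbitrary, which is how [Q] passes sharply from large to
    small compared with [1 / b]. *)
Lemma Q_upper (e : R) (A : nat) : (0 < A)%N -> 0 < e -> exists2 b0 : R, 1 <= b0 &
  forall b h, b0 <= b -> (1 + e) * Gr b <= h%:R -> A%:R * b * Q h <= 1.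
Proof.
(* With this [d], [(1 - d) * (1 + e) - (1 + d) = e / 2], a margin that absorbs the constant [h0]. *)
move=> A0 e0; pose d := e / (2 * (2 + e)).
have P : 0 < 2 * (2 + e) by lra.
have d0 : 0 < d by rewrite divr_gt0.
have dE : d * (2 * (2 + e)) = e by rewrite divfK // gt_eqF.
clearbody d.
have d1 : d <= 1 by nra.
have [h0 H] := Gr_xQ_bounds d0.
have [b1 b11 H1] := Gr_slow A0 d0.
have [b2 b21 H2] := Gr_unbounded (2 * h0%:R / e + h0%:R + 1).
exists (b1 + b2); first by lra.
move=> b h hb hh; rewrite leNgt; apply/negP => abs.
have q0 := Q_gt0 Hmu h; have A1 : 1 <= A%:R :> R by rewrite ler1n.
have xlt : xQ h <= A%:R * b by rewrite /xQ -[leLHS]mul1r ler_pdivrMr // ltW.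
have g1 := H1 b ltac:(lra); have g2 := H2 b ltac:(lra).
have g3 := Gr_le (xQ_ge1 h) xlt.
have h00 : 0 <= h0%:R :> R by [].
have r0 : 0 <= 2 * h0%:R / e by rewrite divr_ge0 ?mulr_ge0 // ltW.
have hG : Gr b <= h%:R by apply: le_trans hh; rewrite ler_peMl //; lra.
have hh0 : (h0 <= h)%N by rewrite -(ler_nat R); lra.
have /andP[g4 _] := H h hh0.
have g5 : 2 * h0%:R < e * Gr b.
  have : 2 * h0%:R / e < Gr b by lra.
  by rewrite ltr_pdivrMr // [Gr b * e]mulrC.
have : (1 - d) * ((1 + e) * Gr b) <= (1 - d) * h%:R by rewrite ler_wpM2l //; lra.
have : d * (2 * (2 + e)) * Gr b = e * Gr b by rewrite dE.
have : 0 <= d * h0%:R by rewrite mulr_ge0 // ltW.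
lra.
Qed.

Lemma Q_lower (e : R) (A : nat) : (0 < A)%N -> 0 < e < 1 -> exists2 b0 : R, 1 <= b0 &
  forall b h, b0 <= b -> h%:R <= (1 - e) * Gr b -> A%:R <= b * Q h.
Proof.
move=> A0 /andP[e0 e1]; pose d := e / 6; have d0 : 0 < d by rewrite divr_gt0.
have dE : 6 * d = e by rewrite /d; field.
clearbody d.
have [h0 H] := Gr_xQ_bounds d0.
have [b1 b11 H1] := Gr_slow A0 d0.
pose C0 := Gr (xQ h0); have C00 : 0 <= C0 by apply/Gr_ge0/xQ_ge1.
have [b2 b21 H2] := Gr_unbounded (4 * C0 / e + 1).
have A1 : 1 <= A%:R :> R by rewrite ler1n.
exists (A%:R * b1 + b2); first by have : 0 <= A%:R * b1 by [rewrite mulr_ge0 //; lra]; lra.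
move=> b h hb hh; rewrite leNgt; apply/negP => abs.
have q0 := Q_gt0 Hmu h.
have bA1 : b1 <= b / A%:R.
  by rewrite ler_pdivlMr ?(mulrC b1); lra.
have bA : 1 <= b / A%:R by lra.
have bx : b / A%:R <= xQ h.
  by rewrite /xQ -[leRHS]mul1r ler_pdivlMr // mulrAC ler_pdivrMr ?mul1r ?ltW //; lra.
have g1 := Gr_le bA bx.
have g2 := H1 (b / A%:R) bA1; rewrite mulrC divfK in g2; last by rewrite gt_eqF //; lra.
have g3 : Gr (xQ h) <= C0 + (1 + d) * h%:R.
  have [hh0|hh0] := leqP h0 h.
    have /andP[_ g] := H h hh0; apply: (le_trans g); rewrite lerD2l ler_wpM2l //; first by lra.
    by rewrite lerBlDr lerDl.
  apply: (le_trans (Gr_le (xQ_ge1 h) (xQ_le (ltnW hh0)))).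
  by rewrite lerDl mulr_ge0 //; lra.
have g4 := H2 b ltac:(have : 0 <= A%:R * b1 by [rewrite mulr_ge0 //; lra]; lra).
have g5 : 4 * C0 < e * Gr b.
  have : 4 * C0 / e < Gr b by lra.
  by rewrite ltr_pdivrMr // [Gr b * e]mulrC.
have Gb : 0 <= Gr b by have : 0 <= 4 * C0 / e by [rewrite divr_ge0 ?mulr_ge0 // ltW]; lra.
have g6 : Gr b <= (1 + d) * (C0 + (1 + d) * ((1 - e) * Gr b)).
  apply: (le_trans g2); rewrite ler_wpM2l //; first by lra.
  apply: (le_trans g1); apply: (le_trans g3); rewrite lerD2l ler_wpM2l //; lra.
have g7 : (1 + d) * C0 <= 2 * C0 by rewrite ler_wpM2r //; lra.
have g8 : (1 + d) * ((1 + d) * ((1 - e) * Gr b)) <= (1 - e / 2) * Gr b.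
  rewrite !mulrA ler_wpM2r //.
  have : 0 <= d * (1 - d) by rewrite mulr_ge0 //; lra.
  have : 0 <= d * e by rewrite mulr_ge0 //; lra.
  have : 0 <= d * d * e by rewrite !mulr_ge0 //; lra.
  lra.
lra.
Qed.

End HeightScale.

(** * From the quantile [m n] to the scale [B n] *)

Section Scale.
Variables (R : realType) (mu : nat -> R).
Hypothesis Hmu : H_mu mu.
Local Notation T0 := (T0 mu).
Local Notation T1 := (T1 mu).
Local Notation ell := (ell mu).
Local Notation rt := (rt R).

Lemma nat_above (x : R) : exists k : nat, x <= k%:R.
Proof. by have [k hk] := nat_ceil x; exists k; rewrite hk. Qed.

Lemma T0_gt0 k : 0 < T0 k.
Proof.
have [N _ HN] := mu_pos_near Hmu.
apply: lt_le_trans (T0_le Hmu (leq_maxl k N)); rewrite T0S ltr_wpDr ?(T0_ge0 Hmu) //.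
exact/HN/leq_maxr.
Qed.

Variable m : nat -> nat.
Hypothesis m_lim : (n%:R * T0 (m n)) @[n --> \oo] --> (1 : R).

Lemma m_large (K : nat) : \forall n \near \oo, (K <= m n)%N.
Proof.
have T00 := T0_gt0 K; have h2 := cvgr_lt _ m_lim _ (ltr1n R 2).
near=> n; rewrite leqNgt; apply/negP => mK.
have : n%:R * T0 (m n) < 2 by near: n; exact: h2.
have : n%:R * T0 K <= n%:R * T0 (m n) by rewrite ler_wpM2l // (T0_le Hmu) // ltnW.
have : 2 / T0 K < n%:R by near: n; exact: nbhs_infty_gtr.
rewrite ltr_pdivrMr //; lra.
Unshelve. all: by end_near. Qed.

(** Both bounds follow from [n * T0 (m n)] tending to 1 and [k * T0 k] being of the order of
    [ell k]. *)
Lemma m_ell : \forall n \near \oo,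
  (m n)%:R <= 32 * (n%:R * ell (m n)) /\ n%:R * ell (m n) <= 64 * (m n)%:R.
Proof.
have h2 := cvgr_lt _ m_lim _ (ltr1n R 2).
have h1 : \forall n \near \oo, 2^-1 < n%:R * T0 (m n).
  by apply: (cvgr_gt _ m_lim); rewrite invf_lt1 // ltr1n.
have hl := near_B m_large (T0_le_ell Hmu); have hg := near_B m_large (T0_ge_ell Hmu).
near=> n.
have e1 : 2^-1 < n%:R * T0 (m n) by near: n; exact: h1.
have e2 : n%:R * T0 (m n) < 2 by near: n; exact: h2.
have e3 : (m n)%:R * T0 (m n) <= 16 * ell (m n) by near: n; exact: hl.
have e4 : ell (m n) <= 32 * ((m n)%:R * T0 (m n)) by near: n; exact: hg.
have n0 : 0 <= n%:R :> R by [].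
have m0 : 0 <= (m n)%:R :> R by [].
have f3 := ler_wpM2l n0 e3; have f4 := ler_wpM2l n0 e4.
have f1 := ler_wpM2l m0 (ltW e1); have f2 := ler_wpM2l m0 (ltW e2).
by split; lra.
Unshelve. all: by end_near. Qed.

Lemma m_le_scale (A : nat) : \forall n \near \oo, A%:R * (m n)%:R <= n%:R * T1 (m n).
Proof.
have e0 : 0 < (32 * A.+1%:R)^-1 :> R by rewrite invr_gt0 mulr_gt0.
have hs := near_B m_large (ell_small Hmu e0); have he := m_ell.
near=> n.
have [e1 _] : (m n)%:R <= 32 * (n%:R * ell (m n)) /\ n%:R * ell (m n) <= 64 * (m n)%:R.
  by near: n; exact: he.
have e2 : ell (m n) <= (32 * A.+1%:R)^-1 * T1 (m n) by near: n; exact: hs.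
apply: (@le_trans _ _ (A.+1%:R * (m n)%:R)); first by rewrite ler_wpM2r // ler_nat.
apply: le_trans (ler_wpM2l _ e1) _ => //.
move: e2; rewrite [leRHS]mulrC ler_pdivlMr ?mulr_gt0 // => e2.
have := ler_wpM2l (ler0n R n) e2; lra.
Unshelve. all: by end_near. Qed.

Variable B : nat -> nat.
Hypothesis BP : forall n k, (n%:R * T1 (m n) <= k%:R) = (B n <= k)%N.

Lemma scale_ge n : n%:R * T1 (m n) <= (B n)%:R.
Proof. by rewrite BP. Qed.

Lemma scale_le n : (B n)%:R <= n%:R * T1 (m n) + 1.
Proof.
case E : (B n) => [|k]; first by rewrite addr_ge0 // mulr_ge0 // (T1_ge0 Hmu).
have : ~~ (n%:R * T1 (m n) <= k%:R) by rewrite BP E ltnn.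
rewrite -ltNge -natr1; lra.
Qed.

Lemma scale_large (K : nat) : \forall n \near \oo, (K <= B n)%N.
Proof.
have h1 := m_large K; have h2 := m_le_scale 1; near=> n.
apply: (@leq_trans (m n)); first by near: n; exact: h1.
rewrite -(ler_nat R); apply: le_trans (scale_ge n).
have : 1%:R * (m n)%:R <= n%:R * T1 (m n) by near: n; exact: h2.
by rewrite mul1r.
Unshelve. all: by end_near. Qed.

(** As [B n] is [n * T1 (m n)] rounded up, the tails at [m n] and [B n] must agree to first order.
    By [T1_diff] and [m_ell], [n] times their difference is at most 512 times the square root of
    [m n * B n], and [m n] is negligible against [B n]. *)
Lemma scale_fix (e : R) : 0 < e ->
  \forall n \near \oo, (1 - e) * (B n)%:R <= n%:R * T1 (B n) <= (1 + e) * (B n)%:R.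
Proof.
move=> e0.
have [A hA] := nat_above (1024 / e).
have [C hC] := nat_above (2 / e).
have [k0 [k00 H]] := T1_diff Hmu.
have h1 := m_large k0; have h2 := m_le_scale (A ^ 2).+1; have h3 := m_ell.
have h4 := scale_large C.
near=> n.
have mk : (k0 <= m n)%N by near: n; exact: h1.
have m0 : (0 < m n)%N by exact: leq_trans mk.
have sm : (A ^ 2).+1%:R * (m n)%:R <= n%:R * T1 (m n) by near: n; exact: h2.
have [_ em] : (m n)%:R <= 32 * (n%:R * ell (m n)) /\ n%:R * ell (m n) <= 64 * (m n)%:R.
  by near: n; exact: h3.
have BC : (C <= B n)%N by near: n; exact: h4.
have b1 := scale_ge n; have b2 := scale_le n.
have AmB : ((A ^ 2).+1 * m n <= B n)%N by rewrite -(ler_nat R) natrM; apply: le_trans b1.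
have mB : (m n <= B n)%N by apply: leq_trans AmB; rewrite leq_pmull.
have T1le := ler_wpM2l (ler0n R n) (T1_le Hmu mB).
apply/andP; split; last first.
  apply: (le_trans T1le); apply: (le_trans b1).
  by rewrite ler_peMl // lerDl ltW.
have r0 := rt_gt0 R m0.
have rA : A%:R * rt (m n) <= rt (B n).
  rewrite -[A%:R](ger0_norm (ler0n R A)) -sqrtr_sqr -sqrtrM ?sqr_ge0 // ler_wsqrtr //.
  rewrite -natrX -natrM ler_nat.
  by apply: leq_trans AmB; rewrite leq_mul2r leqnSn orbT.
have D := H _ _ mk mB.
have D2 : (n%:R * T1 (m n) - n%:R * T1 (B n)) * rt (m n) <= 512 * (rt (B n) * (rt (m n) * rt (m n))).
  have := ler_wpM2l (ler0n R n) D.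
  have : rt (B n) * (n%:R * ell (m n)) <= rt (B n) * (64 * (m n)%:R) by rewrite ler_wpM2l // sqrtr_ge0.
  rewrite -[(m n)%:R]rt_sqr; lra.
have D3 : n%:R * T1 (m n) - n%:R * T1 (B n) <= 512 * (rt (B n) * rt (m n)).
  rewrite -(ler_pM2r r0); apply: le_trans D2 _; lra.
have D4 : 512 * (rt (B n) * rt (m n)) <= e / 2 * (B n)%:R.
  have : 1024 * rt (m n) <= e * rt (B n).
    move: hA; rewrite ler_pdivrMr // => hA.
    have := ler_wpM2r (ltW r0) hA; have := ler_wpM2l (ltW e0) rA; lra.
  move=> h; have := ler_wpM2l (sqrtr_ge0 (B n)%:R : 0 <= rt (B n)) h.
  rewrite -(rt_sqr R (B n)); lra.
have D5 : 1 <= e / 2 * (B n)%:R.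
  move: hC; rewrite ler_pdivrMr // => hC.
  have : e * C%:R <= e * (B n)%:R by rewrite ler_wpM2l ?(ltW e0) // ler_nat.
  lra.
lra.
Unshelve. all: by end_near. Qed.

Lemma scale_tail : \forall n \near \oo,
  n%:R * tailE mu (n%:R * T1 (m n)) <= n%:R * T1 (m n).
Proof.
have h2 := m_le_scale 1; near=> n; rewrite ler_wpM2l // -(tailE_nat Hmu (m n)).
apply: (tailE_le Hmu); rewrite -[leLHS]mul1r (tailE_nat Hmu).
by near: n; exact: h2.
Unshelve. all: by end_near. Qed.

End Scale.

(** * Transfer of bad events from conditioned trees to free words *)

Section Transfer.
Variables (R : realType) (mu : nat -> R).
Hypothesis Hmu : H_mu mu.
Local Notation T0 := (T0 mu).
Local Notation T1 := (T1 mu).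
Local Notation walk := (@walk R).
Let mu0 := mu_ge0 Hmu.
Variable B : nat -> nat.
Hypothesis B_large : forall K : nat, \forall n \near \oo, (K <= B n)%N.
Hypothesis B_scale : forall e : R, 0 < e ->
  \forall n \near \oo, (1 - e) * (B n)%:R <= n%:R * T1 (B n) <= (1 + e) * (B n)%:R.

Definition in_window (e : R) n d := `|d%:R - (B n)%:R| <= e * (B n)%:R.

Lemma mu_in_window (e : R) : e <= 2^-1 -> \forall n \near \oo, forall d,
  in_window e n d -> mu d <= 32 * mu (B n).
Proof.
move=> e2; have [k0 H] := mu_window Hmu; have h := B_large k0.*2.
near=> n => d dB.
have kB : (k0.*2 <= B n)%N by near: n; exact: h.
have : e * (B n)%:R <= 2^-1 * (B n)%:R by rewrite ler_wpM2r.
move: dB; rewrite /in_window ler_norml => /andP[l u] h2.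
have u2 : (d <= (B n).*2)%N by rewrite -(ler_nat R) -muln2 natrM; lra.
have l2 : (B n <= d.*2)%N by rewrite -(ler_nat R) -muln2 natrM; lra.
apply: H => //; move: kB l2; clear; lia.
Unshelve. all: by end_near. Qed.

(** Words without a letter in the window are covered by [local_upper]. In the others such a letter
    is rotated to the front: it has weight at most [32 * mu (B n)] and is determined by the
    remaining letters, which then are free except for [G]. *)
Lemma Pr_luk_bad (e kappa : R) : 0 < e -> e <= 2^-1 -> 0 < kappa -> \forall n \near \oo,
  forall (A G : pred (seq nat)),
  (forall p d s, A (p ++ d :: s) -> in_window e n d -> G (s ++ p)) ->
  Pr mu n n (fun w => luk w && A w) <= (kappa + 32 * Pr mu n n.-1 G) * mu (B n).
Proof.
move=> e0 e2 k0; have hu := local_upper Hmu B_large B_scale e0 k0.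
have hm := mu_in_window e2.
near=> n.
have U : forall M, Pr mu M n (fun w => ((sumn w).+1 == n) &&
    all (fun d => e * (B n)%:R < `|d%:R - (B n)%:R|) w) <= kappa * (n%:R * mu (B n)).
  by near: n; exact: hu.
have W : forall d, in_window e n d -> mu d <= 32 * mu (B n) by near: n; exact: hm.
have n0 : (0 < n)%N by near: n; exact: nbhs_infty_gt.
move=> A G H; pose F := all (fun d : nat => ~~ in_window e n d).
have UF : Pr mu n n (fun w => luk w && F w) <= kappa * mu (B n).
  have nR : 0 < n%:R :> R by rewrite ltr0n.
  rewrite -(ler_pM2l nR) mulrCA; apply: le_trans (U n).
  apply: le_trans (Pr_luk_le mu0 n n (_ : forall i w, F (rot i w) = F w)) _.
    by move=> i w; apply: eq_all_r => x; rewrite mem_rot.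
  apply: Pr_le => // w _ /andP[-> /allP h]; apply/allP => d /h.
  by rewrite /in_window -ltNge.
rewrite mulrDl.
apply: le_trans (Pr_union mu0 (_ : forall w, _ -> _ -> (luk w && F w) || (luk w && (A w && ~~ F w)))) (lerD UF _).
  by move=> w _ /andP[lw Aw]; case FE : (F w); rewrite lw /= ?Aw.
have DP w : luk w -> A w && ~~ F w -> exists p d s,
   [/\ w = p ++ d :: s, in_window e n d & G (s ++ p)].
  move=> _ /andP[Aw]; rewrite -has_predC => /hasP[d dw] /negPn dB.
  case/splitPr: dw Aw => p s Aw; exists p, d, s; split=> //; exact: H Aw dB.
have := @Pr_luk_mark _ _ mu0 n (sum_mu_le1 Hmu n) n.-1 _ _ (fun _ => G) DP.
rewrite prednK // => /le_trans; apply.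
apply: (@le_trans _ _ (\sum_(0 <= d < n | in_window e n d) (32 * mu (B n)) *
  Pr mu n n.-1 (fun u => ((d + sumn u)%N == n.-1) && G u))).
  by apply: ler_sum => d Dd; rewrite ler_wpM2r ?Pr_ge0 // W.
rewrite -big_distrr /= mulrAC ler_wpM2r // ler_wpM2l // -Ex_sum //.
apply: Ex_le => // u _.
apply: (@le_trans _ _ (\sum_(0 <= d < n | in_window e n d) ((d + sumn u)%N == n.-1)%:R * (G u)%:R)).
  by apply: ler_sum => d _; rewrite -natrM mulnb.
rewrite -big_distrl /= ler_piMl // (le_trans (@sum_indic_sub _ _ _ _ _)) //.
by case: in_window.
Unshelve. all: by end_near. Qed.

Lemma PGW_dfs_bad (e kappa : R) : 0 < e -> e <= 2^-1 -> 0 < kappa -> \forall n \near \oo,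
  forall (Bad : set tree) (G : pred (seq nat)),
  (forall t p d s, Bad t -> dfs_word t = p ++ d :: s -> tsize t = n -> in_window e n d ->
     G (s ++ p)) ->
  PGW mu [set t | tsize t = n /\ Bad t] <= (kappa + 32 * Pr mu n n.-1 G) * mu (B n).
Proof.
move=> e0 e2 k0; have h := Pr_luk_bad e0 e2 k0; near=> n => Bad G H.
pose A w := `[< exists t, [/\ dfs_word t = w, tsize t = n & Bad t] >].
apply: le_trans (PGW_dfs_le mu0 (_ : forall t, _ -> tsize t = n /\ A (dfs_word t))) _.
  by move=> t [tn bt]; split=> //; apply/asboolP; exists t.
have : forall p d s, A (p ++ d :: s) -> in_window e n d -> G (s ++ p).
  by move=> p d s /asboolP[t [tw tn bt]] dB; exact: H bt tw tn dB.
by move: A G {H}; near: n; exact: h.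
Unshelve. all: by end_near. Qed.

Lemma PGW_bfs_bad (e kappa : R) : 0 < e -> e <= 2^-1 -> 0 < kappa -> \forall n \near \oo,
  forall (Bad : set tree) (G : pred (seq nat)),
  (forall t p d s, Bad t -> bfs_word n [:: t] = p ++ d :: s -> tsize t = n -> in_window e n d ->
     G (s ++ p)) ->
  PGW mu [set t | tsize t = n /\ Bad t] <= (kappa + 32 * Pr mu n n.-1 G) * mu (B n).
Proof.
move=> e0 e2 k0; have h := Pr_luk_bad e0 e2 k0; near=> n => Bad G H.
pose A w := `[< exists t, [/\ bfs_word n [:: t] = w, tsize t = n & Bad t] >].
apply: le_trans (PGW_bfs_le mu0 (_ : forall t, _ -> tsize t = n /\ A (bfs_word n [:: t]))) _.
  by move=> t [tn bt]; split=> //; apply/asboolP; exists t.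
have : forall p d s, A (p ++ d :: s) -> in_window e n d -> G (s ++ p).
  by move=> p d s /asboolP[t [tw tn bt]] dB; exact: H bt tw tn dB.
by move: A G {H}; near: n; exact: h.
Unshelve. all: by end_near. Qed.

Lemma PGW_size_lower : \forall n \near \oo,
  0 < mu (B n) /\ mu (B n) / 64 <= PGW mu [set t | tsize t = n].
Proof.
have hl := local_lower Hmu B_large B_scale; have h2 := B_le_n Hmu B_large B_scale 2.
have hp := near_B B_large (mu_pos_near Hmu).
near=> n; split; first by near: n; exact: hp.
have n0 : 0 < n%:R :> R by rewrite ltr0n; near: n; exact: nbhs_infty_gt.
apply: le_trans (PGW_size_ge mu0 n n).
rewrite -(ler_pM2l n0); apply: le_trans (Pr_luk_ge mu0 n n).
have B2 : (2 * B n <= n)%N by near: n; exact: h2.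
rewrite mulrA; move: B2; have : forall M, (2 * B n <= M)%N ->
  n%:R * mu (B n) / 64 <= Pr mu M n (fun w => (sumn w).+1 == n) by near: n; exact: hl.
by apply.
Unshelve. all: by end_near. Qed.

Lemma condP_cvg (Bad : nat -> set tree) (delta : R) : 0 < delta ->
  (forall kappa : R, 0 < kappa -> \forall n \near \oo,
    PGW mu [set t | tsize t = n /\ Bad n t] <= kappa * mu (B n)) ->
  \forall n \near \oo, condP mu n (Bad n) < delta.
Proof.
move=> d0 H; have h := H (delta / 128) ltac:(by rewrite divr_gt0); have hl := PGW_size_lower.
near=> n.
have [m0 ml] : 0 < mu (B n) /\ mu (B n) / 64 <= PGW mu [set t | tsize t = n].
  by near: n; exact: hl.
have b : PGW mu [set t | tsize t = n /\ Bad n t] <= delta / 128 * mu (B n).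
  by near: n; exact: h.
have P0 : 0 < PGW mu [set t | tsize t = n] by apply: lt_le_trans ml; rewrite divr_gt0.
rewrite /condP ltr_pdivrMr //; apply: (le_lt_trans b).
have := ler_wpM2l (ltW d0) ml; have : 0 < delta * mu (B n) by rewrite mulr_gt0.
lra.
Unshelve. all: by end_near. Qed.

End Transfer.

(** * Consequences of small deviations, and the depth of a free word *)

Section WordEvents.
Variables (R : realType) (mu : nat -> R).
Hypothesis Hmu : H_mu mu.
Local Notation T0 := (T0 mu).
Local Notation T1 := (T1 mu).
Local Notation Q := (Q mu).
Local Notation walk := (@walk R).
Let mu0 := mu_ge0 Hmu.

Lemma walk_cat u v : walk (u ++ v) = walk u + walk v.
Proof. exact: big_cat. Qed.

(** A value of the original walk is a combination of values of the rotated walk: two of them before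
    the letter [d], three of them and [d] after it. The drift terms only lower the result. *)
Lemma walk_rot_le n (b e : R) p d s j : 0 <= b -> 0 <= e -> (size (s ++ p)).+1 = n ->
  ~~ deviates n b e (s ++ p) -> (j <= n)%N ->
  walk (take j (p ++ d :: s)) <= 3 * (e * b) + d%:R.
Proof.
move=> b0 e0 sz nd jn; have eb : 0 <= e * b by rewrite mulr_ge0.
have drift k : 0 <= k%:R / n%:R * b by rewrite mulr_ge0 // divr_ge0.
have d0 : 0 <= d%:R :> R by [].
have nds := not_deviates nd (_ : (size s <= size (s ++ p))%N).
move: nds; rewrite size_cat leq_addr take_size_cat // => /(_ isT).
rewrite ltr_norml => /andP[s1 s2].
have [jp|pj] := leqP j (size p).
  have := not_deviates nd (_ : (size s + j <= size (s ++ p))%N).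
  rewrite size_cat leq_add2l => /(_ jp); rewrite takeD take_size_cat // drop_size_cat //.
  rewrite walk_cat ltr_norml => /andP[_ h].
  rewrite takel_cat //; have := drift j.
  move: h; rewrite natrD; lra.
have := not_deviates nd (leqnn _); rewrite take_size walk_cat ltr_norml => /andP[_ h].
pose k := (j - (size p).+1)%N; have jE : j = (size p + k.+1)%N by rewrite /k addnS -addSn subnKC.
have ks : (k <= size s)%N.
  by move: jn; rewrite -sz jE size_cat addnS ltnS [(size s + _)%N]addnC leq_add2l.
have := not_deviates nd (_ : (k <= size (s ++ p))%N).
rewrite size_cat (leq_trans ks (leq_addr _ _)) takel_cat // => /(_ isT).
rewrite ltr_norml => /andP[_ h'].
have -> : take j (p ++ d :: s) = p ++ d :: take k s.
  by rewrite jE take_cat ltnNge leq_addr /= addKn.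
have -> : walk (p ++ d :: take k s) = walk p + (d%:R - 1) + walk (take k s).
  by rewrite walk_cat -addrA; congr (_ + _); exact: big_cons.
have := drift k; have := drift (size p); move: h; rewrite size_cat natrD; lra.
Qed.

(** Without deviation the walk stays above [- 3 / 2 * b], so fewer than [2 * b] trees are completed
    and the stack is never exhausted. Rounding needs [b >= 2]. *)
Lemma reach_of_depth n (b : nat) u k H : (2 <= b)%N -> (size u <= n)%N ->
  ~~ deviates n (b%:R : R) 2^-1 u -> (k < size u)%N -> (H <= depth (take k u))%N ->
  reach u (nseq (2 * b) H).
Proof.
move=> b2 un nd ku hH; apply/reachP; exists k.
have mk : (mindepth (take k u) < 2 * b)%N.
  rewrite -(@prednK (2 * b)) ?muln_gt0 ?(leq_trans _ b2) // ltnS.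
  apply/mindepth_leP => j; rewrite size_takel ?(ltnW ku) // => jk.
  have ju : (j <= size u)%N by rewrite (leq_trans jk) // ltnW.
  rewrite take_takel //; have := not_deviates nd ju.
  rewrite walkE size_takel // ltr_norml => /andP[h _].
  have B2 : 2 <= b%:R :> R by rewrite ler_nat.
  have : j%:R / n%:R * b%:R <= b%:R :> R.
    rewrite ler_piMl //; have [->|n0] := posnP n; first by rewrite invr0 mulr0.
    by rewrite ler_pdivrMr ?ltr0n // mul1r ler_nat (leq_trans ju).
  rewrite -(ler_nat R) natrD -subn1 natrB ?muln_gt0 ?(leq_trans _ b2) // natrM; lra.
by split=> //; rewrite ?size_nseq // nth_nseq mk.
Qed.

Lemma Pr_fin_nseq M n K h : 0 < K%:R * Q h -> Pr mu M n (fun w => fin w (nseq K h)) <= (K%:R * Q h)^-1.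
Proof.
move=> KQ; apply: le_trans (expRN_le_inv KQ).
apply: le_trans (Pr_fin mu0 (sum_mu_le1 Hmu M) (erefl : Q 0%N = 1) (Q01 Hmu) (QS_le Hmu M) _ _) _.
rewrite big_nseq iter_mulr_1 -mulrN expRM_natl.
by rewrite lerXn2r ?nnegrE ?expR_ge0 ?expR_ge1Dx //; case/andP: (Q01C Hmu h).
Qed.

Lemma Pr_reach_nseq M n K h : Pr mu M n (fun w => reach w (nseq K h)) <= K%:R * Q h.
Proof.
apply: le_trans (Pr_reach mu0 (sum_mu_le1 Hmu M) (erefl : Q 0%N = 1) (Q01 Hmu) (QS_ge Hmu M) _ _) _.
rewrite big_nseq iter_mulr_1; have := bernoulli_le K (Q01 Hmu h); lra.
Qed.

Variable B : nat -> nat.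
Hypothesis B_large : forall K : nat, \forall n \near \oo, (K <= B n)%N.
Hypothesis B_scale : forall e : R, 0 < e ->
  \forall n \near \oo, (1 - e) * (B n)%:R <= n%:R * T1 (B n) <= (1 + e) * (B n)%:R.

(** By [Ex_depth] the question is the sum of [staypos], bounded by [sum_staypos_le] with [x] about
    [B n / 2]: the walk is below [- x] at time [n] with probability at least [2^-1]. *)
Lemma Ex_depth_le : \forall n \near \oo,
  (B n)%:R * Ex mu n n.-1 (fun w => (depth w)%:R) <= 24 * n%:R.
Proof.
have q0 : 0 < 4^-1 :> R by rewrite invr_gt0.
have hl := lln Hmu B_large B_scale q0 q0.
have hs := scale_facts Hmu B_large B_scale (ltn0Sn 0) q0.
have h1 := B_le_n Hmu B_large B_scale 1; have h2 := B_large 4.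
near=> n.
have L : forall m M, (m <= n)%N ->
  Pr mu M m (fun w => 4^-1 * (B n)%:R <= walk w + m%:R / n%:R * (B n)%:R) <= 4^-1 /\
  Pr mu M m (fun w => walk w + m%:R / n%:R * (B n)%:R <= - (4^-1 * (B n)%:R)) <= 4^-1.
  by near: n; exact: hl.
have [_ _ _ tn] : [/\ (0 < B n %/ 1)%N, `|n%:R * T1 (B n %/ 1) - (B n)%:R| <= 4^-1 * (B n)%:R,
      n%:R * trvar mu (B n %/ 1) <= 4^-1 * (B n)%:R ^+ 2 & n%:R * T0 (B n %/ 1) <= 4^-1].
  by near: n; exact: hs.
have Bn : (1 * B n <= n)%N by near: n; exact: h1.
have B4 : (4 <= B n)%N by near: n; exact: h2.
have n0 : (0 < n)%N by near: n; exact: nbhs_infty_gt.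
rewrite divn1 in tn; rewrite mul1n in Bn.
have [L1 _] := L n n (leqnn _); rewrite divff ?mul1r ?pnatr_eq0 -?lt0n // in L1.
have P1 : 1 - 4^-1 <= Pr mu n n xpredT.
  apply: le_trans (Pr_true_ge Hmu n n); rewrite lerD2l lerN2; apply: le_trans tn.
  by rewrite ler_wpM2l // (T0_le Hmu).
set x := (B n %/ 2)%N.
have x2 : (B n)%:R / 4 <= x%:R :> R.
  rewrite ler_pdivrMr // -natrM ler_nat /x; have := divn_eq (B n) 2; have := ltn_pmod (B n) (ltn0Sn 1).
  move: B4; clear; lia.
have x3 : x%:R <= (B n)%:R / 2 :> R.
  rewrite ler_pdivlMr // -natrM ler_nat; exact: leq_trunc_div.
have P2 : 2^-1 <= Pr mu n n (fun w => (sumn w + x <= n)%N).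
  have : Pr mu n n xpredT <= Pr mu n n (fun w => 4^-1 * (B n)%:R <= walk w + (B n)%:R) +
     Pr mu n n (fun w => (sumn w + x <= n)%N).
    apply: Pr_union => // w /andP[/eqP sw _] _.
    case: leP => //= h; rewrite -(ler_nat R) natrD; move: h; rewrite walkE sw.
    have : 0 <= (B n)%:R :> R by []. lra.
  lra.
have S := sum_staypos_le mu0 (sum_mu_le1 Hmu n) x (ltnSn n.*2).
set s := \sum_(0 <= j < n.+1) _ in S.
have ED : Ex mu n n.-1 (fun w => (depth w)%:R) <= s.
  apply: le_trans (Ex_depth mu0 (sum_mu_le1 Hmu n) n.-1) _.
  rewrite -(big_add1 _ _ 0 n.-1.+1 xpredT (staypos mu n)) prednK // /s.
  rewrite [leRHS]big_nat_recr //= [X in _ <= X + _]big_ltn // addrAC lerDr.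
  by rewrite addr_ge0 // Pr_ge0.
have s0 : 0 <= s by apply: sumr_ge0 => j _; exact: Pr_ge0.
have Bp : 0 <= (B n)%:R :> R by [].
apply: le_trans (ler_wpM2l Bp ED) _.
have xs : (B n)%:R / 4 * 2^-1 * s <= x%:R * Pr mu n n (fun w => (sumn w + x <= n)%N) * s.
  rewrite ler_wpM2r // ler_pM // ?divr_ge0 //.
have E : n.*2.+1%:R = 2 * n%:R + 1 :> R by rewrite -natr1 -muln2 natrM mulrC.
have := le_trans xs S; rewrite E.
have : 1 <= n%:R :> R by rewrite ler1n.
lra.
Unshelve. all: by end_near. Qed.

End WordEvents.

(** * Union bound for the tree measure *)

Section PGWUnion.
Variables (R : realType) (mu : nat -> R).
Hypothesis mu0 : forall k, 0 <= mu k.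

Lemma esum_tweight_fin n (A : set tree) :
  (\esum_(t in [set t | tsize t = n] `&` A) (tweight mu t)%:E)%E \is a fin_num.
Proof.
rewrite ge0_fin_numE ?esum_tweight_ge0 //.
apply: le_lt_trans (ltry (Pr mu n n xpredT)); apply: (@esum_tweight_le _ _ mu0 _ _ _ dfs_word).
- by move=> t _; exact: tweight_dfs.
- by move=> t [/= tn _]; have := luk_word (dfs_word_luk t); rewrite size_dfs_word tn => ->.
- by move=> t t' _ _; apply: dfs_word_inj.
Qed.

Lemma PGW_union n (A B C : set tree) : (forall t, A t -> B t \/ C t) ->
  PGW mu [set t | tsize t = n /\ A t] <=
  PGW mu [set t | tsize t = n /\ B t] + PGW mu [set t | tsize t = n /\ C t].
Proof.
move=> H; have f := esum_tweight_fin n.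
rewrite /PGW -fineD ?f //; apply: fine_le; rewrite ?fin_numD ?f //.
rewrite (esum_mkcondr _ A) (esum_mkcondr _ B) (esum_mkcondr _ C) -esumD; last 2 first.
- by move=> t _; case: ifP => // _; rewrite lee_fin (tweight_dfs mu) wt_ge0.
- by move=> t _; case: ifP => // _; rewrite lee_fin (tweight_dfs mu) wt_ge0.
have w0 t : (0 <= (tweight mu t)%:E)%E by rewrite lee_fin (tweight_dfs mu) wt_ge0.
apply: le_esum => t _; case: ifPn => [|_]; last by apply: adde_ge0; case: ifP.
rewrite inE => /H[] h.
- by rewrite (mem_set h) leeDl //; case: ifP.
- by rewrite (mem_set h) leeDr //; case: ifP.
Qed.

End PGWUnion.

(** * The four one-sided estimates and the theorem *)

Section Conclusion.
Variables (R : realType) (mu : nat -> R).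
Hypothesis Hmu : H_mu mu.
Local Notation T1 := (T1 mu).
Local Notation Gr := (Gr mu).
Local Notation walk := (@walk R).
Let mu0 := mu_ge0 Hmu.
Variables (B : nat -> nat) (b : nat -> R).
Hypothesis B_large : forall K : nat, \forall n \near \oo, (K <= B n)%N.
Hypothesis B_scale : forall e : R, 0 < e ->
  \forall n \near \oo, (1 - e) * (B n)%:R <= n%:R * T1 (B n) <= (1 + e) * (B n)%:R.
Hypothesis b_le_B : forall n, b n <= (B n)%:R.
Hypothesis B_le_b : forall n, (B n)%:R <= b n + 1.
Hypothesis b_tail : \forall n \near \oo, n%:R * tailE mu (b n) <= b n.

Lemma b_large (C : R) : \forall n \near \oo, C <= b n.
Proof.
have [K hK] := nat_above (C + 1); have h := B_large K; near=> n.
have : (K <= B n)%N by near: n; exact: h.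
rewrite -(ler_nat R); have := B_le_b n; lra.
Unshelve. all: by end_near. Qed.

Lemma ceil_between (x : R) : 0 <= x -> exists h : nat, x <= h%:R <= x + 1.
Proof.
move=> x0; have [h hP] := nat_ceil x; exists h; rewrite hP leqnn /=.
case: h hP => [|h] hP; first by rewrite addr_ge0.
have : ~~ (x <= h%:R) by rewrite hP ltnn.
rewrite -ltNge -natr1; lra.
Qed.

Lemma small_half (x : R) : 0 < x -> exists e : R, [/\ 0 < e, e <= 2^-1 & e <= x].
Proof.
move=> x0; exists (Num.min x 2^-1).
split; [by rewrite lt_min x0 /= invr_gt0|by rewrite ge_min lexx orbT|by rewrite ge_min lexx].
Qed.

(** The children of the big vertex alone are enough, so nothing is asked of the other letters: [G]
    is empty. *)
Lemma width_lower (eps kappa : R) : 0 < eps -> 0 < kappa -> \forall n \near \oo,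
  PGW mu [set t | tsize t = n /\ (width t)%:R < (1 - eps) * b n] <= kappa * mu (B n).
Proof.
move=> e0 k0; have [e [e1 e2 e3]] : exists e : R, [/\ 0 < e, e <= 2^-1 & e <= eps].
  exact: small_half.
have h := PGW_dfs_bad Hmu B_large B_scale e1 e2 k0; have hb := b_large 0.
near=> n.
have b0 : 0 <= b n by near: n; exact: hb.
have H : forall (Bad : set tree) (G : pred (seq nat)),
  (forall t p d s, Bad t -> dfs_word t = p ++ d :: s -> tsize t = n -> in_window B e n d ->
     G (s ++ p)) ->
  PGW mu [set t | tsize t = n /\ Bad t] <= (kappa + 32 * Pr mu n n.-1 G) * mu (B n).
  by near: n; exact: h.
apply: le_trans (H (fun t => (width t)%:R < (1 - eps) * b n) pred0 _) _; last first.
  by rewrite /Pr Ex_zero mulr0 addr0.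
move=> t p d s bt tw _; rewrite /in_window ler_norml => /andP[l _]; exfalso.
have dw : (d <= width t)%N by apply: size_child_le_width; rewrite tw mem_cat mem_head orbT.
have : (1 - eps) * b n <= (1 - e) * b n by rewrite ler_wpM2r //; lra.
have : (1 - e) * b n <= (1 - e) * (B n)%:R by rewrite ler_wpM2l //; lra.
move: dw bt; rewrite -(ler_nat R); lra.
Unshelve. all: by end_near. Qed.

Lemma width_upper (eps kappa : R) : 0 < eps -> 0 < kappa -> \forall n \near \oo,
  PGW mu [set t | tsize t = n /\ (1 + eps) * b n < (width t)%:R] <= kappa * mu (B n).
Proof.
move=> e0 k0; have [e [e1 e2 e3]] : exists e : R, [/\ 0 < e, e <= 2^-1 & e <= eps / 8].
  by apply: small_half; rewrite divr_gt0.
have k2 : 0 < kappa / 2 by rewrite divr_gt0.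
have k64 : 0 < kappa / 64 by rewrite divr_gt0.
have h := PGW_bfs_bad Hmu B_large B_scale e1 e2 k2; have hb := b_large (8 / eps).
have hw := walk_sup Hmu B_large B_scale e1 k64.
have h1 := B_le_n Hmu B_large B_scale 1.
near=> n.
have bn : 8 / eps <= b n by near: n; exact: hb.
have Bn : (1 * B n <= n)%N by near: n; exact: h1.
have n0 : (0 < n)%N by near: n; exact: nbhs_infty_gt.
have H : forall (Bad : set tree) (G : pred (seq nat)),
  (forall t p d s, Bad t -> bfs_word n [:: t] = p ++ d :: s -> tsize t = n -> in_window B e n d ->
     G (s ++ p)) ->
  PGW mu [set t | tsize t = n /\ Bad t] <= (kappa / 2 + 32 * Pr mu n n.-1 G) * mu (B n).
  by near: n; exact: h.
have W : forall m M, (m <= n)%N -> (B n <= M)%N -> Pr mu M m (deviates n (B n)%:R e) <= kappa / 64.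
  by near: n; exact: hw.
rewrite mul1n in Bn.
apply: le_trans (H (fun t => (1 + eps) * b n < (width t)%:R) (deviates n (B n)%:R e) _) _; last first.
  by rewrite ler_wpM2r //; have := W n.-1 n (leq_pred n) Bn; lra.
move=> t p d s bt tw tn; rewrite /in_window ler_norml => /andP[_ u].
apply/negP => /negP nd.
have [j jt] := width_le_bfs t; rewrite tn tw => wj.
have sz : size (p ++ d :: s) = n by rewrite -tw size_bfs_word /forest_size /= addn0 tn.
have sz' : (size (s ++ p)).+1 = n by rewrite -sz !size_cat /= addnS addnC.
rewrite tn in jt.
have := walk_rot_le d (ler0n R (B n)) (ltW e1) sz' nd jt.
rewrite walkE size_takel ?sz //.
move: wj; rewrite -(ler_nat R) !natrD => wj wk.
have eB : e * (B n)%:R <= e * (b n + 1) by rewrite ler_wpM2l ?(ltW e1).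
have b0 : 0 <= b n by apply: le_trans bn; rewrite divr_ge0 // ltW.
have eb : e * b n <= eps / 8 * b n by rewrite ler_wpM2r.
move: bn; rewrite ler_pdivrMr // => bn.
have := B_le_b n; lra.
Unshelve. all: by end_near. Qed.

Lemma height_lower (eps kappa : R) : 0 < eps -> 0 < kappa -> \forall n \near \oo,
  PGW mu [set t | tsize t = n /\ (height t)%:R < (1 - eps) * Gr (b n)] <= kappa * mu (B n).
Proof.
move=> e0 k0; have [e [e1 e2 e3]] : exists e : R, [/\ 0 < e, e <= 2^-1 & e <= eps].
  exact: small_half.
have k2 : 0 < kappa / 2 by rewrite divr_gt0.
have p2 : 0 < 2^-1 :> R by rewrite invr_gt0.
have h := PGW_dfs_bad Hmu B_large B_scale p2 (lexx _) k2.
(* The [K] trees with [K >= B n / 4] give [K * Q k >= A.+1 / 4 >= 64 / kappa], so that 32 times the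
   bound of [Pr_fin_nseq] is at most [kappa / 2]. *)
have [A hA] := nat_above (256 / kappa).
have e21 : 0 < e / 2 < 1 by lra.
have [b1 b11 HQ] := Q_lower Hmu (ltn0Sn A) e21.
have [b2 b21 HG] := Gr_unbounded Hmu (2 / e).
have hb := b_large (b1 + b2 + 2); have h2 := B_large 4.
near=> n.
have bn : b1 + b2 + 2 <= b n by near: n; exact: hb.
have B4 : (4 <= B n)%N by near: n; exact: h2.
have H : forall (Bad : set tree) (G : pred (seq nat)),
  (forall t p d s, Bad t -> dfs_word t = p ++ d :: s -> tsize t = n -> in_window B (2^-1 : R) n d ->
     G (s ++ p)) ->
  PGW mu [set t | tsize t = n /\ Bad t] <= (kappa / 2 + 32 * Pr mu n n.-1 G) * mu (B n).
  by near: n; exact: h.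
have g2 : 2 / e <= Gr (b n) by apply: HG; lra.
have g0 : 0 <= Gr (b n) by apply: le_trans g2; rewrite divr_ge0 // ltW.
have [k /andP[hk1 hk2]] := @ceil_between ((1 - e) * Gr (b n)) ltac:(rewrite mulr_ge0 //; lra).
have q : A.+1%:R <= b n * Q mu k.
  apply: HQ; first by lra.
  apply: (le_trans hk2); move: g2; rewrite ler_pdivrMr //; lra.
pose K := (B n %/ 2)%N.
have K4 : (B n)%:R / 4 <= K%:R :> R.
  rewrite ler_pdivrMr // -natrM ler_nat /K; have := divn_eq (B n) 2; have := ltn_pmod (B n) (ltn0Sn 1).
  move: B4; clear; lia.
have q0 := Q_gt0 Hmu k.
have KQ : A.+1%:R / 4 <= K%:R * Q mu k.
  apply: (@le_trans _ _ (b n / 4 * Q mu k)); first by lra.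
  by rewrite (ler_wpM2r (ltW q0)) // (le_trans _ K4) // ler_pM2r // invr_gt0.
have KQ0 : 0 < K%:R * Q mu k by apply: lt_le_trans KQ; rewrite divr_gt0.
apply: le_trans (H (fun t => (height t)%:R < (1 - eps) * Gr (b n))
  (fun u => fin u (nseq K k)) _) _; last first.
  rewrite ler_wpM2r //; have := Pr_fin_nseq Hmu n n.-1 KQ0.
  have : (K%:R * Q mu k)^-1 <= kappa / 64.
    rewrite -[leRHS]invrK lef_pV2 ?posrE ?invr_gt0 ?divr_gt0 // invfM invrK.
    apply: le_trans KQ; rewrite -natr1; lra.
  lra.
move=> t p d s bt tw _; rewrite /in_window ler_norml => /andP[l _].
apply: (height_lt_fin tw).
  rewrite -(ltr_nat R); apply: lt_le_trans hk1; apply: (lt_le_trans bt).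
  by rewrite ler_wpM2r //; lra.
rewrite -(ler_nat R); have : K%:R <= (B n)%:R / 2 :> R.
  by rewrite ler_pdivlMr // -natrM ler_nat; exact: leq_trunc_div.
lra.
Unshelve. all: by end_near. Qed.

Lemma height_upper (eps kappa : R) : 0 < eps -> 0 < kappa -> \forall n \near \oo,
  PGW mu [set t | tsize t = n /\ (1 + eps) * Gr (b n) < (height t)%:R] <= kappa * mu (B n).
Proof.
move=> e0 k0.
have k2 : 0 < kappa / 2 by rewrite divr_gt0.
have e3 : 0 < eps / 3 by rewrite divr_gt0.
have p2 : 0 < 2^-1 :> R by rewrite invr_gt0.
(* Three events of probability at most [k'], each with the factor 32, add up to [kappa / 2]. *)
pose k' := kappa / 192; have k'0 : 0 < k' by rewrite divr_gt0.
have k'E : 192 * k' = kappa by rewrite /k' mulrC divfK.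
clearbody k'.
have h := PGW_dfs_bad Hmu B_large B_scale p2 (lexx _) k2.
have hw := walk_sup Hmu B_large B_scale p2 k'0.
have hd := Ex_depth_le Hmu B_large B_scale.
have [A hA] := nat_above (4 / k').
have [b1 b11 HQ] := Q_upper Hmu (ltn0Sn A) e3.
(* Rounding [k] up and counting the big vertex add 2 to the height; this is at most
   [eps / 3 * Gr (b n)]. *)
have [b2 b21 HG] := Gr_unbounded Hmu (6 / eps).
(* Markov's inequality at level [eps / 3 * Gr (b n)] with the mean bound [24 * n / B n] produces the
   72. Since [n * tl (b n) <= b n], [Gr_large] makes the height above the rotation negligible. *)
have [b3 b31 HL] := Gr_large Hmu (72 / (eps * k')).
have hb := b_large (b1 + b2 + b3 + 2); have h2 := B_large 4.
have h1 := B_le_n Hmu B_large B_scale 1.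
near=> n.
have bn : b1 + b2 + b3 + 2 <= b n by near: n; exact: hb.
have B4 : (4 <= B n)%N by near: n; exact: h2.
have Bn : (1 * B n <= n)%N by near: n; exact: h1.
have n0 : (0 < n)%N by near: n; exact: nbhs_infty_gt.
have bt0 : n%:R * tailE mu (b n) <= b n by near: n; exact: b_tail.
have ED : (B n)%:R * Ex mu n n.-1 (fun w => (depth w)%:R) <= 24 * n%:R by near: n; exact: hd.
have W : forall m M, (m <= n)%N -> (B n <= M)%N -> Pr mu M m (deviates n ((B n)%:R : R) 2^-1) <= k'.
  by near: n; exact: hw.
have H : forall (Bad : set tree) (G : pred (seq nat)),
  (forall t p d s, Bad t -> dfs_word t = p ++ d :: s -> tsize t = n -> in_window B (2^-1 : R) n d ->
     G (s ++ p)) ->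
  PGW mu [set t | tsize t = n /\ Bad t] <= (kappa / 2 + 32 * Pr mu n n.-1 G) * mu (B n).
  by near: n; exact: h.
rewrite mul1n in Bn.
have g6 : 6 / eps <= Gr (b n) by apply: HG; lra.
have g0 : 0 <= Gr (b n) by apply: le_trans g6; rewrite divr_ge0 // ltW.
have gl : 72 / (eps * k') <= Gr (b n) * tailE mu (b n) by apply: HL; lra.
have [k /andP[hk1 hk2]] := @ceil_between ((1 + eps / 3) * Gr (b n)) ltac:(rewrite mulr_ge0 //; lra).
have q : A.+1%:R * b n * Q mu k <= 1 by apply: HQ => //; lra.
have q0 := Q_gt0 Hmu k.
have PR : Pr mu n n.-1 (fun w => reach w (nseq (2 * B n) k)) <= k'.
  apply: le_trans (Pr_reach_nseq Hmu _ _ _ _) _.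
  have : (2 * B n)%:R * Q mu k <= 4 * (b n * Q mu k).
    by rewrite mulrA (ler_wpM2r (ltW q0)) // natrM; have := B_le_b n; lra.
  move=> /le_trans; apply.
  move: hA; rewrite ler_pdivrMr // => hA.
  have bq : 0 <= b n * Q mu k by rewrite mulr_ge0 ?(ltW q0) //; lra.
  have := ler_wpM2r bq hA; have := ler_wpM2l (ltW k'0) q; rewrite -[A.+1%:R]natr1.
  have : 0 <= k' * (b n * Q mu k) by rewrite mulr_ge0 // ltW.
  lra.
pose D (w : seq nat) := eps / 3 * Gr (b n) <= (depth w)%:R.
have PD : Pr mu n n.-1 D <= k'.
  have M := @markov_word _ _ mu0 n n.-1 D (fun w => (depth w)%:R) (eps / 3 * Gr (b n))
    (fun w _ => ler0n R _) (fun w _ h => h).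
  have nR : 0 < n%:R :> R by rewrite ltr0n.
  have PD0 : 0 <= Pr mu n n.-1 D by exact: Pr_ge0.
  have M1 := le_trans (ler_wpM2l (ler0n R (B n)) M) ED.
  move: gl; rewrite ler_pdivrMr ?mulr_gt0 // => gl.
  have gB : n%:R * 72 <= eps * k' * (Gr (b n) * (B n)%:R).
    have := ler_wpM2l (ltW nR) gl.
    have := ler_wpM2l g0 (le_trans bt0 (b_le_B n)).
    have ek : 0 <= eps * k' by rewrite mulr_ge0 // ltW.
    move=> h3; have := ler_wpM2l ek h3; lra.
  have gB2 := ler_wpM2r PD0 gB.
  have kM := ler_wpM2l (ltW k'0) M1.
  have n72 : 0 < n%:R * 72 :> R by rewrite mulr_gt0.
  rewrite -(ler_pM2l n72); lra.
apply: le_trans (H (fun t => (1 + eps) * Gr (b n) < (height t)%:R)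
  (fun u => deviates n ((B n)%:R : R) 2^-1 u || (reach u (nseq (2 * B n) k) || D u)) _) _; last first.
  rewrite ler_wpM2r //.
  have := Pr_or mu0 n n.-1 (deviates n ((B n)%:R : R) 2^-1) (fun u => reach u (nseq (2 * B n) k) || D u).
  have := Pr_or mu0 n n.-1 (fun u => reach u (nseq (2 * B n) k)) D.
  have := W n.-1 n (leq_pred n) Bn; lra.
move=> t p d s bt tw tn _.
case: (boolP (deviates _ _ _ _)) => //= nd.
case: (boolP (reach _ _)) => //= nr.
have sz : (size (s ++ p)).+1 = n by rewrite -tn -size_dfs_word tw !size_cat /= addnS addnC.
have : (height t <= depth (s ++ p) + 1 + k)%N.
  apply: (height_le_rot tw) => i iu; rewrite leqNgt; apply/negP => ki; case/negP: nr.
  by apply: (reach_of_depth _ _ nd iu (ltnW ki)); [exact: leq_trans B4|rewrite -sz].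
rewrite -(ler_nat R) !natrD /D; move: g6; rewrite ler_pdivrMr //; lra.
Unshelve. all: by end_near. Qed.

End Conclusion.

Theorem theorem3 (R : realType) (mu : nat -> R) (a : nat -> R) :
  H_mu mu ->
  (n%:R * tailP mu (a n)) @[n --> \oo] --> (1 : R) ->
  cvg_prob_to1 mu (fun n t => (height t)%:R / hseq mu a n) /\
  cvg_prob_to1 mu (fun n t => (width t)%:R / (n%:R * tailE mu (a n))).
Proof.
move=> Hmu Ha.
have [m mP] := choice (fun n => nat_ceil (a n)).
have TE n : tailE mu (a n) = T1 mu (m n) by exact: tailE_T1.
have m_lim : (n%:R * T0 mu (m n)) @[n --> \oo] --> (1 : R).
  by under eq_cvg => n do rewrite -(tailP_T0 Hmu (mP n)).
(* The real scale is rounded up to an integer because the local estimates are expressed with the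
   weight [mu (B n)] of one letter. *)
have [B BP] := choice (fun n => nat_ceil (n%:R * T1 mu (m n))).
pose b n := n%:R * T1 mu (m n).
have B_large := scale_large Hmu m_lim BP.
have B_scale := scale_fix Hmu m_lim BP.
have bB : forall n, b n <= (B n)%:R by exact: scale_ge.
have Bb : forall n, (B n)%:R <= b n + 1 by exact: (scale_le Hmu).
have b_tail := scale_tail Hmu m_lim.
have key (X : nat -> tree -> nat) (y : nat -> R) : (\forall n \near \oo, 0 < y n) ->
  (forall eps kappa : R, 0 < eps -> 0 < kappa -> \forall n \near \oo,
    PGW mu [set t | tsize t = n /\ (X n t)%:R < (1 - eps) * y n] <= kappa * mu (B n)) ->
  (forall eps kappa : R, 0 < eps -> 0 < kappa -> \forall n \near \oo,
    PGW mu [set t | tsize t = n /\ (1 + eps) * y n < (X n t)%:R] <= kappa * mu (B n)) ->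
  cvg_prob_to1 mu (fun n t => (X n t)%:R / y n).
  move=> y0 lo up eps delta e0 d0.
  have : \forall n \near \oo, condP mu n [set t | eps < `|(X n t)%:R / y n - 1|] < delta.
    apply: (condP_cvg Hmu B_large B_scale d0) => kappa k0.
    have k2 : 0 < kappa / 2 by rewrite divr_gt0.
    have h1 := lo eps _ e0 k2; have h2 := up eps _ e0 k2.
    near=> n.
    have yn : 0 < y n by near: n; exact: y0.
    have p1 : PGW mu [set t | tsize t = n /\ (X n t)%:R < (1 - eps) * y n] <= kappa / 2 * mu (B n).
      by near: n; exact: h1.
    have p2 : PGW mu [set t | tsize t = n /\ (1 + eps) * y n < (X n t)%:R] <= kappa / 2 * mu (B n).
      by near: n; exact: h2.
    have U := @PGW_union _ mu (mu_ge0 Hmu) n [set t | eps < `|(X n t)%:R / y n - 1|]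
      [set t | (X n t)%:R < (1 - eps) * y n] [set t | (1 + eps) * y n < (X n t)%:R].
    apply: le_trans (U _) _; last by apply: le_trans (lerD p1 p2) _; lra.
    move=> t /=; rewrite ltr_normr => /orP[h|h]; [right|left].
      by rewrite -ltr_pdivlMr //; lra.
    by rewrite -ltr_pdivrMr //; lra.
  by move=> [N _ HN]; exists N => n Nn _; exact: HN.
split.
  apply: (key (fun _ => height) (fun n => hseq mu a n)).
  - have [b1 b11 HG] := Gr_unbounded Hmu 1.
    have hb := b_large B_large Bb b1; near=> n.
    rewrite /hseq TE; apply: lt_le_trans (HG _ _) => //.
    by near: n; exact: hb.
  - move=> eps kappa e0 k0; have := height_lower Hmu B_large B_scale bB Bb e0 k0.
    by apply: filterS => n; rewrite /hseq TE.
  - move=> eps kappa e0 k0; have := height_upper Hmu B_large B_scale bB Bb b_tail e0 k0.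
    by apply: filterS => n; rewrite /hseq TE.
apply: (key (fun _ => width) (fun n => n%:R * tailE mu (a n))).
- have hb := b_large B_large Bb 1; near=> n.
  rewrite TE; apply: lt_le_trans (_ : 1 <= b n) => //.
  by near: n; exact: hb.
- move=> eps kappa e0 k0; have := width_lower Hmu B_large B_scale bB Bb e0 k0.
  by apply: filterS => n; rewrite TE.
- move=> eps kappa e0 k0; have := width_upper Hmu B_large B_scale Bb e0 k0.
  by apply: filterS => n; rewrite TE.
Unshelve. all: by end_near. Qed.
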